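(* Let $\Phi:\mathbb{S}^1\to\mathbb{S}^1$ be a $C^2$ expanding map, i.e. $|\Phi'|>1$, and let $\rho\lambda$ be its unique absolutely continuous invariant probability measure. The map $\Phi_\#:\mathscr{P}(\mathbb{S}^1)\to\mathscr{P}(\mathbb{S}^1)$ has a G\^ateaux derivative $\mathscr{L}:L^2_0(\rho\lambda)\to L^2_0(\rho\lambda)$ at $\rho\lambda$, given by $$\mathscr{L}v(x)=\sum_{y\in\Phi^{-1}(x)}\frac{\rho(y)}{\rho(x)}v(y)-\frac{\int v\,\Phi'\,\frac{\rho}{\rho\circ\Phi}}{\rho(x)\int 1/\rho},$$ where integrals are with respect to $\lambda$. Moreover the adjoint operator of $\mathscr{L}$ in $L^2_0(\rho\lambda)$ is given by $$\mathscr{L}^*u=\Phi'\,u\circ\Phi.$$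
   Context: $\mathbb{S}^1=\mathbb{R}/\mathbb{Z}$, $\lambda$ is the Lebesgue probability measure, $\mathscr{P}(\mathbb{S}^1)$ is the set of Borel probability measures on $\mathbb{S}^1$ and $\Phi_\#$ is push-forward of measures. A $C^2$ expanding map of $\mathbb{S}^1$ is a self-covering and has a unique absolutely continuous invariant probability measure $\rho\lambda$, whose density $\rho$ is positive and $C^1$ (known facts). $\mathrm{W}$ is the quadratic Wasserstein metric: $\mathrm{W}(\mu,\nu)=\left(\inf_\Pi\int d(x,y)^2\,\Pi(dx\,dy)\right)^{1/2}$, with $d$ the distance of $\mathbb{S}^1$ and the infimum over probability measures $\Pi$ on $\mathbb{S}^1\times\mathbb{S}^1$ with marginals $\mu,\nu$. Vector fields on $\mathbb{S}^1$ are identified with functions $v:\mathbb{S}^1\to\mathbb{R}$. For $\mu\in\mathscr{P}(\mathbb{S}^1)$, $L^2_0(\mu)$ is the closure in $L^2(\mu)$ of the set of derivatives of smooth functions. Here $L^2_0(\rho\lambda)=\{v\in L^2(\rho\lambda):\int v\,d\lambda=0\}$ (mean zero with respect to $\lambda$), with the inner product of $L^2(\rho\lambda)$. For $v\in L^2(\mu)$, $\mu+v:=(\mathrm{Id}+v)_\#\mu$. A map $f:\mathscr{P}(\mathbb{S}^1)\to\mathscr{P}(\mathbb{S}^1)$ has G\^ateaux derivative $L$ at an atomless $\mu$ if $f(\mu)$ has no atom, $L:L^2_0(\mu)\to L^2_0(f(\mu))$ is a continuous linear operator, and for all $v\in L^2_0(\mu)$ one has $\mathrm{W}(f(\mu+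tv),f(\mu)+tLv)=o(t)$.
   Formalization: The printed formula for L fails when Φ reverses orientation (e.g. Φ(x)=−2x, ρ=1), so each term of the sum over preimages y carries the factor sign Φ'(y); for Φ'>0 this is the printed formula. *)

(* Defs.v *)
From HB Require Import structures.
From mathcomp Require Import all_boot all_order all_algebra ring_quotient.
From mathcomp Require Import all_classical all_reals all_analysis measurable_realfun.
Set Implicit Arguments.
Unset Strict Implicit.
Unset Printing Implicit Defensive.
Import Order.TTheory GRing.Theory Num.Theory numFieldNormedType.Exports.
Local Open Scope classical_set_scope.
Local Open Scope ring_scope.
Local Open Scope quotient_scope.

Definition integers (R : realType) : {pred R} := fun x => x \is a Num.int.

Fact integers_zmod_closed (R : realType) : zmod_closed (@integers R).
Proof.
by split=> [|x y xZ yZ]; rewrite /integers unfold_in/= ?rpred0// rpredB.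
Qed.

HB.instance Definition _ (R : realType) :=
  GRing.isZmodClosed.Build R (@integers R) (@integers_zmod_closed R).

Definition circle (R : realType) : Type :=
  ring_quotient.Quotient.quot (@integers R).

HB.instance Definition _ (R : realType) := GRing.Zmodule.on (circle R).
HB.instance Definition _ (R : realType) := Quotient.on (circle R).
HB.instance Definition _ (R : realType) := isPointed.Build (circle R) 0.

Section quotient_topology.
Context (R : realType).

Definition circle_open (U : set (circle R)) := open (\pi_(circle R) @^-1` U).

Let circle_openT : circle_open setT.
Proof. by rewrite /circle_open preimage_setT; exact: openT. Qed.

Let circle_openI : setI_closed circle_open.
Proof. by move=> A B; exact: openI. Qed.

Let circle_open_bigcup (I : Type) (f : I -> set (circle R)) :
  (forall i, circle_open (f i)) -> circle_open (\bigcup_i f i).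
Proof. by move=> of_; apply: bigcup_open => i _; exact: of_. Qed.

HB.instance Definition _ := @isOpenTopological.Build (circle R) circle_open
  circle_openT circle_openI circle_open_bigcup.

End quotient_topology.

HB.instance Definition _ (R : realType) :=
  Measurable.copy (circle R) (g_sigma_algebraType (@open (circle R))).

Definition to_circle (R : realType) (t : R) : circle R := \pi_(circle R) t.

(* the representative of x in the interval [-1/2, 1/2[ *)
Definition short_repr (R : realType) (x : circle R) : R :=
  repr x - (Num.floor (repr x + 2^-1))%:~R.

Definition circle_dist (R : realType) (x y : circle R) : R :=
  `|short_repr (x - y)|.

Section lebesgue.
Context (R : realType).

Lemma measurable_to_circle :
  measurable_fun [set: measurableTypeR R] (@to_circle R).
Proof.
apply: (@measurability _ _ _ _ _ _ (@open (circle R))) => //.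
move=> _ [A oA <-]; rewrite setTI; apply: open_measurable.
exact: oA.
Qed.

Definition circle_lebesgue (A : set (circle R)) : \bar R :=
  lebesgue_measure (@to_circle R @^-1` A `&` `[0, 1[).

Let circle_lebesgue0 : circle_lebesgue set0 = 0%E.
Proof. by rewrite /circle_lebesgue preimage_set0 set0I measure0. Qed.

Let circle_lebesgue_ge0 A : (0 <= circle_lebesgue A)%E.
Proof. exact: measure_ge0. Qed.

Let circle_lebesgue_sigma_additive : semi_sigma_additive circle_lebesgue.
Proof.
have mpre A : measurable A ->
    measurable ((@to_circle R @^-1` A : set (measurableTypeR R)) `&` `[0, 1[).
  move=> mA; apply: measurableI; last exact: measurable_itv.
  by rewrite -[X in measurable X]setTI; exact: measurable_to_circle.
move=> F mF tF mUF; rewrite /circle_lebesgue preimage_bigcup setI_bigcupl.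
apply: measure_semi_sigma_additive.
- by move=> n; exact: mpre.
- apply/trivIsetP => i j _ _ ij.
  by rewrite setIACA -preimage_setI (trivIsetP.1 tF)// preimage_set0 set0I.
- by rewrite -setI_bigcupl -preimage_bigcup; exact: mpre.
Qed.

HB.instance Definition _ := isMeasure.Build _ _ _ circle_lebesgue
  circle_lebesgue0 circle_lebesgue_ge0 circle_lebesgue_sigma_additive.

Let circle_lebesgueT : circle_lebesgue setT = 1%E.
Proof.
rewrite /circle_lebesgue preimage_setT setTI lebesgue_measure_itv/= lte_fin.
by rewrite ltr01 oppr0 adde0.
Qed.

HB.instance Definition _ :=
  Measure_isProbability.Build _ _ _ circle_lebesgue circle_lebesgueT.

End lebesgue.
Arguments circle_lebesgue : clear implicits.

Section calculus.
Context (R : realType).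
Implicit Types (v : circle R -> R) (Phi : circle R -> circle R).

Definition fun_derivable v :=
  forall x, derivable (fun h : R => v (x + to_circle h)) 0 1.

Definition fun_deriv v : circle R -> R :=
  fun x => derive1 (fun h : R => v (x + to_circle h)) 0.

Definition fun_C1 v := fun_derivable v /\ continuous (fun_deriv v).

Definition fun_smooth v := forall n, fun_derivable (iter n fun_deriv v).

(* A self-map of the circle is differentiated by reading its increments
   in the chart short_repr, which is a local inverse of to_circle at 0. The
   increment vanishes at h = 0, so its derivability forces Phi to be
   continuous and does not see the jump of short_repr at 1/2. *)
Definition increment Phi (x : circle R) : R -> R :=
  fun h => short_repr (Phi (x + to_circle h) - Phi x).

Definition map_deriv Phi : circle R -> R := fun x => derive1 (increment Phi x) 0.

Definition map_C2 Phi :=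
  (forall x, derivable (increment Phi x) 0 1) /\ fun_C1 (map_deriv Phi).

Definition expanding Phi := forall x, 1 < `|map_deriv Phi x|.

End calculus.

Section transport.
Context (R : realType).
Local Notation S1 := (circle R).
Local Notation P := (probability S1 R).
Implicit Types (mu nu : P) (v w : S1 -> R).

(* The value is junk if g is not measurable. *)
Definition pushP (g : S1 -> S1) mu : P :=
  if pselect (measurable_fun setT g) is left mg
  then distribution mu (mfun_Sub (mem_set mg)) else point.

Definition translate mu v : P := pushP (fun x => x + to_circle (v x)) mu.

Definition coupling mu nu : set (probability (S1 * S1)%type R) :=
  [set Pi | forall A, measurable A ->
     Pi (fst @^-1` A) = mu A /\ Pi (snd @^-1` A) = nu A].

Definition wasserstein mu nu : R :=
  Num.sqrt (fine (ereal_inf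
    [set (\int[Pi]_z ((circle_dist z.1 z.2) ^+ 2)%:E)%E
    | Pi in coupling mu nu])).

Definition atomless mu := forall x, mu [set x] = 0%E.

(* The closure in L^2(mu) of the derivatives of smooth functions. Elements of
   L^2 are given by representatives, so that equality is equality almost
   everywhere. *)
Definition L20 mu : set (S1 -> R) :=
  [set v | v \in Lfun mu 2%:E /\
     forall e : R, 0 < e -> exists phi, fun_smooth phi /\
       ('N[mu]_2%:E[EFin \o (v \- fun_deriv phi)%R] < e%:E)%E].

Definition L20_operator mu nu (L : (S1 -> R) -> (S1 -> R)) :=
  [/\ forall v, L20 mu v -> L20 nu (L v),
      forall a v w, L20 mu v -> L20 mu w ->
        {ae nu, forall x, L (fun y => a * v y + w y) x = a * L v x + L w x} &
      exists C : R, forall v, L20 mu v ->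
        ('N[nu]_2%:E[EFin \o L v] <= C%:E * 'N[mu]_2%:E[EFin \o v])%E].

Definition gateaux_derivative (f : P -> P) mu (L : (S1 -> R) -> (S1 -> R)) :=
  [/\ atomless mu, atomless (f mu), L20_operator mu (f mu) L &
      forall v, L20 mu v ->
        (fun t : R => wasserstein (f (translate mu (fun x => t * v x)))
                                  (translate (f mu) (fun x => t * L v x)))
          =o_ (0 : R) (fun t : R => t)].

Definition L20_adjoint mu (L M : (S1 -> R) -> (S1 -> R)) :=
  L20_operator mu mu M /\
  forall u v, L20 mu u -> L20 mu v ->
    \int[mu]_x (L v x * u x) = \int[mu]_x (v x * M u x).

End transport.

Section expanding_maps.
Context (R : realType).
Implicit Types (Phi : circle R -> circle R) (rho v u : circle R -> R).

(* For a C^2 expanding map the absolutely continuous invariant probability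
   measure mu exists and is unique, and its density has a positive C^1
   version; rho is that version, so that rho is defined at every point. *)
Definition invariant_density Phi rho (mu : probability (circle R) R) :=
  [/\ fun_C1 rho, forall x, 0 < rho x,
      forall A, measurable A ->
        mu A = (\int[circle_lebesgue R]_(x in A) (rho x)%:E)%E &
      forall A, measurable A -> mu (Phi @^-1` A) = mu A].

(* The factor sg (Phi' y) is 1 when Phi preserves the orientation. When Phi'
   is negative it cannot be omitted: the first variation of Phi_# along v is
   the conditional expectation of Phi' v given Phi, that is the sum over the
   preimages y of x of Phi'(y) / |Phi'(y)| * rho(y) / rho(x) * v(y). *)
Definition deriv_op Phi rho v : circle R -> R := fun x =>
  \sum_(y \in Phi @^-1` [set x])
     Num.sg (map_deriv Phi y) * (rho y / rho x * v y)
  - (\int[circle_lebesgue R]_y (v y * map_deriv Phi y * (rho y / rho (Phi y))))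
    / (rho x * \int[circle_lebesgue R]_y (1 / rho y)).

Lemma deriv_op_orientation_preserving Phi rho v x :
  (forall y, 0 < map_deriv Phi y) ->
  deriv_op Phi rho v x =
  \sum_(y \in Phi @^-1` [set x]) rho y / rho x * v y
  - (\int[circle_lebesgue R]_y (v y * map_deriv Phi y * (rho y / rho (Phi y))))
    / (rho x * \int[circle_lebesgue R]_y (1 / rho y)).
Proof.
move=> dPhi; rewrite /deriv_op; congr (_ - _).
by apply: eq_fsbigr => y _; rewrite gtr0_sg// mul1r.
Qed.

Definition adjoint_op Phi u : circle R -> R :=
  fun x => map_deriv Phi x * u (Phi x).

End expanding_maps.

(* Main.v *)
(* A vector field v with smooth flux z = rho v is compared with the flow of
   mass: if F is a primitive of rho with inverse T, the map
   s |-> T (F s - t z s) sends the density rho - t z' to rho, and its inverse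
   is x |-> x + t v x up to O(t^2). Writing Z for the flux of L v, one has
   Z' (x) = sum of z'(y) / |Phi'(y)| over the preimages y of x, so Phi sends
   the density rho - t z' to rho - t Z'. With m the probability of density
   rho - t z', this gives two maps X and Y of law mu under m such that, at the
   point s, Phi (X + t v X) and Y + t L v Y are both within O(t^2) of Phi s,
   hence a coupling of Phi_# (mu + t v) with Phi_# mu + t L v. A general v in L^2_0 is
   approximated by a derivative of a smooth function v': the same X and Y, for
   v', couple the measures of v at L^2 distance at most
   C |t| (|v - v'|_2 + |t|), because L is bounded in L^2. Here L^2_0 is the
   space of fields of Lebesgue mean zero, by Fejer interpolation, and L is the
   transfer operator of Phi' v, corrected by a multiple of 1 / rho to have
   mean zero. *)
From HB Require Import structures.
Require Import Defs.
From mathcomp Require Import all_boot all_order all_algebra ring_quotient.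
From mathcomp Require Import all_classical all_reals all_analysis measurable_realfun.
From mathcomp Require Import ring lra.
Set Implicit Arguments.
Unset Strict Implicit.
Unset Printing Implicit Defensive.
Import Order.TTheory GRing.Theory Num.Theory numFieldNormedType.Exports.
Local Open Scope classical_set_scope.
Local Open Scope ring_scope.
Local Open Scope quotient_scope.

(** * The circle and its lifts *)

(** For [v] merely square integrable, Id + t v need not be injective and its image of [mu] need not
    have a density to follow; this is why fluxes are used for smooth fields only. Their estimates
    are uniform in the point, but the admissible range of t depends on the smooth field, so only
    o(t) survives in the limit. The flux Z is known from Z' up to a constant, and any constant would
    give the same coupling estimate: a constant flux, that is a field c / rho, moves [mu] by O(t^2)
    only. The constant is therefore fixed by membership in L^2_0 alone. Paired with u in L^2_0, a
    multiple of 1 / rho gives a multiple of the Lebesgue mean of u, which is zero; hence no trace of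
    the correction in the adjoint. Invariance is a statement about measures, whereas densities and
    averages over fibres are needed at every point; continuity of rho and Phi' turns it into a
    pointwise identity over the preimages. Since rho and Phi' are only C^1, both operators send
    derivatives of smooth functions to C^1 fields, which have to be approximated again. *)

Section integral_density.
Local Open Scope ereal_scope.
Context d (T : measurableType d) (R : realType).
Variables (mu nu : {measure set T -> \bar R}) (w : T -> R).
Hypothesis mw : measurable_fun setT w.
Hypothesis w0 : forall x, (0 <= w x)%R.
Hypothesis nuE : forall A, measurable A -> nu A = \int[mu]_(x in A) (w x)%:E.

Import HBNNSimple.

(** Both sides pass to the limit along simple functions by monotone convergence, and on indicators
    the identity is [nuE]. *)
Lemma ge0_integral_density (f : T -> \bar R) :
  measurable_fun setT f -> (forall x, 0 <= f x) ->
  \int[nu]_x f x = \int[mu]_x (f x * (w x)%:E).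
Proof.
move=> mf f0.
pose f_ := nnsfun_approx measurableT mf.
have cf x : (f_ n x)%:E @[n --> \oo] --> f x.
  by apply: cvg_nnsfun_approx.
transitivity (limn (fun n => \int[nu]_x (f_ n x)%:E)).
  rewrite -monotone_convergence//.
  - by apply: eq_integral => y _; apply/esym/cvg_lim => //; exact: cf.
  - by move=> n; exact/measurable_EFinP/measurable_funP.
  - by move=> n y _; rewrite lee_fin.
  - by move=> y _ m n mn; rewrite lee_fin; exact/lefP/nd_nnsfun_approx.
rewrite [X in limn X](_ : _ = (fun n => \int[mu]_x ((f_ n x)%:E * (w x)%:E))).
  rewrite -monotone_convergence//.
  - apply: eq_integral => x _; apply/cvg_lim => //.
    by apply: cvgeZr => //; exact: cf.
  - move=> n; apply: emeasurable_funM; last exact/measurable_EFinP.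
    exact/measurable_EFinP/measurable_funP.
  - by move=> n x _; rewrite mule_ge0// lee_fin.
  - move=> x _ m n mn; rewrite lee_wpmul2r ?lee_fin//.
    exact/lefP/nd_nnsfun_approx.
apply/funext => n.
transitivity (\sum_(k \in range (f_ n)) \int[nu]_x (k * \1_(f_ n @^-1` [set k]) x)%:E).
  under eq_integral do rewrite fimfunE -fsumEFin//.
  rewrite ge0_integral_fsum//.
  - by move=> y; exact/measurable_EFinP/measurable_funM.
  - by move=> y x _; rewrite nnfun_muleindic_ge0.
transitivity (\sum_(k \in range (f_ n)) \int[mu]_x ((k * \1_(f_ n @^-1` [set k]) x)%:E * (w x)%:E)); last first.
  rewrite -ge0_integral_fsum//.
  - apply: eq_integral => x _; rewrite -ge0_mule_fsuml ?fsumEFin// -?fimfunE//.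
    by move=> k; rewrite nnfun_muleindic_ge0.
  - move=> k; apply: emeasurable_funM; last exact/measurable_EFinP.
    exact/measurable_EFinP/measurable_funM.
  - by move=> k x _; rewrite mule_ge0 ?lee_fin ?w0// -lee_fin nnfun_muleindic_ge0.
apply: eq_fsbigr => k; rewrite inE => -[x _ <-].
have fx0 : (0 <= f_ n x)%R by [].
under eq_integral do rewrite EFinM.
rewrite ge0_integralZl//; last exact/measurable_EFinP.
under [RHS]eq_integral do rewrite EFinM -muleA.
rewrite ge0_integralZl//; last 2 first.
  - by apply: emeasurable_funM; exact/measurable_EFinP.
  - by move=> y _; rewrite mule_ge0// lee_fin.
congr (_ * _); rewrite integral_indic//= setIT nuE// [LHS]integral_mkcond/=.
apply: eq_integral => y _; rewrite epatch_indic/= muleC; congr (_ * _).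
Qed.

End integral_density.

(** The law is prescribed on measurable sets rather than as an equality of measures, so that [nu]
    can be an invariant [mu] itself, or the law of a map on an auxiliary space. *)
Lemma ge0_integral_transfer d1 d2 (T1 : measurableType d1) (T2 : measurableType d2)
    (R : realType) (mu : {measure set T1 -> \bar R}) (nu : {measure set T2 -> \bar R})
    (g : T1 -> T2) (f : T2 -> \bar R) :
  measurable_fun setT g ->
  (forall A, measurable A -> nu A = mu (g @^-1` A)) ->
  measurable_fun setT f -> (forall x, (0 <= f x)%E) ->
  (\int[nu]_x f x = \int[mu]_x f (g x))%E.
Proof.
move=> mg nuE mf f0.
transitivity (\int[pushforward mu g]_x f x)%E.
  by apply: eq_measure_integral => A mA _; exact: nuE.
by rewrite ge0_integral_pushforward.
Qed.

(** * The circle as a quotient of the line: representatives, distance, measurability *)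

Section circle_basics.
Context {R : realType}.
Implicit Types (s t : R) (x y z : circle R).
Local Notation tc := (@to_circle R).

Lemma to_circleD s t : tc (s + t) = tc s + tc t.
Proof. by rewrite /to_circle raddfD. Qed.

Lemma to_circleB s t : tc (s - t) = tc s - tc t.
Proof. by rewrite /to_circle raddfB. Qed.

Lemma to_circleN s : tc (- s) = - tc s.
Proof. by rewrite /to_circle raddfN. Qed.

Lemma to_circle0 : tc 0 = 0.
Proof. by rewrite /to_circle raddf0. Qed.

Lemma to_circle_eq s t : tc s = tc t <-> s - t \is a Num.int.
Proof.
split; last first.
  move=> st; apply/eqP; rewrite /to_circle -[_ == _]/(_ == _ %[mod circle R])%qT.
  by rewrite eqmodE /= /Quotient.equiv.
move=> /eqP; rewrite /to_circle -[_ == _]/(_ == _ %[mod circle R])%qT.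
by rewrite eqmodE /= /Quotient.equiv.
Qed.

Lemma to_circleDz s (n : int) : tc (s + n%:~R) = tc s.
Proof. by apply/to_circle_eq; rewrite addrC addKr intr_int. Qed.

Lemma to_circleDn s (n : nat) : tc (s + n%:R) = tc s.
Proof. exact: (to_circleDz s n). Qed.

Lemma short_reprK x : tc (short_repr x) = x.
Proof.
rewrite /short_repr to_circleB -[X in _ - X]addr0.
have -> : tc (Num.floor (repr x + 2^-1))%:~R = 0.
  by rewrite -[X in tc X]add0r to_circleDz to_circle0.
by rewrite addr0 subr0 /to_circle reprK.
Qed.

Lemma short_repr_to_circle s : short_repr (tc s) = s - (Num.floor (s + 2^-1))%:~R.
Proof.
rewrite /short_repr.
have /to_circle_eq/intrP[m em] : tc (repr (tc s)) = tc s by rewrite /to_circle reprK.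
have -> : repr (tc s) = s + m%:~R by rewrite -em addrC subrK.
by rewrite [X in Num.floor X]addrAC floorDrz ?intr_int// intrD intrKfloor; ring.
Qed.

Lemma short_repr_bounds x : - 2^-1 <= short_repr x < 2^-1.
Proof.
rewrite /short_repr; have := floor_le (repr x + 2^-1).
have := floorD1_gt (repr x + 2^-1); rewrite intrD.
move=> h1 h2; apply/andP; split; lra.
Qed.

Lemma short_repr_small s : - 2^-1 <= s < 2^-1 -> short_repr (tc s) = s.
Proof.
move=> /andP[s0 s1]; rewrite short_repr_to_circle.
have -> : Num.floor (s + 2^-1) = 0; last by rewrite subr0.
by apply: floor_def; rewrite /= ; apply/andP; split; lra.
Qed.

Lemma short_repr0 : short_repr (0 : circle R) = 0.
Proof. by rewrite -to_circle0 short_repr_small //; apply/andP; split; lra. Qed.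

(** The short representative has the least absolute value in its class: either [s] is already in the
    window, or |s| is at least 1/2, which bounds every short representative. *)
Lemma normr_short_repr_le s : `|short_repr (tc s)| <= `|s|.
Proof.
have [/andP[s0 s1]|] := boolP (- 2^-1 <= s < 2^-1).
  by rewrite short_repr_small// s0.
move=> h; have /andP[a b] := short_repr_bounds (tc s).
apply: (@le_trans _ _ 2^-1); first by rewrite ler_norml a ltW.
move: h; rewrite negb_and -!ltNge -leNgt => /orP[h|h].
  by rewrite ler0_norm; lra.
by rewrite ger0_norm; lra.
Qed.

Lemma circle_distxx x : circle_dist x x = 0.
Proof. by rewrite /circle_dist subrr short_repr0 normr0. Qed.

Lemma circle_dist_ge0 x y : 0 <= circle_dist x y.
Proof. exact: normr_ge0. Qed.

Lemma circle_dist_to_circle_le s t : circle_dist (tc s) (tc t) <= `|s - t|.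
Proof. by rewrite /circle_dist -to_circleB normr_short_repr_le. Qed.

Lemma circle_distC x y : circle_dist x y = circle_dist y x.
Proof.
(* [short_repr] is not odd: the class of 1/2 is its own opposite and is represented by -1/2.
   Symmetry thus comes from two inequalities. *)
have h (a b : circle R) : circle_dist a b <= circle_dist b a.
  rewrite /circle_dist -opprB -{1}(short_reprK (b - a)) -to_circleN.
  by rewrite (le_trans (normr_short_repr_le _))// normrN.
by apply/eqP; rewrite eq_le !h.
Qed.

Lemma circle_dist_triangle y x z :
  circle_dist x z <= circle_dist x y + circle_dist y z.
Proof.
rewrite {1}/circle_dist -(subrKA y) -(short_reprK (x - y)) -(short_reprK (y - z)).
rewrite -to_circleD (le_trans (normr_short_repr_le _))//.
exact: ler_normD.
Qed.

Lemma circle_dist_eq0 x y : circle_dist x y = 0 -> x = y.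
Proof.
move=> /eqP; rewrite normr_eq0 => /eqP h.
by apply/eqP; rewrite -subr_eq0 -(short_reprK (x - y)) h to_circle0.
Qed.


Lemma short_repr_intE s : exists n : int, short_repr (tc s) = s + n%:~R.
Proof.
by exists (- Num.floor (s + 2^-1)); rewrite short_repr_to_circle intrN.
Qed.

Lemma circle_openE (U : set (circle R)) : open U = open (tc @^-1` U).
Proof. by []. Qed.

Lemma continuous_to_circle : continuous tc.
Proof. by apply/continuousP => A; rewrite circle_openE. Qed.

Lemma open_image_to_circle (U : set R) : open U -> open (tc @` U).
Proof.
move=> oU; rewrite circle_openE.
rewrite (_ : _ @^-1` _ = \bigcup_(n in [set: int]) ((fun s => s + n%:~R) @^-1` U)).
  apply: bigcup_open => n _.
  apply: open_comp oU => s _.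
  by apply: cvgD; [exact: cvg_id|exact: cvg_cst].
apply/seteqP; split=> [s /= [t Ut /to_circle_eq/intrP[n tsn]]|s [n _ /= Us]].
  by exists n => //=; rewrite -tsn addrC subrK.
by exists (s + n%:~R) => //; rewrite to_circleDz.
Qed.

(** Although [short_repr] jumps at the class of 1/2, its superlevel sets are open: above a level a
    >= -1/2 they are images of the open interval from a to 1/2. *)
Lemma measurable_short_repr :
  measurable_fun setT (@short_repr R : circle R -> measurableTypeR R).
Proof.
apply: (measurability _ (RGenOInfty.measurableE R)) => _ [_ [a ->] <-].
rewrite setTI.
have [a2|a2] := ltP a (- 2^-1).
  rewrite (_ : _ @^-1` _ = setT)//; apply/seteqP; split=> // x _ /=.
  rewrite in_itv/= andbT; have /andP[+ _] := short_repr_bounds x.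
  exact: lt_le_trans.
apply: sub_sigma_algebra.
rewrite (_ : _ @^-1` _ = tc @` `]a, 2^-1[).
  exact: open_image_to_circle (interval_open _ _).
apply/seteqP; split=> [x /=|_ [s /= + <-]].
  rewrite in_itv/= andbT => ax; exists (short_repr x); last exact: short_reprK.
  by rewrite in_itv/= ax /=; have /andP[] := short_repr_bounds x.
rewrite !in_itv/= andbT => /andP[as1 s2].
by rewrite short_repr_small// s2 andbT ltW// (le_lt_trans a2).
Qed.

Lemma measurable_comp_to_circle d (T : measurableType d) (f : circle R -> T) :
  measurable_fun setT f -> measurable_fun setT (f \o tc : measurableTypeR R -> T).
Proof. move=> mf; apply: measurableT_comp => //; exact: measurable_to_circle. Qed.

Lemma measurable_fun_of_lift d (T : measurableType d) (f : circle R -> T) :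
  measurable_fun setT (f \o tc : measurableTypeR R -> T) -> measurable_fun setT f.
Proof.
move=> mf; rewrite (_ : f = (f \o tc) \o @short_repr R).
  by apply: measurableT_comp => //; exact: measurable_short_repr.
by apply/funext => x /=; rewrite short_reprK.
Qed.

Lemma measurable_circle_dist d (T : measurableType d) (f g : T -> circle R) :
  measurable_fun setT f -> measurable_fun setT g ->
  measurable_fun [set: T] (fun z : T => circle_dist (f z) (g z)).
Proof.
move=> mf mg; rewrite /circle_dist.
apply: measurableT_comp => //=.
(* Representatives move the subtraction to the line, where differences of measurable functions are
   measurable; the class of the difference does not depend on them. *)
rewrite (_ : (fun z : T => _) = (@short_repr R) \o tc \o
   (fun z : T => short_repr (f z) - short_repr (g z))); last first.
  by apply/funext => z /=; rewrite to_circleB !short_reprK.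
apply: measurableT_comp.
  apply: measurableT_comp; first exact: measurable_short_repr.
  exact: measurable_to_circle.
apply: measurable_funB.
  by apply: (measurableT_comp measurable_short_repr).
by apply: (measurableT_comp measurable_short_repr).
Qed.

Lemma measurable_translate_circle d (T : measurableType d) (f : T -> circle R) (u : T -> R) :
  measurable_fun setT f -> measurable_fun setT u ->
  measurable_fun [set: T] (fun z : T => f z + tc (u z)).
Proof.
move=> mf mu.
rewrite (_ : (fun z : T => _) = tc \o (fun z : T => short_repr (f z) + u z)); last first.
  by apply/funext => z /=; rewrite to_circleD short_reprK.
apply: measurableT_comp; first exact: measurable_to_circle.
by apply: measurable_funD => //; apply: (measurableT_comp measurable_short_repr).
Qed.

Local Notation leb := (@lebesgue_measure R).

Lemma ge0_integral_circle (f : circle R -> \bar R) :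
  measurable_fun setT f -> (forall x, (0 <= f x)%E) ->
  (\int[circle_lebesgue R]_x f x = \int[leb]_(s in `[0%R, 1%R[) f (tc s))%E.
Proof.
move=> mf f0.
have mI : measurable (`[0%R, 1%R[%classic : set (measurableTypeR R)) by exact: measurable_itv.
rewrite (ge0_integral_transfer (mu := mrestr leb mI) (g := tc))//; last exact: measurable_to_circle.
rewrite (ge0_integral_density (mu := leb) (w := \1_(`[0%R, 1%R[))) //=.
- by rewrite [RHS]integral_mkcond; apply: eq_integral => s _; rewrite epatch_indic.
- move=> A mA; by rewrite integral_indic// /mrestr setIC.
- exact: measurable_comp_to_circle.
Qed.

End circle_basics.

(** * Calculus on the line *)

Section real_calculus.
Context {R : realType}.
Implicit Types (f g F : R -> R) (a b s t x y : R).
Local Notation leb := (@lebesgue_measure R).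

Lemma is_derive_continuous f (df : R -> R) :
  (forall s, is_derive s 1 f (df s)) -> continuous f.
Proof.
move=> h s; apply: differentiable_continuous; apply/derivable1_diffP.
by have [] := h s.
Qed.

Lemma continuous_integrable f a b : continuous f ->
  leb.-integrable `[a, b] (EFin \o f).
Proof.
move=> cf; apply: continuous_compact_integrable; first exact: segment_compact.
exact: continuous_subspaceT.
Qed.

(** The integral from -n to x is a primitive only to the right of -n. Normalised at 0 these
    functions agree wherever they are primitives, so the value at x can use any n above |x|. *)
Lemma continuous_primitive f : continuous f ->
  exists F, forall s, is_derive s 1 F (f s).
Proof.
move=> cf.
pose G (n : nat) x := \int[leb]_(t in `[- n%:R, x]) f t.
have dG n x : - n%:R < x -> is_derive x 1 (G n) (f x).
  move=> nx; have [d e] := @continuous_FTC1_closed R f (- n%:R) x (x + 1)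
    ltac:(by rewrite ltrDl) (continuous_integrable _ _ cf) nx (cf x).
  by split; [exact: d|rewrite -derive1E e].
have GE (m n : nat) y : (m <= n)%N -> - m%:R <= y ->
    G n y - G m y = \int[leb]_(t in `[- n%:R, - m%:R]) f t.
  move=> mn my.
  have h1 := @Rintegral_itvB R f (BLeft (- n%:R)) (BRight y) (- m%:R)
    (continuous_integrable _ _ cf).
  have h2 := @Rintegral_itvB R f (BLeft (- m%:R)) (BRight y) (- m%:R)
    (continuous_integrable _ _ cf).
  have e1 : (BLeft (- n%:R) <= BRight (- m%:R) :> itv_bound R)%O.
    by rewrite bnd_simp lerN2 ler_nat.
  have e2 : (BRight (- m%:R) <= BRight y :> itv_bound R)%O by rewrite bnd_simp.
  have e3 : (BLeft (- m%:R) <= BRight (- m%:R) :> itv_bound R)%O by rewrite bnd_simp.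
  move: (h2 e3 e2); rewrite set_itv1 Rintegral_set1 subr0 -(h1 e1 e2) /G => ->.
  by rewrite subKr.
have GE0 (m n : nat) y : (m <= n)%N -> - m%:R <= y -> G n y - G n 0 = G m y - G m 0.
  move=> mn my; have := GE _ _ _ mn my.
  have := GE m n 0 mn; rewrite oppr_le0 ler0n => /(_ isT) <-; lra.
pose k x := (Num.trunc `|x|).+1.
have kx x : `|x| < (k x)%:R by rewrite truncnS_gt.
exists (fun x => G (k x) x - G (k x) 0) => s.
(* One more than [k s], so that points at distance less than 1 from [s] still lie to the right of
   -N. *)
pose N := (k s).+1.
have Fs : {near s, (fun x => G N x - G N 0) =1 (fun x => G (k x) x - G (k x) 0)}.
  near=> y.
  have [kN|/ltnW kN] := leqP (k y) N.
    by apply: GE0 => //; have := kx y; rewrite ltr_norml => /andP[/ltW].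
  symmetry; apply: GE0 => //.
  have : `|s - y| < 1 by near: y; exact: (nbhsx_ballx s 1 ltr01).
  have := kx s; rewrite /N -natr1 !ltr_norml => /andP[? ?] /andP[? ?]; lra.
apply: near_eq_is_derive Fs _ => //.
rewrite -[f s]subr0; apply: is_deriveB; apply: dG.
have := kx s; rewrite /N -natr1 !ltr_norml => /andP[? ?]; lra.
Unshelve. all: by end_near. Qed.

Lemma mean_value f (df : R -> R) a b :
  (forall s, is_derive s 1 f (df s)) ->
  exists c, f b - f a = df c * (b - a).
Proof.
move=> h; have cf := is_derive_continuous h.
have [ab|/ltW ba] := leP a b.
  have [c _ ->] := @MVT_segment R f df a b ab (fun x _ => h x) (continuous_subspaceT cf).
  by exists c.
have [c _ e] := @MVT_segment R f df b a ba (fun x _ => h x) (continuous_subspaceT cf).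
by exists c; rewrite -opprB e -mulrN opprB.
Qed.

Lemma derive_bounded_lipschitz f (df : R -> R) C a b :
  (forall s, is_derive s 1 f (df s)) -> (forall s, `|df s| <= C) ->
  `|f b - f a| <= C * `|b - a|.
Proof.
move=> h hC; have [c ->] := mean_value a b h.
by rewrite normrM ler_wpM2r.
Qed.

Definition one_periodic (T : Type) (f : R -> T) := forall s, f (s + 1) = f s.

Lemma one_periodicDn (T : Type) (f : R -> T) (n : nat) s :
  one_periodic f -> f (s + n%:R) = f s.
Proof. by move=> pf; elim: n => [|n ih]; rewrite ?addr0// -natr1 addrA pf. Qed.

Lemma one_periodicDz (T : Type) (f : R -> T) (n : int) s :
  one_periodic f -> f (s + n%:~R) = f s.
Proof.
move=> pf; case: n => n; first exact: one_periodicDn.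
by rewrite NegzE intrN -(one_periodicDn n.+1 (s - _) pf) subrK.
Qed.

Lemma itv01_shift s : exists n : int, s + n%:~R \in `[0, 1[.
Proof.
exists (- Num.floor s); rewrite intrN in_itv/=.
have /andP[a b] := floor_itv s; rewrite intrD in b.
by apply/andP; split; lra.
Qed.

Lemma periodic_max f : continuous f -> one_periodic f -> exists c, forall s, f s <= f c.
Proof.
move=> cf pf; have [c _ h] := @EVT_max R f 0 1 ler01 (continuous_subspaceT cf).
exists c => s; have [n] := itv01_shift s; rewrite in_itv/= => /andP[a b].
by rewrite -(one_periodicDz n s)// h// in_itv/= a ltW.
Qed.

Lemma periodic_bounded f : continuous f -> one_periodic f ->
  exists2 C, 0 < C & forall s, `|f s| <= C.
Proof.
move=> cf pf.
have cnf : continuous (fun s => `|f s|).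
  by move=> s; apply: (continuous_comp (cf s)); exact: norm_continuous.
have [|c h] := periodic_max cnf; first by move=> s; rewrite pf.
exists (`|f c| + 1); first by rewrite ltr_wpDl.
by move=> s; rewrite (le_trans (h s))// lerDl.
Qed.

Lemma periodic_gt0_lbound f : continuous f -> one_periodic f -> (forall s, 0 < f s) ->
  exists2 m, 0 < m & forall s, m <= f s.
Proof.
move=> cf pf f0.
have [||c h] := @periodic_max (fun s => - f s).
- by move=> s; apply: continuousN; exact: cf.
- by move=> s; rewrite pf.
- by exists (f c) => // s; rewrite -lerN2.
Qed.

Lemma increasing_derive_inverse f (df : R -> R) m : 0 < m ->
  (forall s, is_derive s 1 f (df s)) -> (forall s, m <= df s) ->
  exists g, [/\ cancel f g, cancel g f & forall x, is_derive x 1 g (df (g x))^-1].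
Proof.
move=> m0 h hm; have cf := is_derive_continuous h.
have inc x y : x <= y -> m * (y - x) <= f y - f x.
  move=> xy; have [c ->] := mean_value x y h.
  by rewrite ler_wpM2r// subr_ge0.
have finj : injective f.
  move=> x y; wlog xy : x y / x <= y.
    by move=> wl fxy; have [/wl->//|/ltW /wl ->//] := leP x y.
  move=> fxy; have := inc _ _ xy; rewrite fxy subrr pmulr_rle0// subr_le0 => yx.
  by apply/eqP; rewrite eq_le xy.
have fsurj y : exists x, f x = y.
  pose b := `|y - f 0| / m; have b0 : 0 <= b by rewrite divr_ge0// ltW.
  have bE : m * b = `|y - f 0| by rewrite mulrC divfK// gt_eqF.
  have h1 := inc 0 b b0; have h2 := inc (- b) 0; rewrite oppr_le0 in h2.
  have {}h2 := h2 b0.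
  have := ler_norm (y - f 0); have := lerNnormlW (lexx `|y - f 0|) => n1 n2.
  have [||x _ <-] := @IVT R f (- b) b y _ (continuous_subspaceT cf).
  - by lra.
  - have e1 : f (- b) <= y by lra.
    have e2 : y <= f b by lra.
    by rewrite min_l ?max_r ?e1 ?e2//; lra.
  - by exists x.
have [g gK] := choice fsurj.
have fK : cancel f g by move=> x; apply: finj; rewrite gK.
exists g; split => // x.
rewrite -{1}(gK x); apply: is_derive_inverse.
- by near=> y.
- by near=> y; exact: cf.
- by rewrite gt_eqF// (lt_le_trans m0).
Unshelve. all: by end_near. Qed.


Lemma derive_inverse f (df : R -> R) m e : 0 < m -> e = 1 \/ e = -1 ->
  (forall s, is_derive s 1 f (df s)) -> (forall s, m <= e * df s) ->
  exists g, [/\ cancel f g, cancel g f & forall x, is_derive x 1 g (df (g x))^-1].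
Proof.
move=> m0 [->|->] h hm.
  by apply: increasing_derive_inverse m0 h _ => s; rewrite -[df s]mul1r.
have [s|g [fK gK dg]] := @increasing_derive_inverse (- f) (fun s => - df s) m m0 _.
  by rewrite -mulN1r.
exists (g \o -%R); split => [x|x|x] /=.
- exact: fK.
- by rewrite -[LHS]opprK -[- f _]/((- f) _) gK opprK.
- have := is_derive1_comp (dg (- x)) (is_deriveN (is_derive_id x 1)).
  by rewrite invrN mulrNN mulr1.
Qed.

End real_calculus.

(** * Changes of variables *)

Section density_measure.
Local Open Scope ereal_scope.
Context d (T : measurableType d) (R : realType).
Variables (mu : {measure set T -> \bar R}) (w : T -> R).
Hypothesis mw : measurable_fun setT w.
Hypothesis w0 : forall x, (0 <= w x)%R.

Definition density_measure (A : set T) := \int[mu]_(x in A) (w x)%:E.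

Let density0 : density_measure set0 = 0.
Proof. by rewrite /density_measure integral_set0. Qed.

Let density_ge0 A : 0 <= density_measure A.
Proof. by apply: integral_ge0 => x _; rewrite lee_fin. Qed.

Let density_sigma_additive : semi_sigma_additive density_measure.
Proof.
apply: semi_sigma_additive_nng_induced => //; exact/measurable_EFinP.
Qed.

HB.instance Definition _ := isMeasure.Build _ _ _ density_measure
  density0 density_ge0 density_sigma_additive.

Hypothesis w1 : density_measure setT = 1.

HB.instance Definition _ := Measure_isProbability.Build _ _ _
  density_measure w1.

Lemma exists_density_probability :
  exists P : probability T R, forall A, P A = \int[mu]_(x in A) (w x)%:E.
Proof. by exists density_measure. Qed.

End density_measure.

Lemma exists_density_measure d (T : measurableType d) (R : realType)
   (mu : {measure set T -> \bar R}) (w : T -> R) :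
   measurable_fun setT w -> (forall x, (0 <= w x)%R) ->
   exists nu : {measure set T -> \bar R}, 
     forall A, nu A = (\int[mu]_(x in A) (w x)%:E)%E.
Proof.
by move=> mw w0; unshelve (exists (density_measure mu w)); [exact: mw|exact: w0|].
Qed.

Section change_of_variables.
Context {R : realType}.
Local Notation leb := (@lebesgue_measure R).
Variables (g dg : R -> R) (m : R).
Hypotheses (m0 : 0 < m) (dgE : forall s : R, is_derive s 1 g (dg s)) (cdg : continuous dg).

Lemma integral_derive a b : a <= b ->
  (\int[leb]_(x in `]a, b]) (dg x)%:E = (g b - g a)%:E)%E.
Proof.
rewrite le_eqVlt => /predU1P[->|ab].
  by rewrite set_itv_ge ?bnd_simp ?ltxx// integral_set0 subrr.
have cg := is_derive_continuous dgE.
rewrite integral_itv_obnd_cbnd//; last first.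
  apply/measurable_EFinP; apply: measurable_funTS; exact: continuous_measurable_fun.
rewrite (@continuous_FTC2 R dg g)//.
- exact: continuous_subspaceT.
- split.
  + by move=> x _; have [] := dgE x.
  + exact/cvg_at_right_filter/cg.
  + exact/cvg_at_left_filter/cg.
- by move=> x _; rewrite derive1E; have [] := dgE x.
Qed.

Hypothesis mdg : forall s, m <= dg s.

(** The image under [g] of the measure with density [dg] gives ]a, b] the mass b - a, by the
    fundamental theorem of calculus; uniqueness of Lebesgue measure identifies it. *)
Lemma ge0_change_of_variables_incr (h : R -> \bar R) :
  measurable_fun [set: measurableTypeR R] (h : measurableTypeR R -> \bar R) -> (forall x, (0 <= h x)%E) ->
  (\int[leb]_x h x = \int[leb]_s (h (g s) * (dg s)%:E))%E.
Proof.
move=> mh h0.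
have dg0 s : 0 <= dg s by exact: le_trans (ltW m0) _.
have mcdg : measurable_fun [set: measurableTypeR R] (dg : measurableTypeR R -> R).
  exact: continuous_measurable_fun.
have mg : measurable_fun [set: measurableTypeR R] (g : measurableTypeR R -> measurableTypeR R).
  by apply: continuous_measurable_fun; exact: is_derive_continuous dgE.
have [nu nuE] := exists_density_measure leb mcdg dg0.
have [xi [gK xiK dxi]] := increasing_derive_inverse m0 dgE mdg.
have gmono : {mono g : x y / x <= y}.
  apply: le_mono => x y xy; have [c e] := mean_value x y dgE.
  by rewrite -subr_gt0 e mulr_gt0 ?subr_gt0// (lt_le_trans m0).
rewrite (@ge0_integral_transfer _ _ (measurableTypeR R) (measurableTypeR R) R nu leb g h)//.
  rewrite (ge0_integral_density (mu := leb) (w := dg))//.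
  exact: measurableT_comp mh mg.
apply: (@lebesgue_measure_unique R
  (measure_function_pushforward__canonical__measure_function_Measure nu mg)).
move=> _ [[a b] _ <-]/=.
rewrite /pushforward nuE.
have -> : g @^-1` `]a, b] = `]xi a, xi b]%classic.
  apply/seteqP; split=> s /=; rewrite !in_itv/=;
    by rewrite -(leW_mono gmono (xi a)) -(gmono s) !xiK.
rewrite lebesgue_measure_itv/= lte_fin.
have ximono : {mono xi : x y / x <= y} by move=> x y; rewrite -gmono !xiK.
case: ltP => ab; first by rewrite integral_derive ?xiK// ximono ltW.
by rewrite set_itv_ge ?integral_set0// bnd_simp -leNgt ximono.
Qed.

End change_of_variables.

Lemma ge0_change_of_variables (R : realType) (g dg : R -> R) (m e : R)
   (h : R -> \bar R) :
  0 < m -> (forall s : R, is_derive s 1 g (dg s)) -> continuous dg ->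
  e = 1 \/ e = -1 -> (forall s, m <= e * dg s) ->
  measurable_fun [set: measurableTypeR R] (h : measurableTypeR R -> \bar R) -> (forall x, (0 <= h x)%E) ->
  (\int[lebesgue_measure]_x h x = \int[lebesgue_measure]_s (h (g s) * `|dg s|%:E))%E.
Proof.
move=> m0 dgE cdg [->|->] mdg mh h0.
  rewrite (ge0_change_of_variables_incr m0 dgE cdg)//; last by move=> s; rewrite -[dg s]mul1r.
  by apply: eq_integral => s _; rewrite ger0_norm// (le_trans (ltW m0))// -[dg s]mul1r.
have mN : measurable_fun [set: measurableTypeR R] (-%R : measurableTypeR R -> measurableTypeR R).
  by [].
(* Decreasing case: Lebesgue measure is symmetric and -g is increasing. *)
transitivity (\int[lebesgue_measure]_x h (- (x : R))%R)%E.
  rewrite [LHS](@ge0_integral_transfer _ _ (measurableTypeR R) (measurableTypeR R) R lebesgue_measure lebesgue_measure -%R h)// => A mA.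
  exact/esym/lebesgue_measureN.
rewrite (@ge0_change_of_variables_incr R (- g) (- dg) m)//.
- apply: eq_integral => s _; rewrite opprK -normrN ger0_norm//.
  by rewrite (le_trans (ltW m0))// -mulN1r.
- by move=> s; apply: continuousN; exact: cdg.
- by move=> s; have := mdg s; rewrite mulN1r.
- exact: measurableT_comp mh mN.
Qed.

Lemma measurable_patch d (T : measurableType d) (R : realType) (D : set T)
    (f : T -> \bar R) : measurable D -> measurable_fun setT f ->
  measurable_fun setT (f \_ D).
Proof.
by move=> mD mf; apply: (measurable_restrictT f mD).1; exact: measurable_funTS.
Qed.

(** * Periodic integrands and sums over inverse branches *)

Section periodic_integrals.
Context {R : realType}.
Local Notation leb := (@lebesgue_measure R).
Implicit Types (h : R -> \bar R) (a b c : R).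

Lemma ge0_integral_itvco_translate h a b c :
  measurable_fun [set: measurableTypeR R] h -> (forall x, (0 <= h x)%E) ->
  (\int[leb]_(x in `[(a + c)%R, (b + c)%R[) h x = \int[leb]_(x in `[a, b[) h (x + c)%R)%E.
Proof.
move=> mh h0; rewrite [LHS]integral_mkcond [RHS]integral_mkcond.
have dE (s : R) : is_derive s 1 (fun s => s + c) ((fun=> 1) s).
  by rewrite -[X in is_derive _ _ _ X]addr0; exact: is_deriveD.
rewrite (@ge0_change_of_variables R (fun s => s + c) (fun=> 1) 1 1)//.
- apply: eq_integral => s _; rewrite normr1 mule1 /patch.
  by rewrite !mem_setE/= !in_itv/= lerD2r ltrD2r.
- by move=> s; exact: cvg_cst.
- by left.
- by move=> s; rewrite mulr1.
- exact: measurable_patch.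
- by move=> x; apply: erestrict_ge0 => y _.
Qed.

Lemma ge0_integral_itvco_split h a b c : a <= b -> b <= c ->
  measurable_fun [set: measurableTypeR R] h -> (forall x, (0 <= h x)%E) ->
  (\int[leb]_(x in `[a, c[) h x =
   \int[leb]_(x in `[a, b[) h x + \int[leb]_(x in `[b, c[) h x)%E.
Proof.
move=> ab bc mh h0.
rewrite (@itv_bndbnd_setU _ _ _ (BLeft b)) ?bnd_simp//.
rewrite ge0_integral_setU//; first exact: measurable_funTS.
rewrite disj_set2E; apply/eqP; rewrite -subset0 => x [] /=.
by rewrite !in_itv/= => /andP[_ xb] /andP[]; rewrite leNgt xb.
Qed.

Lemma ge0_integral_periodic h a :
  measurable_fun [set: measurableTypeR R] h -> (forall x, (0 <= h x)%E) -> one_periodic h ->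
  (\int[leb]_(x in `[a, (a + 1)%R[) h x = \int[leb]_(x in `[0%R, 1%R[) h x)%E.
Proof.
move=> mh h0 ph.
have [r [n [r01 ->]]] : exists r (n : int), 0 <= r < 1 /\ a = r + n%:~R.
  exists (a - (Num.floor a)%:~R), (Num.floor a); split; last by rewrite subrK.
  have := floor_itv a; rewrite intrD => /andP[? ?]; apply/andP; split; lra.
rewrite (addrAC r) ge0_integral_itvco_translate//.
under eq_integral do rewrite one_periodicDz//.
rewrite (@ge0_integral_itvco_split _ r 1); [|lra..|exact: mh|exact: h0].
rewrite (@ge0_integral_itvco_split _ 0 r); [|lra..|exact: mh|exact: h0].
rewrite addeC; congr (_ + _)%E.
rewrite -[X in `[X, _[%classic]add0r ge0_integral_itvco_translate//.
by under eq_integral do rewrite ph.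
Qed.

Lemma ge0_integral_itvco_sum h a (k : nat) :
  measurable_fun [set: measurableTypeR R] h -> (forall x, (0 <= h x)%E) ->
  (\int[leb]_(x in `[a, (a + k%:R)%R[) h x =
   \int[leb]_(x in `[a, (a + 1)%R[) \sum_(j < k) h (x + j%:R)%R)%E.
Proof.
move=> mh h0.
have mhj (j : nat) : measurable_fun [set: measurableTypeR R] (fun x => h (x + j%:R)%R).
  by apply: measurableT_comp mh _; exact: measurable_funD.
elim: k => [|k ih].
  rewrite addr0 set_itv_ge ?bnd_simp ?ltxx// integral_set0.
  by under eq_integral do rewrite big_ord0; rewrite integral0.
rewrite (@ge0_integral_itvco_split _ a (a + k%:R)); [|by rewrite ?lerDl ?lerD2l ?ler_nat..|exact: mh|exact: h0].
rewrite ih.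
under [RHS]eq_integral do rewrite big_ord_recr/=.
rewrite ge0_integralD//.
- congr (_ + _)%E.
  by rewrite -natr1 addrA addrAC ge0_integral_itvco_translate.
- by move=> x _; apply: sume_ge0.
- by apply: measurable_funTS; apply: emeasurable_sum => j.
- exact: measurable_funTS.
Qed.

(** Through [g] one period of [s] becomes an interval of length [k], which is cut into [k] unit
    intervals translated onto each other. The factor |dg| is absorbed by the change of variables. *)
Lemma ge0_integral_branches (g dg xi : R -> R) (m e : R) (k : nat) h :
  0 < m -> e = 1 \/ e = -1 ->
  (forall s : R, is_derive s 1 g (dg s)) -> continuous dg ->
  (forall s, m <= e * dg s) -> (forall s, g (s + 1) = g s + e * k%:R) ->
  cancel g xi -> cancel xi g -> continuous xi ->
  measurable_fun [set: measurableTypeR R] h -> (forall x, (0 <= h x)%E) -> one_periodic h ->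
  (\int[leb]_(s in `[0%R, 1%R[) (h s * `|dg s|%:E) =
   \int[leb]_(x in `[0%R, 1%R[) \sum_(j < k) h (xi (x + j%:R)%R))%E.
Proof.
move=> m0 e1 dgE cdg mdg gk gK xiK cxi mh h0 ph.
have mxi : measurable_fun [set: measurableTypeR R] (xi : measurableTypeR R -> measurableTypeR R).
  exact: continuous_measurable_fun.
have mhxi : measurable_fun [set: measurableTypeR R] (h \o xi) by exact: measurableT_comp.
have mono x y : x < y -> e * g x < e * g y.
  move=> xy; have [c E] := mean_value x y dgE.
  rewrite -subr_gt0 -mulrBr E mulrA mulr_gt0 ?subr_gt0//.
  exact: lt_le_trans m0 _.
have xik x : xi (x + k%:R) = xi x + e.
  apply: (can_inj gK); rewrite xiK.
  case: e1 gk => -> gk; first by rewrite gk xiK mul1r.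
  by have := gk (xi x - 1); rewrite subrK xiK => E; lra.
pose Q x := (\sum_(j < k) h (xi (x + j%:R)%R))%E.
have mQ : measurable_fun [set: measurableTypeR R] Q.
  apply: emeasurable_sum => j; apply: (measurableT_comp mhxi).
  exact: measurable_funD.
have Q0 x : (0 <= Q x)%E by apply: sume_ge0.
(* Moving x by 1 permutes the branches cyclically: the last one returns to the first up to xi (x +
   k) = xi x + e, which the periodic [h] does not see. *)
have pQ : one_periodic Q.
  move=> x; rewrite /Q.
  have -> : (\sum_(j < k) h (xi (x + 1 + j%:R)%R) = \sum_(j < k) h (xi (x + j.+1%:R)%R))%E.
    by apply: eq_bigr => j _; rewrite -addrA nat1r.
  case: k {Q mQ Q0 gk} xik => [|k] xik; first by rewrite !big_ord0.
  rewrite big_ord_recr big_ord_recl/= xik addr0 [RHS]addeC; congr (_ + _)%E.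
  by case: e1 => ->; [rewrite ph|rewrite -[in RHS](subrK 1 (xi x)) ph].
transitivity (\int[leb]_(x in xi @^-1` `[0%R, 1%R[) h (xi x))%E.
  rewrite [LHS]integral_mkcond [RHS]integral_mkcond.
  rewrite [RHS](@ge0_change_of_variables R g dg m e)//.
  - apply: eq_integral => s _; rewrite !patchE.
    have -> : (g s \in xi @^-1` `[0, 1[) = (s \in `[0%R, 1%R[%classic).
      by apply/idP/idP; rewrite !inE/= gK.
    by case: ifPn; rewrite ?gK ?mul0e.
  - apply: measurable_patch => //.
    by rewrite -[X in measurable X]setTI; exact: mxi.
  - by move=> x; apply: erestrict_ge0 => y _.
have [a ->] : exists a, (\int[leb]_(x in xi @^-1` `[0%R, 1%R[) h (xi x) =
   \int[leb]_(x in `[a, (a + k%:R)%R[) h (xi x))%E.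
  have emono : {mono (fun s => e * g s) : x y / x <= y} by apply: le_mono => x y /mono.
  have gk0 := gk 0; rewrite add0r in gk0.
  case: e1 emono gk0 => -> emono gk0.
    exists (g 0); congr (integral _ _ _); apply/seteqP; split=> x /=;
    by rewrite !in_itv/= -(emono 0) -(leW_mono emono _ 1) xiK !mul1r gk0 mul1r.
  (* For e = -1 the image of [0, 1[ is ]g 1, g 0], open at the other end; the endpoints can be
     exchanged because points are null. *)
  exists (g 1); rewrite [LHS](_ : _ = \int[leb]_(x in `](g 1%R), (g 0%R)]) h (xi x))%E.
    have -> : g 1 + k%:R = g 0 by lra.
    rewrite integral_itv_obnd_cbnd -?integral_itv_bndo_bndc//;
      exact: measurable_funTS.
  congr (integral _ _ _); apply/seteqP; split=> x /=;
    by rewrite !in_itv/= -(emono 0) -(leW_mono emono _ 1) xiK !mulN1r lerN2 ltrN2 andbC.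
rewrite (ge0_integral_itvco_sum _ _ mhxi); last by move=> x; exact: h0.
exact: ge0_integral_periodic.
Qed.

End periodic_integrals.

(** * Lifts of expanding maps *)

Section lifts.
Context {R : realType}.
Local Notation tc := (@to_circle R).
Implicit Types (v : circle R -> R) (Phi : circle R -> circle R).

Lemma is_derive_translate (f : R -> R) (s a l : R) :
  is_derive (s + a) 1 f l -> is_derive s 1 (fun t => f (t + a)) l.
Proof.
move=> df; rewrite -[l]mulr1; apply: (@is_derive1_comp R f (fun t => t + a)).
by rewrite -[X in is_derive _ _ _ X]addr0; exact: is_deriveD.
Qed.

Lemma one_periodic_lift (T : Type) (f : circle R -> T) : one_periodic (fun s => f (tc s)).
Proof. by move=> s; rewrite -[1]/(1%:R) to_circleDn. Qed.

Lemma continuous_lift v : continuous v -> continuous (fun s => v (tc s)).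
Proof.
by move=> cv s; apply: continuous_comp; [exact: continuous_to_circle|exact: cv].
Qed.

Lemma is_derive_lift v : fun_derivable v ->
  forall s : R, is_derive s 1 (fun t => v (tc t)) (fun_deriv v (tc s)).
Proof.
move=> dv s; pose f h := v (tc s + tc h).
have -> : (fun t => v (tc t)) = (fun t => f (t - s)).
  by apply/funext => t; rewrite /f -to_circleD addrC subrK.
apply: is_derive_translate; rewrite subrr /fun_deriv derive1E.
by split => //; exact: dv.
Qed.

Lemma fun_deriv_of_lift v (d : R -> R) :
  (forall s : R, is_derive s 1 (fun t => v (tc t)) (d s)) ->
  fun_derivable v /\ forall s, fun_deriv v (tc s) = d s.
Proof.
move=> dv.
have h s : is_derive (0 : R) 1 (fun h => v (tc s + tc h)) (d s).
  have -> : (fun h => v (tc s + tc h)) = (fun h => v (tc (h + s))).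
    by apply/funext => h; rewrite -to_circleD addrC.
  by apply: (@is_derive_translate (v \o tc)); rewrite add0r; exact: dv.
split=> [x|s]; first by rewrite -(short_reprK x); case: (h (short_repr x)).
by rewrite /fun_deriv derive1E; case: (h s).
Qed.

(** Caratheodory's form of the derivative. Only a bound on the increments of [f] is assumed, because
    the intended [f] is a circle distance, whose absolute value blocks the chain rule. *)
Lemma is_derive_squeeze0 (f r : R -> R) (s : R) : is_derive (0 : R) 1 r 0 -> r 0 = 0 ->
  (forall h, `|f (s + h) - f s| <= `|r h|) -> is_derive s 1 f 0.
Proof.
move=> /is_derive1_caratheodory[k [kE ck k0]] r0 hf.
apply/is_derive1_caratheodory.
exists (fun z => if z == s then 0 else (f z - f s) / (z - s)); split.
- move=> z; case: eqP => [->|/eqP zs]; first by rewrite !subrr mulr0.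
  by rewrite divfK// subr_eq0.
- apply/cvgrPdist_lt => eps eps0; rewrite eqxx.
  have ck' : {for s, continuous (fun z => k (z - s))}.
    apply: (@continuous_comp _ _ _ (fun z => z - s) k).
      by apply: cvgB; [exact: cvg_id|exact: cvg_cst].
    by rewrite subrr.
  move/cvgrPdist_lt : ck' => /(_ _ eps0) ck'.
  near=> z; case: eqP => [_|/eqP zs]; first by rewrite subrr normr0.
  have : `|k (s - s) - k (z - s)| < eps by near: z.
  rewrite subrr k0 !sub0r !normrN; apply: le_lt_trans.
  have zs0 : 0 < `|z - s| by rewrite normr_gt0 subr_eq0.
  rewrite normrM normfV ler_pdivrMr// -normrM.
  have := hf (z - s); rewrite (addrC s) subrK => /le_trans; apply.
  by have := kE (z - s); rewrite r0 !subr0 => ->.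
- by rewrite eqxx.
Unshelve. all: by end_near. Qed.

(* If g is a primitive of Phi', the distance from Phi (tc s) to tc (g s) is
   constant, because its derivative vanishes. *)
Lemma exists_map_lift Phi :
  (forall x, derivable (increment Phi x) 0 1) -> continuous (map_deriv Phi) ->
  exists g : R -> R, (forall s, tc (g s) = Phi (tc s)) /\
    forall s : R, is_derive s 1 g (map_deriv Phi (tc s)).
Proof.
move=> dPhi cp.
have [G dG] := continuous_primitive (continuous_lift cp).
pose g s := G s + (short_repr (Phi (tc 0)) - G 0).
have dg (s : R) : is_derive s 1 g (map_deriv Phi (tc s)).
  by rewrite -[X in is_derive _ _ _ X]addr0; exact: is_deriveD.
exists g; split => //.
pose q s := Phi (tc s) - tc (g s).
pose D s := circle_dist (q s) 0.
have dD (s : R) : is_derive s 1 D 0.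
  pose r h := increment Phi (tc s) h - (g (h + s) - g s).
  apply: (@is_derive_squeeze0 D r).
  - rewrite -[X in is_derive _ _ _ X](subrr (map_deriv Phi (tc s))).
    apply: is_deriveB; last first.
      rewrite -[X in is_derive _ _ _ X]subr0; apply: is_deriveB.
      by apply: is_derive_translate; rewrite add0r.
    by rewrite /map_deriv derive1E; split => //; exact: dPhi.
  - by rewrite /r add0r subrr subr0 /increment to_circle0 addr0 subrr short_repr0.
  - move=> h.
    have E : q (s + h) - q s = tc (r h).
      rewrite /r 2!to_circleB /increment short_reprK /q -to_circleD.
      rewrite (addrC h) !opprB addrACA [RHS]addrACA; congr (_ + _).
      exact: addrC.
    apply: (@le_trans _ _ (circle_dist (q (s + h)) (q s))); last first.
      by rewrite /circle_dist E normr_short_repr_le.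
    rewrite ler_norml; apply/andP; split; rewrite /D.
      have := circle_dist_triangle (q (s + h)) (q s) 0.
      rewrite (circle_distC (q s) (q (s + h))); lra.
    have := circle_dist_triangle (q s) (q (s + h)) 0; lra.
move=> s; have D0 : D 0 = 0.
  by rewrite /D /q /g addrCA subrr addr0 short_reprK subrr circle_distxx.
have : D s = 0 by rewrite (is_derive_0_is_cst s 0 dD).
by move=> /circle_dist_eq0/eqP; rewrite subr_eq0 => /eqP.
Qed.


(* g lifts Phi, p and dp are the first two derivatives of g, xi is the inverse
   of g, and e k is the degree of Phi, with e the sign of p. The preimages of
   tc s are the points tc (xi (s + j)) for j < k. *)
Record circle_covering Phi (g p dp xi : R -> R) (e : R) (k : nat) : Prop := {
  cov_lift : forall s, tc (g s) = Phi (tc s);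
  cov_derive : forall s : R, is_derive s 1 g (p s);
  cov_map_deriv : forall s, map_deriv Phi (tc s) = p s;
  cov_derive2 : forall s : R, is_derive s 1 p (dp s);
  cov_derive2_continuous : continuous dp;
  cov_sign : e = 1 \/ e = -1;
  cov_expanding : forall s, 1 <= e * p s;
  cov_degree : forall s, g (s + 1) = g s + e * k%:R;
  cov_degree_gt0 : (0 < k)%N;
  covK : cancel g xi;
  cov_invK : cancel xi g;
  cov_inv_derive : forall s : R, is_derive s 1 xi (p (xi s))^-1
}.

Lemma expanding_covering Phi : map_C2 Phi -> expanding Phi ->
  exists g p dp xi e k, circle_covering Phi g p dp xi e k.
Proof.
move=> [dPhi [ddPhi cddPhi]] ePhi.
pose p s := map_deriv Phi (tc s).
pose dp s := fun_deriv (map_deriv Phi) (tc s).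
have dpE (s : R) : is_derive s 1 p (dp s) by exact: is_derive_lift.
have cp : continuous p := is_derive_continuous dpE.
have cmd : continuous (map_deriv Phi).
  apply/continuousP => A oA; rewrite circle_openE.
  by move/continuousP : cp => /(_ A oA).
have [g [gE dg]] := exists_map_lift dPhi cmd.
have p1 s : 1 < `|p s| by exact: ePhi.
(* Since |p| > 1 everywhere, a change of sign would force a zero of [p] by the intermediate value
   theorem. *)
have [e e1 pe] : exists2 e : R, e = 1 \/ e = -1 & forall s, 1 <= e * p s.
  have noz a b : 1 < p a -> p b < -1 -> False.
    move=> pa pb; have [c pc0] : exists c, p c = 0.
      have [ab|/ltW ba] := leP a b.
        have [|c _ pc] := @IVT R p a b 0 ab (continuous_subspaceT cp); last by exists c.
        by rewrite min_r ?max_l; lra.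
      have [|c _ pc] := @IVT R p b a 0 ba (continuous_subspaceT cp); last by exists c.
      by rewrite min_l ?max_r; lra.
    by have := p1 c; rewrite pc0 normr0 ltr10.
  have dich s : 1 < p s \/ p s < -1.
    by have := p1 s; rewrite ltr_normr => /orP[|]; [left|right; lra].
  have [p0|p0] := dich 0.
    exists 1; first by left.
    by move=> s; have [ps|ps] := dich s; [lra|exfalso; exact: noz p0 ps].
  exists (-1); first by right.
  by move=> s; have [ps|ps] := dich s; [exfalso; exact: noz ps p0|lra].
have [n gn] : exists n : int, g 1 = g 0 + n%:~R.
  have /to_circle_eq/intrP[n E] : tc (g 1) = tc (g 0).
    by rewrite !gE -[1]add0r (one_periodic_lift Phi 0).
  by exists n; rewrite -E addrC subrK.
(* The degree is a value of [p] by the mean value theorem, so it is nonzero and has the sign [e]. *)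
have en1 : 1 <= e * n%:~R.
  have [c] := mean_value 0 1 dg; rewrite gn addrC addKr subr0 mulr1 => ->.
  exact: pe.
have deg s : g (s + 1) = g s + n%:~R.
  have dd (t : R) : is_derive t 1 (fun t => g (t + 1) - g t) 0.
    rewrite -[X in is_derive _ _ _ X](subrr (p t)); apply: is_deriveB.
    by apply: is_derive_translate; rewrite -[p t](one_periodic_lift (map_deriv Phi) t).
  have := is_derive_0_is_cst s 0 dd; rewrite add0r gn addrAC subrr add0r => E.
  lra.
have [k k0 ek] : exists2 k : nat, (0 < k)%N & n%:~R = e * k%:R.
  exists `|n|%N.
    rewrite absz_gt0; apply/eqP => n0; move: en1; rewrite n0 mulr0; lra.
  rewrite natr_absz intr_norm.
  by case: e1 en1 => ->; rewrite ?mul1r ?mulN1r => h; [rewrite ger0_norm; lra|rewrite ler0_norm; lra].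
have [xi [gK xiK dxi]] := derive_inverse ltr01 e1 dg pe.
exists g, p, dp, xi, e, k; split => //.
- exact: continuous_lift.
- by move=> s; rewrite deg ek.
Qed.

(** * Preimages and inverse branches *)

Section covering.
Variables (Phi : circle R -> circle R) (g p dp xi : R -> R) (e : R) (k : nat).
Hypothesis cov : circle_covering Phi g p dp xi e k.

Lemma cov_p_continuous : continuous p.
Proof. exact: is_derive_continuous (cov_derive2 cov). Qed.

Lemma cov_inv_continuous : continuous xi.
Proof. exact: is_derive_continuous (cov_inv_derive cov). Qed.

Lemma cov_p_periodic : one_periodic p.
Proof. by move=> s; rewrite -!(cov_map_deriv cov); exact: one_periodic_lift. Qed.

Lemma cov_sign_sqr : e * e = 1.
Proof. by case: (cov_sign cov) => ->; rewrite ?mulrNN mulr1. Qed.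

Lemma cov_norm s : `|p s| = e * p s.
Proof.
have := cov_expanding cov s; case: (cov_sign cov) => ->; rewrite ?mul1r ?mulN1r => h.
  by rewrite ger0_norm//; lra.
by rewrite ler0_norm//; lra.
Qed.

Lemma cov_sg s : Num.sg (p s) = e.
Proof.
have := cov_expanding cov s; case: (cov_sign cov) => ->; rewrite ?mul1r ?mulN1r => h.
  by rewrite gtr0_sg//; lra.
by rewrite ltr0_sg//; lra.
Qed.

Lemma cov_degreez (n : int) s : g (s + n%:~R) = g s + e * k%:R * n%:~R.
Proof.
have hn (m : nat) t : g (t + m%:R) = g t + e * k%:R * m%:R.
  elim: m => [|m ih]; first by rewrite mulr0 !addr0.
  by rewrite -natr1 addrA (cov_degree cov) ih; ring.
case: n => n; first exact: hn.
have := hn n.+1 (s + (Negz n)%:~R); rewrite NegzE intrN subrK mulrN => ->.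
by rewrite addrK.
Qed.

Lemma cov_inv_degree s : xi (s + k%:R) = xi s + e.
Proof.
apply: (can_inj (covK cov)); rewrite (cov_invK cov).
have -> : e = (if e == 1 then 1 else -1)%:~R :> R.
  by case: (cov_sign cov) => ->; case: eqP => // /eqP; rewrite eqNr oner_eq0.
rewrite cov_degreez (cov_invK cov).
case: (cov_sign cov) => ->; first by rewrite eqxx; ring.
by rewrite eqNr oner_eq0; ring.
Qed.

Lemma cov_preimage x :
  Phi @^-1` [set tc x] = (fun j : 'I_k => tc (xi (x + j%:R))) @` setT.
Proof.
apply/seteqP; split=> [y /=|_ [j _ <-]] /=; last first.
  by rewrite -(cov_lift cov) (cov_invK cov) to_circleDn.
rewrite -(short_reprK y) -(cov_lift cov); set s := short_repr y.
move=> /to_circle_eq/intrP[n gsx].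
have k0 := cov_degree_gt0 cov.
have kz : (k%:Z != 0) by rewrite eqz_nat -lt0n.
have jk : (`|(n %% k%:Z)%Z| < k)%N.
  by rewrite -ltz_nat gez0_abs ?modz_ge0// ltz_pmod.
exists (Ordinal jk) => //=.
(* Euclidean division of [n] by the degree: moving [s] by the quotient, up to the sign dictated by
   [e], leaves the remainder as branch index. *)
have xE : x + `|(n %% k%:Z)%Z|%:R = g (s + (if e == 1 then - (n %/ k%:Z)%Z else (n %/ k%:Z)%Z)%:~R).
  rewrite cov_degreez natr_absz ger0_norm ?modz_ge0//.
  have : n%:~R = ((n %/ k%:Z)%Z)%:~R * k%:R + ((n %% k%:Z)%Z)%:~R :> R.
    by rewrite {1}(divz_eq n k%:Z) intrD intrM.
  case: (cov_sign cov) => ->; first by rewrite eqxx intrN; lra.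
  by rewrite eqNr oner_eq0; lra.
by rewrite xE (covK cov) to_circleDz.
Qed.

Lemma cov_preimage_inj x : injective (fun j : 'I_k => tc (xi (x + j%:R))).
Proof.
move=> i j /to_circle_eq/intrP[n E].
have {}E : xi (x + i%:R) = xi (x + j%:R) + n%:~R by lra.
have := congr1 g E; rewrite cov_degreez !(cov_invK cov) => {}E.
have {}E : (i%:R : R) - j%:R = e * k%:R * n%:~R by lra.
apply/val_inj/eqP; rewrite -(eqr_nat R) -subr_eq0 E.
have [->|n0] := eqVneq n 0; first by rewrite mulr0.
exfalso.
have : `|(i%:R : R) - j%:R| < k%:R.
  have := ltn_ord i; have := ltn_ord j; rewrite -!(ltr_nat R) => h1 h2.
  have h3 : (0 : R) <= i%:R by []. have h4 : (0 : R) <= j%:R by [].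
  by rewrite ltr_norml; apply/andP; split; lra.
rewrite E !normrM; have -> : `|e| = 1.
  by case: (cov_sign cov) => ->; rewrite ?normrN normr1.
rewrite mul1r normr_nat gtr_pMr ?ltr0n ?(cov_degree_gt0 cov)//.
rewrite ltNge => /negP; apply.
by rewrite -intr_norm -[1]/(1%:~R) ler_int -gtz0_ge1 normr_gt0.
Qed.

End covering.

End lifts.

(** * Square integrable functions *)

Section L2.
Context d (T : measurableType d) (R : realType) (mu : probability T R).
Implicit Types f g b : T -> R.

Lemma Lfun2P f : f \in Lfun mu 2%:E <->
  measurable_fun setT f /\ mu.-integrable setT (EFin \o (fun x => f x ^+ 2)).
Proof.
split=> [f2|[mf /integrableP[_ fi]]].
  split; last exact: Lfun2_integrable_sqr.
  by move: f2; rewrite inE => /andP[]; rewrite inE.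
rewrite inE; apply/andP; split; rewrite inE//=.
rewrite /finite_norm unlock poweR_lty//.
move: fi; congr (_ < _)%E; apply: eq_integral => x _ /=.
by rewrite powR_mulrn// normrX.
Qed.

Lemma Lfun2_measurable f : f \in Lfun mu 2%:E -> measurable_fun setT f.
Proof. by case/Lfun2P. Qed.

Lemma Lfun2_sqr_integrable f : f \in Lfun mu 2%:E ->
  mu.-integrable setT (EFin \o (fun x => f x ^+ 2)).
Proof. by case/Lfun2P. Qed.

Lemma Lfun2_dominated f g c : measurable_fun setT f -> g \in Lfun mu 2%:E ->
  (forall x, `|f x| <= c * `|g x|) -> f \in Lfun mu 2%:E.
Proof.
move=> mf g2 fg; apply/Lfun2P; split => //.
apply: (@le_integrable _ _ _ _ _ _ _ (EFin \o (fun x => c ^+ 2 * g x ^+ 2))) => //.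
- by apply/measurable_EFinP; exact: measurable_funX.
- move=> x _ /=; rewrite lee_fin -exprMn !normrX lerXn2r ?nnegrE// normrM.
  by rewrite (le_trans (fg x))// ler_wpM2r// ler_norm.
- have := integrableZl measurableT (c ^+ 2) (Lfun2_sqr_integrable g2).
  by apply: eq_integrable => // x _ /=; rewrite EFinM.
Qed.

Lemma Lfun2_integrable f : f \in Lfun mu 2%:E -> mu.-integrable setT (EFin \o f).
Proof.
move=> f2; apply/Lfun1_integrable.
have fin1 : mu [set: T] \is a fin_num by rewrite probability_setT.
exact: (Lfun_subset12 fin1).
Qed.

Lemma Lfun2_cst c : (fun=> c) \in Lfun mu 2%:E.
Proof. exact: Lfun_cst. Qed.

Lemma Lfun2_bounded f c : measurable_fun setT f -> (forall x, `|f x| <= c) ->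
  f \in Lfun mu 2%:E.
Proof.
move=> mf fc; apply: (@Lfun2_dominated _ (fun=> 1) c) => //; first exact: Lfun2_cst.
by move=> x; rewrite normr1 mulr1.
Qed.

Lemma Lfun2D f g : f \in Lfun mu 2%:E -> g \in Lfun mu 2%:E ->
  (fun x => f x + g x) \in Lfun mu 2%:E.
Proof. by move=> f2 g2; apply: (rpredD f2 g2); rewrite ?lee1n. Qed.

Lemma Lfun2Z c f : f \in Lfun mu 2%:E -> (fun x => c * f x) \in Lfun mu 2%:E.
Proof.
move=> f2; apply: (@Lfun2_dominated _ f `|c|) => //.
  by apply: measurable_funM => //; exact: Lfun2_measurable.
by move=> x; rewrite normrM.
Qed.

Lemma Lfun2B f g : f \in Lfun mu 2%:E -> g \in Lfun mu 2%:E ->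
  (fun x => f x - g x) \in Lfun mu 2%:E.
Proof.
move=> f2 g2; have := Lfun2D f2 (Lfun2Z (-1) g2).
rewrite [X in X \in _ -> _](_ : _ = fun x => f x - g x)//.
by apply/funext => x; rewrite mulN1r.
Qed.

Lemma Lfun2M_integrable f g : f \in Lfun mu 2%:E -> g \in Lfun mu 2%:E ->
  mu.-integrable setT (EFin \o (fun x => f x * g x)).
Proof. by move=> f2 g2; apply/Lfun1_integrable; exact: Lfun2_mul_Lfun1. Qed.

Lemma Rintegral_sqr_ge0 f : 0 <= \int[mu]_x (f x ^+ 2).
Proof. by apply: Rintegral_ge0 => x _; exact: sqr_ge0. Qed.

Lemma Lnorm2E f : f \in Lfun mu 2%:E ->
  ('N[mu]_2%:E[EFin \o f] = (Num.sqrt (\int[mu]_x (f x ^+ 2))%R)%:E)%E.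
Proof.
move=> f2; rewrite unlock.
under eq_integral do rewrite /= powR_mulrn// -normrX ger0_norm ?sqr_ge0//.
rewrite -(@fineK _ (\int[mu]_x _)%E) ?(integrable_fin_num _ (Lfun2_sqr_integrable f2))//.
by rewrite poweR_EFin powR12_sqrt// Rintegral_sqr_ge0.
Qed.

Lemma le_Rintegral_sqr f g c : f \in Lfun mu 2%:E -> g \in Lfun mu 2%:E ->
  (forall x, `|f x| <= c * `|g x|) ->
  \int[mu]_x (f x ^+ 2) <= c ^+ 2 * \int[mu]_x (g x ^+ 2).
Proof.
move=> f2 g2 fg; rewrite -RintegralZl//; last exact: Lfun2_sqr_integrable.
apply: le_Rintegral => //.
- exact: Lfun2_sqr_integrable.
- have := integrableZl measurableT (c ^+ 2) (Lfun2_sqr_integrable g2).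
  by apply: eq_integrable => // x _ /=; rewrite EFinM.
- move=> x _; rewrite -exprMn -[leLHS]ger0_norm ?sqr_ge0//.
  rewrite -[leRHS]ger0_norm ?sqr_ge0// !normrX lerXn2r ?nnegrE// normrM.
  by rewrite (le_trans (fg x))// ler_wpM2r// ler_norm.
Qed.

Lemma le_Rintegral_sqrD f g : f \in Lfun mu 2%:E -> g \in Lfun mu 2%:E ->
  \int[mu]_x ((f x + g x) ^+ 2) <=
  2 * \int[mu]_x (f x ^+ 2) + 2 * \int[mu]_x (g x ^+ 2).
Proof.
move=> f2 g2.
have i f' : f' \in Lfun mu 2%:E -> mu.-integrable setT (EFin \o (fun x => 2 * f' x ^+ 2)).
  move=> h2; have := integrableZl measurableT 2 (Lfun2_sqr_integrable h2).
  by apply: eq_integrable => // x _ /=; rewrite EFinM.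
rewrite -!RintegralZl//; [|exact: Lfun2_sqr_integrable..].
rewrite -RintegralD//; [|exact: i..].
apply: le_Rintegral => //.
- exact/Lfun2_sqr_integrable/Lfun2D.
- have := integrableD measurableT (i _ f2) (i _ g2).
  by apply: eq_integrable => // x _ /=; rewrite EFinD.
- by move=> x _; have := sqr_ge0 (f x - g x); nra.
Qed.

(** The variance of [f] under the probability [mu] is nonnegative. *)
Lemma sqr_Rintegral_le f : f \in Lfun mu 2%:E ->
  (\int[mu]_x f x) ^+ 2 <= \int[mu]_x (f x ^+ 2).
Proof.
move=> f2; set a := \int[mu]_x f x.
have := Rintegral_sqr_ge0 (fun x => f x - a).
rewrite (@eq_Rintegral _ _ _ _ _ (fun x => f x ^+ 2 + (- (2 * a) * f x + a ^+ 2))); last first.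
  by move=> x _ /=; ring.
have ic c : mu.-integrable setT (EFin \o (fun=> c)).
  exact/Lfun2_integrable/Lfun2_cst.
have i1 : mu.-integrable setT (EFin \o (fun x => - (2 * a) * f x)).
  exact/Lfun2_integrable/Lfun2Z.
have i2 : mu.-integrable setT (EFin \o (fun x => - (2 * a) * f x + a ^+ 2)).
  exact/Lfun2_integrable/Lfun2D/Lfun2_cst/Lfun2Z.
rewrite RintegralD//; last exact: Lfun2_sqr_integrable.
rewrite RintegralD// RintegralZl//; last exact: Lfun2_integrable.
have mu1 : fine (mu [set: T]) = 1 by rewrite probability_setT.
rewrite Rintegral_cst// mu1 -/a => h; rewrite -subr_ge0; move: h; congr (_ <= _); ring.
Qed.

End L2.

Lemma maxe_mule_ge0 (R : realType) (a : \bar R) (w : R) : 0 <= w ->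
  (maxe (a * w%:E) 0 = maxe a 0 * w%:E)%E.
Proof.
move=> w0; have [a0|/ltW a0] := leP 0%E a.
  by rewrite max_l// mule_ge0// lee_fin.
by rewrite max_r ?mul0e// mule_le0_ge0.
Qed.

Lemma integral_density d (T : measurableType d) (R : realType)
    (mu nu : {measure set T -> \bar R}) (w : T -> R) (f : T -> \bar R) :
  measurable_fun setT w -> (forall x, 0 <= w x) ->
  (forall A, measurable A -> nu A = \int[mu]_(x in A) (w x)%:E)%E ->
  measurable_fun setT f ->
  (\int[nu]_x f x = \int[mu]_x (f x * (w x)%:E))%E.
Proof.
move=> mw w0 nuE mf; rewrite [LHS]integralE [RHS]integralE.
rewrite !(ge0_integral_density mw w0 nuE)//.
- congr (_ - _)%E; apply: eq_integral => x _; first by rewrite !funeposE maxe_mule_ge0.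
  by rewrite !funenegE -maxe_mule_ge0// mulNe.
- exact: measurable_funeneg.
- exact: measurable_funepos.
Qed.

Lemma integral_circle (R : realType) (f : circle R -> \bar R) :
  measurable_fun setT f ->
  (\int[circle_lebesgue R]_x f x =
   \int[lebesgue_measure]_(s in `[0%R, 1%R[) f (to_circle s))%E.
Proof.
move=> mf; rewrite [LHS]integralE [RHS]integralE.
rewrite !ge0_integral_circle//.
- by congr (_ - _)%E; apply: eq_integral => x _; rewrite ?funeposE ?funenegE.
- exact: measurable_funeneg.
- exact: measurable_funepos.
Qed.

Lemma is_derive_sumord (R : realType) (n : nat) (f df : nat -> R -> R) (s : R) :
  (forall j, is_derive s 1 (f j) (df j s)) ->
  is_derive s 1 (fun t => \sum_(j < n) f j t) (\sum_(j < n) df j s).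
Proof.
move=> h; elim: n => [|n ih].
  rewrite big_ord0 (_ : (fun t => _) = cst 0); first exact: is_derive_cst.
  by apply/funext => t; rewrite big_ord0.
rewrite big_ord_recr/= (_ : (fun t => _) = (fun t => \sum_(j < n) f j t) + f n).
  exact: is_deriveD.
by apply/funext => t; rewrite big_ord_recr.
Qed.

Lemma continuous_measurable_lift (R : realType) (v : circle R -> R) :
  continuous (fun s => v (to_circle s)) -> measurable_fun setT v.
Proof.
move=> cv; apply: measurable_fun_of_lift.
exact: (@continuous_measurable_fun R).
Qed.

Lemma continuous_sumord (R : realType) (n : nat) (f : nat -> R -> R) :
  (forall j, continuous (f j)) -> continuous (fun t => \sum_(j < n) f j t).
Proof.
move=> h; elim: n => [|n ih].
  rewrite (_ : (fun t => _) = cst 0); first by move=> s; exact: cvg_cst.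
  by apply/funext => t; rewrite big_ord0.
rewrite (_ : (fun t => _) = (fun t => \sum_(j < n) f j t) + f n).
  by move=> s; apply: continuousD; [exact: ih|exact: h].
by apply/funext => t; rewrite big_ord_recr.
Qed.

Lemma continuous_compR (R : realType) (f h : R -> R) :
  continuous f -> continuous h -> continuous (fun s => h (f s)).
Proof. by move=> cf ch s; exact: (continuous_comp (cf s) (ch (f s))). Qed.

(** * The transfer operator *)

Section transfer_operator.
Context {R : realType}.
Local Notation tc := (@to_circle R).
Local Notation leb := (@lebesgue_measure R).
Variables (Phi : circle R -> circle R) (g p dp xi : R -> R) (e : R) (k : nat).
Hypothesis cov : circle_covering Phi g p dp xi e k.
Variables (rho : circle R -> R) (mu : probability (circle R) R).
Hypothesis inv : invariant_density Phi rho mu.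

Implicit Types (f : circle R -> R) (s : R).

Let r s := rho (tc s).
Let dr s := fun_deriv rho (tc s).

Lemma rho_gt0 x : 0 < rho x. Proof. by case: inv. Qed.

Lemma rho_derive (s : R) : is_derive s 1 (fun t => rho (tc t)) (fun_deriv rho (tc s)).
Proof. by case: inv => -[drho _] _ _ _; exact: is_derive_lift. Qed.

Lemma rho_lift_continuous : continuous r.
Proof. exact: is_derive_continuous rho_derive. Qed.

Lemma rho_derive_continuous : continuous dr.
Proof. by case: inv => -[_ cdrho] _ _ _; exact: continuous_lift. Qed.

Lemma measurable_rho : measurable_fun setT rho.
Proof. exact: (continuous_measurable_lift rho_lift_continuous). Qed.

Lemma measurable_map_deriv : measurable_fun setT (map_deriv Phi).
Proof.
apply: continuous_measurable_lift => s.
under eq_fun do rewrite (cov_map_deriv cov).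
exact: (cov_p_continuous cov).
Qed.

Lemma measurable_expanding : measurable_fun setT Phi.
Proof.
apply: measurable_fun_of_lift.
rewrite (_ : Phi \o tc = tc \o g); last first.
  by apply/funext => s /=; rewrite (cov_lift cov).
apply: measurableT_comp; first exact: measurable_to_circle.
by apply: continuous_measurable_fun; exact: is_derive_continuous (cov_derive cov).
Qed.

Lemma integral_mu (f : circle R -> \bar R) : measurable_fun setT f ->
  (\int[mu]_x f x = \int[circle_lebesgue R]_x (f x * (rho x)%:E))%E.
Proof.
move=> mf; apply: integral_density => //.
- exact: measurable_rho.
- by move=> x; exact/ltW/rho_gt0.
- by case: inv.
Qed.

Lemma integral_mu_lift (f : circle R -> \bar R) : measurable_fun setT f ->
  (\int[mu]_x f x = \int[leb]_(s in `[0%R, 1%R[) (f (tc s) * (r s)%:E))%E.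
Proof.
move=> mf; rewrite integral_mu// integral_circle//.
apply: emeasurable_funM => //.
by apply/measurable_EFinP; exact: measurable_rho.
Qed.

Lemma fsbig_preimage (F : circle R -> R) s :
  \sum_(y \in Phi @^-1` [set tc s]) F y = \sum_(j < k) F (tc (xi (s + j%:R))).
Proof.
pose h (j : nat) := tc (xi (s + j%:R)).
have -> : Phi @^-1` [set tc s] = h @` `I_k.
  rewrite (cov_preimage cov); apply/seteqP; split=> [_ [j _ <-]|_ [j /= jk <-]].
    by exists j => //=; exact: ltn_ord.
  by exists (Ordinal jk).
rewrite fsbig_image; first by rewrite -fsbig_ord.
move=> i j; rewrite !inE/= => ik jk hij.
by have := cov_preimage_inj cov (x := s) (x1 := Ordinal ik) (x2 := Ordinal jk) hij => -[].
Qed.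

Lemma branch_sum_continuous (f : R -> R) : continuous f ->
  continuous (fun s : R => \sum_(j < k) f (xi (s + j%:R))).
Proof.
move=> cf; apply: (@continuous_sumord _ _ (fun j s => f (xi (s + j%:R)))) => j.
have cs : continuous (fun s : R => s + j%:R).
  by move=> t; apply: cvgD; [exact: cvg_id|exact: cvg_cst].
exact: (continuous_compR (continuous_compR cs (cov_inv_continuous cov)) cf).
Qed.

Lemma branch_sum_periodic (f : R -> R) : one_periodic f ->
  one_periodic (fun s : R => \sum_(j < k) f (xi (s + j%:R))).
Proof.
move=> pf s; pose a (j : nat) := f (xi (s + j%:R)).
have ak : a k = a 0%N.
  rewrite /a (cov_inv_degree cov) addr0.
  by case: (cov_sign cov) => ->; [rewrite pf|rewrite -[in RHS](subrK 1 (xi s)) pf].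
have -> : \sum_(j < k) f (xi (s + 1 + j%:R)) = \sum_(j < k) a j.+1.
  by apply: eq_bigr => j _; rewrite /a -addrA nat1r.
have := erefl (\sum_(j < k.+1) a j).
rewrite [LHS]big_ord_recl [RHS]big_ord_recr/= ak => E.
by apply: (@addrI _ (a 0%N)); rewrite [RHS]addrC -E.
Qed.

(** The transfer operator of [Phi] normalised by the density: composed with [Phi], it is the
    conditional expectation of [f] given [Phi] under [mu]. *)
Definition transfer (f : circle R -> R) (x : circle R) : R :=
  \sum_(y \in Phi @^-1` [set x]) rho y / (rho x * `|map_deriv Phi y|) * f y.

Let q s := r s / `|p s|.

Lemma transfer_lift f s :
  transfer f (tc s) = (\sum_(j < k) q (xi (s + j%:R)) * f (tc (xi (s + j%:R)))) / r s.
Proof.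
rewrite /transfer fsbig_preimage mulr_suml; apply: eq_bigr => j _.
by rewrite (cov_map_deriv cov) /q /r invfM; ring.
Qed.

Let q_ge0 s : 0 <= q s.
Proof. by rewrite divr_ge0//; exact/ltW/rho_gt0. Qed.

Let q_periodic : one_periodic q.
Proof.
by move=> s; rewrite /q (cov_p_periodic cov) /r (one_periodic_lift rho).
Qed.

Let q_continuous : continuous q.
Proof.
move=> s; apply: continuousM; first exact: rho_lift_continuous.
apply: continuousV.
  by rewrite normr_eq0 -normr_gt0 (cov_norm cov) (lt_le_trans ltr01)// (cov_expanding cov).
by apply: cvg_norm; exact: (cov_p_continuous cov).
Qed.

Let inv_shift_continuous (j : nat) : continuous (fun s : R => xi (s + j%:R)).
Proof.
move=> s; apply: (@continuous_comp _ _ _ (fun s : R => s + j%:R) xi); last exact: (cov_inv_continuous cov).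
by apply: cvgD; [exact: cvg_id|exact: cvg_cst].
Qed.

Lemma measurable_transfer f : measurable_fun setT f -> measurable_fun setT (transfer f).
Proof.
move=> mf; apply: measurable_fun_of_lift.
rewrite (_ : transfer f \o tc = fun s => (\sum_(j < k) q (xi (s + j%:R)) * f (tc (xi (s + j%:R)))) / r s); last first.
  by apply/funext => s /=; exact: transfer_lift.
apply: measurable_funM; last first.
  apply: continuous_measurable_fun => s; apply: continuousV; last exact: rho_lift_continuous.
  by rewrite gt_eqF// rho_gt0.
apply: measurable_sum => j; apply: measurable_funM.
  apply: continuous_measurable_fun.
  exact: (continuous_compR (@inv_shift_continuous j) q_continuous).
apply: (measurableT_comp mf); apply: (measurableT_comp (@measurable_to_circle R)).
exact: continuous_measurable_fun (@inv_shift_continuous j).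
Qed.

(** With h = f rho / |Phi'| the integrand f rho is h |p|, and [ge0_integral_branches] replaces it by
    the sum of h over the preimages, which is the transfer times rho. *)
Lemma ge0_integral_transfer_op f : measurable_fun setT f -> (forall x, 0 <= f x) ->
  (\int[mu]_x (transfer f x)%:E = \int[mu]_x (f x)%:E)%E.
Proof.
move=> mf f0.
rewrite integral_mu_lift; last by apply/measurable_EFinP; exact: measurable_transfer.
rewrite integral_mu_lift; last exact/measurable_EFinP.
pose h s := (f (tc s) * q s)%:E.
have mftc : measurable_fun [set: measurableTypeR R] (f \o tc).
  exact: measurable_comp_to_circle.
have -> : (\int[leb]_(s in `[0%R, 1%R[) ((f (tc s))%:E * (r s)%:E) =
           \int[leb]_(s in `[0%R, 1%R[) (h s * `|p s|%:E))%E.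
  apply: eq_integral => s _; rewrite /h -!EFinM -mulrA divfK//.
  by rewrite -normr_gt0 normr_id (cov_norm cov) (lt_le_trans ltr01)// (cov_expanding cov).
rewrite (@ge0_integral_branches R g p xi 1 e k h ltr01 (cov_sign cov) (cov_derive cov)
  (cov_p_continuous cov) (cov_expanding cov) (cov_degree cov) (covK cov) (cov_invK cov)
  (cov_inv_continuous cov)).
- apply: eq_integral => s _; rewrite transfer_lift -EFinM divfK; last first.
    by rewrite gt_eqF// rho_gt0.
  by rewrite -sumEFin; apply: eq_bigr => j _; rewrite /h mulrC.
- apply/measurable_EFinP; apply: measurable_funM => //.
  exact: continuous_measurable_fun q_continuous.
- by move=> s; rewrite lee_fin mulr_ge0.
- by move=> s; rewrite /h q_periodic (one_periodic_lift f).
Qed.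

(** The arc ]c, c + d], described from [c] in the chart, which makes it measurable at once. Lengths
    below 1/2 stay inside the chart. *)
Let arc (c d : R) : set (circle R) := [set x | short_repr (x - tc c) \in `]0, d]].

Let measurable_arc c d : measurable (arc c d).
Proof.
have m : measurable_fun [set: circle R] (fun x : circle R => short_repr (x - tc c)).
  apply: (measurableT_comp measurable_short_repr).
  have -> : (fun x : circle R => x - tc c) = (fun x => x + tc (- c)).
    by apply/funext => x; rewrite to_circleN.
  exact: measurable_translate_circle.
have -> : arc c d = [set: circle R] `&` (fun x => short_repr (x - tc c)) @^-1` `]0, d].
  by rewrite setTI.
exact: m.
Qed.

Let integral_arc (f Q : R -> R) c d : continuous f -> (forall s, 0 <= f s) ->
  one_periodic f -> (forall s : R, is_derive s 1 Q (f s)) -> 0 <= d < 2^-1 ->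
  (\int[leb]_(s in `[0%R, 1%R[) ((\1_(arc c d) (tc s))%:E * (f s)%:E) =
   (Q (c + d) - Q c)%:E)%E.
Proof.
move=> cf f0 pf dQ /andP[d0 d2].
(* The period is centred at [c], where the chart reads tc s - tc c as s - c without a jump. *)
rewrite -(@ge0_integral_periodic _ (fun s => (\1_(arc c d) (tc s))%:E * (f s)%:E)%E (c - 2^-1)).
- rewrite -(integral_derive dQ cf); last by rewrite lerDl.
  rewrite [LHS]integral_mkcond [RHS]integral_mkcond; apply: eq_integral => s _.
  rewrite !patchE; case: ifPn => [|sc]; last first.
    rewrite ifF//; apply/negbTE; apply: contra sc; rewrite !inE/= !in_itv/=.
    by move=> /andP[? ?]; apply/andP; split; lra.
  rewrite inE/= in_itv/= => /andP[cs sc].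
  have E : (tc s \in arc c d) = (s \in `]c, c + d]%classic).
    have Esc : short_repr (tc s - tc c) = s - c.
      by rewrite -to_circleB short_repr_small//; apply/andP; split; lra.
    apply/idP/idP => /set_mem h; apply/mem_set; move: h; rewrite /arc/= Esc !in_itv/=;
    by move=> /andP[? ?]; apply/andP; split; lra.
  by rewrite indicE E; case: ifPn => _; rewrite ?mul1e ?mul0e.
- apply: emeasurable_funM; apply/measurable_EFinP; last exact: continuous_measurable_fun cf.
  have mi : measurable_fun [set: circle R] (\1_(arc c d) : circle R -> R).
    exact: measurable_indic.
  exact: (measurable_comp_to_circle mi).
- by move=> s; rewrite mule_ge0// lee_fin.
- by move=> s; rewrite pf (one_periodic_lift \1_(arc c d)).
Qed.

(* Both sides are continuous densities of mu. *)
Lemma sum_branches_density s : \sum_(j < k) q (xi (s + j%:R)) = r s.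
Proof.
pose f1 t := \sum_(j < k) q (xi (t + j%:R)).
have cf1 : continuous f1 by exact: branch_sum_continuous.
have [F dF] := continuous_primitive rho_lift_continuous.
have [F1 dF1] := continuous_primitive cf1.
have transfer_indic A t : transfer \1_(Phi @^-1` A) (tc t) = \1_A (tc t) * f1 t / r t.
  rewrite transfer_lift; congr (_ / _); rewrite /f1 mulr_sumr; apply: eq_bigr => j _.
  rewrite mulrC; congr (_ * _); rewrite !indicE; congr ((_ : bool)%:R).
  apply/idP/idP; rewrite !inE/= -(cov_lift cov) (cov_invK cov) to_circleDn//.
(* By invariance the mass of the arc is that of its preimage, and the transfer of the indicator of
   the preimage is the indicator of the arc times f1 / r. *)
have eqA c d : 0 <= d < 2^-1 -> F1 (c + d) - F1 c = F (c + d) - F c.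
  move=> d2; apply: EFin_inj.
  rewrite -(integral_arc _ rho_lift_continuous _ _ dF)//; last 2 first.
  - by move=> t; exact/ltW/rho_gt0.
  - exact: one_periodic_lift.
  rewrite -(integral_arc _ cf1 _ _ dF1)//; last 2 first.
  - by move=> t; apply: sumr_ge0.
  - exact: branch_sum_periodic.
  rewrite -(integral_mu_lift (f := EFin \o \1_(arc c d))); last first.
    by apply/measurable_EFinP; exact: measurable_indic.
  rewrite integral_indic// setIT.
  have mpre : measurable (Phi @^-1` (arc c d)).
    by rewrite -[X in measurable X]setTI; exact: measurable_expanding.
  apply: etrans; last by have [_ _ _ h] := inv; exact: h.
  have -> : mu (Phi @^-1` (arc c d)) = (\int[mu]_x (\1_(Phi @^-1` (arc c d)) x)%:E)%E.
    by rewrite integral_indic ?setIT.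
  rewrite -ge0_integral_transfer_op//.
  rewrite integral_mu_lift; last first.
    by apply/measurable_EFinP; apply: measurable_transfer; exact: measurable_indic.
  apply: eq_integral => t _; rewrite transfer_indic -!EFinM divfK//.
  by rewrite gt_eqF// rho_gt0.
(* The two primitives have equal increments near [s], so their difference is locally constant; its
   derivative is also f1 s - r s. *)
have d0 : is_derive s 1 (fun t => F1 t - F t) 0.
  have cst_near : {near s, (cst (F1 s - F s)) =1 (fun t => F1 t - F t)}.
    near=> t; rewrite /cst.
    have st : `|s - t| < 2^-1 by near: t; apply: (nbhsx_ballx s); rewrite invr_gt0.
    move: st; rewrite ltr_norml => /andP[? ?].
    have [ts|ts] := leP t s.
      have := eqA t (s - t); rewrite (addrC t) subrK => E.
      have {}E := E ltac:(by apply/andP; split; lra). lra.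
    have := eqA s (t - s); rewrite (addrC s) subrK => E.
    have {}E := E ltac:(by apply/andP; split; lra). lra.
  apply: near_eq_is_derive cst_near _ => //.
have d1 : is_derive s 1 (fun t => F1 t - F t) (f1 s - r s) by apply: is_deriveB.
apply/eqP; rewrite -subr_eq0; apply/eqP.
by have [_ <-] := d1; have [_ ->] := d0.
Unshelve. all: by end_near. Qed.

Lemma transfer_lift_avg f s :
  transfer f (tc s) =
  \sum_(j < k) (q (xi (s + j%:R)) / r s) * f (tc (xi (s + j%:R))).
Proof.
rewrite transfer_lift mulr_suml; apply: eq_bigr => j _.
by rewrite mulrAC.
Qed.

(** The density identity over the preimages makes the weights of [transfer] a probability, so each
    value of [transfer f] is an average of [f] over a fibre. *)
Lemma avg_weights_sum s : \sum_(j < k) (q (xi (s + j%:R)) / r s) = 1.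
Proof. by rewrite -mulr_suml sum_branches_density divff// gt_eqF// rho_gt0. Qed.

Lemma transferZD a f (h : circle R -> R) x :
  transfer (fun y => a * f y + h y) x = a * transfer f x + transfer h x.
Proof.
rewrite -(short_reprK x) !transfer_lift_avg mulr_sumr -big_split/=.
by apply: eq_bigr => j _; rewrite mulrDr mulrCA.
Qed.

(** [u \o Phi] is constant on each fibre, hence comes out of the average. *)
Lemma transferM f (u : circle R -> R) x :
  transfer (fun y => f y * u (Phi y)) x = transfer f x * u x.
Proof.
rewrite -(short_reprK x) !transfer_lift_avg mulr_suml.
apply: eq_bigr => j _; rewrite -(cov_lift cov) (cov_invK cov) to_circleDn.
by rewrite mulrA.
Qed.

Lemma transfer_ge0 f x : (forall y, 0 <= f y) -> 0 <= transfer f x.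
Proof.
move=> f0; rewrite -(short_reprK x) transfer_lift_avg; apply: sumr_ge0 => j _.
by rewrite mulr_ge0// divr_ge0//; exact/ltW/rho_gt0.
Qed.

(** Jensen's inequality for the weights on a fibre: the average of (f - m)^2 is nonnegative, with
    [m] the average of [f]. *)
Lemma sqr_transfer_le f x : transfer f x ^+ 2 <= transfer (fun y => f y ^+ 2) x.
Proof.
rewrite -(short_reprK x); set s := short_repr x; set m := transfer f _.
have : 0 <= transfer (fun y => (f y - m) ^+ 2) (tc s).
  by apply: transfer_ge0 => y; exact: sqr_ge0.
have -> : (fun y => (f y - m) ^+ 2) = (fun y => (- 2 * m) * f y + (1 * f y ^+ 2 + m ^+ 2)).
  by apply/funext => y; ring.
rewrite !transferZD -/m mul1r.
have -> : transfer (fun=> m ^+ 2) (tc s) = m ^+ 2.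
  by rewrite transfer_lift_avg -mulr_suml avg_weights_sum mul1r.
by move=> h; rewrite -subr_ge0; move: h; congr (_ <= _); ring.
Qed.

Lemma Lfun2_transfer f : f \in Lfun mu 2%:E -> transfer f \in Lfun mu 2%:E /\
  \int[mu]_x (transfer f x ^+ 2) <= \int[mu]_x (f x ^+ 2).
Proof.
move=> f2; have mf := Lfun2_measurable f2.
have mt := measurable_transfer mf.
have le1 : (\int[mu]_x (transfer f x ^+ 2)%:E <= \int[mu]_x (f x ^+ 2)%:E)%E.
  rewrite -(ge0_integral_transfer_op (f := fun x => f x ^+ 2))//; last 2 first.
  - exact: measurable_funX.
  - by move=> x; exact: sqr_ge0.
  apply: ge0_le_integral => //.
  - by move=> x _; rewrite lee_fin sqr_ge0.
  - by apply/measurable_EFinP; exact: measurable_funX.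
  - by apply/measurable_EFinP; apply: measurable_transfer; exact: measurable_funX.
  - by move=> x _; rewrite lee_fin sqr_transfer_le.
have fi := Lfun2_sqr_integrable f2.
have t2 : transfer f \in Lfun mu 2%:E.
  apply/Lfun2P; split => //; apply/integrableP; split.
    by apply/measurable_EFinP; exact: measurable_funX.
  have /integrableP[_] := fi; apply: le_lt_trans.
  under eq_integral do rewrite /= ger0_norm ?sqr_ge0//.
  by under [leRHS]eq_integral do rewrite /= ger0_norm ?sqr_ge0//.
split=> //; apply: fine_le => //.
- exact: (integrable_fin_num _ (Lfun2_sqr_integrable t2)).
- exact: (integrable_fin_num _ fi).
Qed.

Lemma Rintegral_transfer f : mu.-integrable setT (EFin \o f) ->
  \int[mu]_x transfer f x = \int[mu]_x f x.
Proof.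
move=> fi; have mf : measurable_fun setT f by have /integrableP[/measurable_EFinP] := fi.
pose fp x := Num.max (f x) 0; pose fn x := Num.max (- f x) 0.
(* Positive and negative parts, combined in the shape of [transferZD]. *)
have fE : f = fun x => -1 * fn x + fp x.
  apply/funext => x; rewrite /fn /fp.
  have [f0|f0] := leP 0 (f x); first by rewrite max_r; lra.
  by rewrite max_l; lra.
have main (h : circle R -> R) : measurable_fun setT h -> (forall x, 0 <= h x) -> (forall x, h x <= `|f x|) ->
    [/\ mu.-integrable setT (EFin \o h), mu.-integrable setT (EFin \o transfer h) &
      \int[mu]_x transfer h x = \int[mu]_x h x].
  move=> mh h0 hf.
  have hi : mu.-integrable setT (EFin \o h).
    apply: le_integrable fi => //; first exact/measurable_EFinP.
    by move=> x _; rewrite /= lee_fin ger0_norm.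
  have E := ge0_integral_transfer_op mh h0.
  split => //; last by rewrite /Rintegral E.
  apply/integrableP; split; first by apply/measurable_EFinP; exact: measurable_transfer.
  have /integrableP[_] := hi; apply: le_lt_trans.
  under eq_integral do rewrite /= ger0_norm ?transfer_ge0//.
  by under [leRHS]eq_integral do rewrite /= ger0_norm//; rewrite E.
have [||| pi tpi pE] := main fp.
- by apply: measurable_maxr.
- by move=> x; rewrite le_max lexx orbT.
- by move=> x; rewrite ge_max ler_norm normr_ge0.
have [||| ni tni nE] := main fn.
- by apply: measurable_maxr => //; exact: measurableT_comp.
- by move=> x; rewrite le_max lexx orbT.
- by move=> x; rewrite ge_max -normrN ler_norm normr_ge0.
rewrite [in LHS]fE [in RHS]fE.
under eq_Rintegral do rewrite transferZD.
have Zi (h : circle R -> R) : mu.-integrable setT (EFin \o h) -> mu.-integrable setT (EFin \o (fun x => -1 * h x)).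
  move=> hi; have := integrableZl measurableT (-1) hi.
  by apply: eq_integrable => // x _ /=; rewrite EFinM.
rewrite !RintegralD//; [|exact: Zi..].
by rewrite !RintegralZl// pE nE.
Qed.

Lemma map_deriv_bounded : exists2 C, 0 < C & forall x, `|map_deriv Phi x| <= C.
Proof.
have [C C0 h] := periodic_bounded (cov_p_continuous cov) (cov_p_periodic cov).
by exists C => // x; rewrite -(short_reprK x) (cov_map_deriv cov).
Qed.

Lemma rho_bounded : exists m M, [/\ 0 < m, 0 < M & forall x, m <= rho x <= M].
Proof.
have [M M0 h] := periodic_bounded rho_lift_continuous (one_periodic_lift rho).
have [m m0 h'] := periodic_gt0_lbound rho_lift_continuous (one_periodic_lift rho) (fun s => rho_gt0 (tc s)).
exists m, M; split=> // x; rewrite -(short_reprK x) h'/=.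
exact: le_trans (ler_norm _) (h (short_repr x)).
Qed.

Lemma rhoV_lift_continuous : continuous (fun s => (rho (tc s))^-1).
Proof.
by move=> s; apply: continuousV; [rewrite gt_eqF// rho_gt0|exact: rho_lift_continuous].
Qed.

Lemma measurable_rhoV : measurable_fun setT (fun x : circle R => (rho x)^-1).
Proof. exact: (continuous_measurable_lift rhoV_lift_continuous). Qed.

Lemma Lfun2_div_rho f : f \in Lfun mu 2%:E -> (fun x => f x / rho x) \in Lfun mu 2%:E.
Proof.
have [m [M [m0 M0 h]]] := rho_bounded => f2.
apply: (@Lfun2_dominated _ _ _ mu _ f m^-1) => //.
  apply: measurable_funM; first exact: Lfun2_measurable f2.
  exact: measurable_rhoV.
move=> x; rewrite normrM mulrC ler_wpM2r// gtr0_norm ?invr_gt0 ?rho_gt0//.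
by rewrite lef_pV2 ?posrE ?rho_gt0//; have /andP[] := h x.
Qed.

(** Turns the Lebesgue mean into a pairing with 1 / rho in L^2(mu), the form in which mean zero is
    used from here on. *)
Lemma Rintegral_lebesgueE f : measurable_fun setT f ->
  \int[circle_lebesgue R]_x f x = \int[mu]_x (f x / rho x).
Proof.
move=> mf; congr fine; rewrite integral_mu.
  apply: eq_integral => x _; rewrite -EFinM divfK//.
  by rewrite gt_eqF// rho_gt0.
apply/measurable_EFinP; apply: measurable_funM => //.
exact: measurable_rhoV.
Qed.

Let B := \int[circle_lebesgue R]_y (1 / rho y).

Let cst1_L2 : (fun=> 1 : R) \in Lfun mu 2%:E. Proof. exact: Lfun2_cst. Qed.

Let BE : B = \int[mu]_x (1 / rho x / rho x).
Proof.
apply: Rintegral_lebesgueE; exact: (Lfun2_measurable (Lfun2_div_rho cst1_L2)).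
Qed.

Let B_gt0 : 0 < B.
Proof.
have [m [M [m0 M0 h]]] := rho_bounded.
apply: (@lt_le_trans _ _ (M^-1 * M^-1)); first by rewrite mulr_gt0// invr_gt0.
rewrite BE (_ : _ * _ = \int[mu]_x (M^-1 * M^-1)).
  apply: le_Rintegral => //.
  - exact/Lfun2_integrable/Lfun2_cst.
  - exact: (Lfun2_integrable (Lfun2_div_rho (Lfun2_div_rho cst1_L2))).
  - move=> x _; have /andP[_ hM] := h x.
    have hi : M^-1 <= (rho x)^-1 by rewrite lef_pV2 ?posrE ?rho_gt0.
    by rewrite mul1r ler_pM// invr_ge0 ltW.
rewrite Rintegral_cst//.
by have -> : fine (mu [set: circle R]) = 1; rewrite ?mulr1// probability_setT.
Qed.

Definition drift v := transfer (fun y => map_deriv Phi y * v y).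

Definition gauge v :=
  (\int[circle_lebesgue R]_y (v y * map_deriv Phi y * (rho y / rho (Phi y)))) / B.

Lemma deriv_opE v x : deriv_op Phi rho v x = drift v x - gauge v / rho x.
Proof.
rewrite /deriv_op /drift /transfer; congr (_ - _); last first.
  by rewrite /gauge /B invfM mulrA mulrAC.
apply: eq_fsbigr => y _.
rewrite -(short_reprK y) (cov_map_deriv cov) (cov_sg cov) (cov_norm cov).
have := cov_expanding cov (short_repr y); set py := p _ => hp.
have py0 : py != 0 by apply: contraTN hp => /eqP->; rewrite mulr0 ler10.
have rx : rho x != 0 by rewrite gt_eqF// rho_gt0.
by case: (cov_sign cov) => ->; field; rewrite rx py0.
Qed.

Lemma Lfun2_map_deriv v : v \in Lfun mu 2%:E ->
  (fun y => map_deriv Phi y * v y) \in Lfun mu 2%:E.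
Proof.
have [C C0 hC] := map_deriv_bounded => v2.
apply: (@Lfun2_dominated _ _ _ mu _ v C) => //.
  by apply: measurable_funM; [exact: measurable_map_deriv|exact: Lfun2_measurable v2].
by move=> x; rewrite normrM ler_wpM2r.
Qed.

Lemma Lfun2_drift v : v \in Lfun mu 2%:E -> drift v \in Lfun mu 2%:E.
Proof. by move=> v2; have [] := Lfun2_transfer (Lfun2_map_deriv v2). Qed.

Lemma drift_bounded : exists2 C, 0 < C & forall v, v \in Lfun mu 2%:E ->
  \int[mu]_x (drift v x ^+ 2) <= C * \int[mu]_x (v x ^+ 2).
Proof.
have [C C0 hC] := map_deriv_bounded; exists (C ^+ 2); first exact: exprn_gt0.
move=> v v2; have [_] := Lfun2_transfer (Lfun2_map_deriv v2).
move=> /le_trans; apply.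
apply: le_Rintegral_sqr => //; first exact: Lfun2_map_deriv.
by move=> x; rewrite normrM ler_wpM2r.
Qed.

(** Since (1 / rho) \o Phi comes out of the transfer, the integral in [gauge] is the Lebesgue mean
    of [drift v]. Dividing by [B], the mean of 1 / rho, gives gauge v / rho that same mean. *)
Lemma gaugeE v : v \in Lfun mu 2%:E -> gauge v = (\int[mu]_x (drift v x / rho x)) / B.
Proof.
move=> v2; rewrite /gauge; congr (_ / _).
have mv := Lfun2_measurable v2.
have mPhi := measurable_expanding.
have mrP : measurable_fun [set: circle R] (fun y : circle R => (rho (Phi y))^-1).
  exact: (measurableT_comp measurable_rhoV mPhi).
rewrite Rintegral_lebesgueE; last first.
  apply: measurable_funM; first exact: measurable_funM mv measurable_map_deriv.
  exact: measurable_funM measurable_rho mrP.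
transitivity (\int[mu]_x ((map_deriv Phi x * v x) * (rho (Phi x))^-1)).
  apply: eq_Rintegral => x _; have : rho x != 0 by rewrite gt_eqF// rho_gt0.
  have : rho (Phi x) != 0 by rewrite gt_eqF// rho_gt0.
  by move=> ? ?; field; apply/andP.
rewrite -Rintegral_transfer.
  by apply: eq_Rintegral => x _; rewrite (transferM _ (fun x => (rho x)^-1)).
have [m [M [m0 M0 h]]] := rho_bounded.
apply: Lfun2_integrable; apply: (Lfun2_dominated (g := fun y => map_deriv Phi y * v y) (c := m^-1)).
- by apply: measurable_funM => //; exact: Lfun2_measurable (Lfun2_map_deriv v2).
- exact: Lfun2_map_deriv.
- move=> x; rewrite normrM mulrC ler_wpM2r// gtr0_norm ?invr_gt0 ?rho_gt0//.
  by rewrite lef_pV2 ?posrE ?rho_gt0//; have /andP[] := h (Phi x).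
Qed.

Lemma Lfun2_deriv_op v : v \in Lfun mu 2%:E -> deriv_op Phi rho v \in Lfun mu 2%:E.
Proof.
move=> v2; rewrite (_ : deriv_op Phi rho v = fun x => drift v x - gauge v * (1 / rho x)).
  apply: Lfun2B; first exact: Lfun2_drift.
  exact/Lfun2Z/Lfun2_div_rho.
by apply/funext => x; rewrite deriv_opE mul1r.
Qed.

Lemma deriv_op_bounded : exists2 C, 0 < C & forall v, v \in Lfun mu 2%:E ->
  \int[mu]_x (deriv_op Phi rho v x ^+ 2) <= C * \int[mu]_x (v x ^+ 2).
Proof.
have [C C0 hC] := drift_bounded; have [m [M [m0 M0 h]]] := rho_bounded.
have rhoV f x : `|f x / rho x| <= m^-1 * `|f x|.
  rewrite normrM mulrC ler_wpM2r// gtr0_norm ?invr_gt0 ?rho_gt0//.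
  by rewrite lef_pV2 ?posrE ?rho_gt0//; have /andP[] := h x.
pose I1 := \int[mu]_x ((1 / rho x) ^+ 2).
have I10 : 0 <= I1 by exact: Rintegral_sqr_ge0.
(* From (a + b)^2 <= 2 a^2 + 2 b^2: the first term bounds the drift, the second the correction,
   where the square of the gauge is controlled by [sqr_Rintegral_le] and 1 / rho <= 1 / m. *)
exists (2 * C + 2 * (m^-1 ^+ 2 * C / B ^+ 2 * I1)).
  rewrite ltr_wpDr ?mulr_gt0// !mulr_ge0// ?invr_ge0 ?exprn_ge0 ?invr_ge0// ltW//.
move=> v v2; pose N := \int[mu]_x (v x ^+ 2).
have -> : \int[mu]_x (deriv_op Phi rho v x ^+ 2) =
    \int[mu]_x ((drift v x + (- gauge v) * (1 / rho x)) ^+ 2).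
  by apply: eq_Rintegral => x _; rewrite deriv_opE mul1r mulNr.
have d2 := Lfun2_drift v2.
apply: (le_trans (le_Rintegral_sqrD d2 (Lfun2Z (- gauge v) (Lfun2_div_rho cst1_L2)))).
rewrite [leRHS]mulrDl lerD//.
  by rewrite -mulrA ler_wpM2l// hC.
rewrite -[leRHS]mulrA ler_wpM2l//.
have -> : \int[mu]_x ((- gauge v * (1 / rho x)) ^+ 2) = gauge v ^+ 2 * I1.
  rewrite -RintegralZl//; last exact: (Lfun2_sqr_integrable (Lfun2_div_rho cst1_L2)).
  by apply: eq_Rintegral => x _; rewrite exprMn sqrrN.
rewrite [leRHS]mulrAC ler_wpM2r//.
rewrite gaugeE// expr_div_n [leRHS]mulrAC ler_wpM2r ?invr_ge0 ?exprn_ge0 ?(ltW B_gt0)//.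
apply: (le_trans (sqr_Rintegral_le (Lfun2_div_rho d2))).
rewrite -[leRHS]mulrA; apply: (@le_trans _ _ (m^-1 ^+ 2 * \int[mu]_x (drift v x ^+ 2))).
  by apply: le_Rintegral_sqr => //; exact: Lfun2_div_rho.
by rewrite ler_wpM2l ?exprn_ge0 ?invr_ge0 ?(ltW m0)// hC.
Qed.

Lemma deriv_op_mean0 v : v \in Lfun mu 2%:E ->
  \int[mu]_x (deriv_op Phi rho v x / rho x) = 0.
Proof.
move=> v2; have d2 := Lfun2_drift v2.
rewrite (@eq_Rintegral _ _ _ _ _ (fun x => drift v x / rho x - gauge v * (1 / rho x / rho x))); last first.
  by move=> x _ /=; rewrite deriv_opE; field; rewrite gt_eqF// rho_gt0.
have r2 := Lfun2_div_rho (Lfun2_div_rho cst1_L2).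
rewrite RintegralB//; last 2 first.
- exact: (Lfun2_integrable (Lfun2_div_rho d2)).
- exact: (Lfun2_integrable (Lfun2Z (gauge v) r2)).
rewrite RintegralZl//; last exact: (Lfun2_integrable r2).
by rewrite -BE gaugeE// divfK ?subrr// gt_eqF.
Qed.

Lemma driftZD a v w x : drift (fun y => a * v y + w y) x = a * drift v x + drift w x.
Proof.
rewrite /drift -transferZD; congr (transfer _ x).
by apply/funext => y; ring.
Qed.

Lemma deriv_opZD a v w x : v \in Lfun mu 2%:E -> w \in Lfun mu 2%:E ->
  deriv_op Phi rho (fun y => a * v y + w y) x =
  a * deriv_op Phi rho v x + deriv_op Phi rho w x.
Proof.
move=> v2 w2; have g2 := Lfun2D (Lfun2Z a v2) w2.
rewrite !deriv_opE driftZD; suff -> : gauge (fun y => a * v y + w y) = a * gauge v + gauge w.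
  by ring.
have dv2 := Lfun2_div_rho (Lfun2_drift v2); have dw2 := Lfun2_div_rho (Lfun2_drift w2).
rewrite !gaugeE// mulrA -mulrDl; congr (_ / _).
rewrite -RintegralZl//; last exact: (Lfun2_integrable dv2).
rewrite -RintegralD//; last 2 first.
- exact: (Lfun2_integrable (Lfun2Z a dv2)).
- exact: (Lfun2_integrable dw2).
by apply: eq_Rintegral => x' _; rewrite driftZD mulrDl mulrA.
Qed.

Lemma Lfun2_comp_map u : u \in Lfun mu 2%:E -> (fun x => u (Phi x)) \in Lfun mu 2%:E /\
  \int[mu]_x (u (Phi x) ^+ 2) = \int[mu]_x (u x ^+ 2).
Proof.
move=> u2; have mPhi := measurable_expanding.
have mu2 := Lfun2_measurable u2.
have E : (\int[mu]_x (u (Phi x) ^+ 2)%:E = \int[mu]_x (u x ^+ 2)%:E)%E.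
  rewrite -(ge0_integral_transfer (mu := mu) (nu := mu) (g := Phi) (f := fun x => (u x ^+ 2)%:E))//.
  - by have [_ _ _ h] := inv => A mA; apply/esym; exact: h.
  - by apply/measurable_EFinP; exact: measurable_funX.
  - by move=> x; rewrite lee_fin sqr_ge0.
split; last by rewrite /Rintegral E.
have muP : measurable_fun [set: circle R] (fun x => u (Phi x)).
  exact: (measurableT_comp mu2 mPhi).
apply/Lfun2P; split => //; apply/integrableP; split.
  by apply/measurable_EFinP; exact: measurable_funX.
have /integrableP[_] := Lfun2_sqr_integrable u2; apply: le_lt_trans.
under eq_integral do rewrite /= ger0_norm ?sqr_ge0//.
by under [leRHS]eq_integral do rewrite /= ger0_norm ?sqr_ge0//; rewrite E.
Qed.

Lemma Lfun2_adjoint_op u : u \in Lfun mu 2%:E -> adjoint_op Phi u \in Lfun mu 2%:E.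
Proof. by move=> u2; have [uP2 _] := Lfun2_comp_map u2; exact: Lfun2_map_deriv. Qed.

Lemma adjoint_op_bounded : exists2 C, 0 < C & forall u, u \in Lfun mu 2%:E ->
  \int[mu]_x (adjoint_op Phi u x ^+ 2) <= C * \int[mu]_x (u x ^+ 2).
Proof.
have [C C0 hC] := map_deriv_bounded; exists (C ^+ 2); first exact: exprn_gt0.
move=> u u2; have [uP2 <-] := Lfun2_comp_map u2.
apply: le_Rintegral_sqr => //; first exact: Lfun2_adjoint_op.
by move=> x; rewrite normrM ler_wpM2r.
Qed.

(** The correction pairs with [u] as a multiple of the Lebesgue mean of [u], which is zero. In what
    remains, [u] enters the transfer as [u \o Phi], and the transfer preserves integrals. *)
Lemma deriv_op_adjoint u v : u \in Lfun mu 2%:E -> v \in Lfun mu 2%:E ->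
  \int[mu]_x (u x / rho x) = 0 ->
  \int[mu]_x (deriv_op Phi rho v x * u x) = \int[mu]_x (v x * adjoint_op Phi u x).
Proof.
move=> u2 v2 u0; have [uP2 _] := Lfun2_comp_map u2.
have d2 := Lfun2_drift v2; have ur2 := Lfun2_div_rho u2.
rewrite (@eq_Rintegral _ _ _ _ _ (fun x => drift v x * u x - gauge v * (u x / rho x))); last first.
  by move=> x _ /=; rewrite deriv_opE mulrBl mulrAC -!mulrA.
rewrite RintegralB//; last 2 first.
- exact: Lfun2M_integrable.
- exact: (Lfun2_integrable (Lfun2Z (gauge v) ur2)).
rewrite RintegralZl//; last exact: (Lfun2_integrable ur2).
rewrite u0 mulr0 subr0.
transitivity (\int[mu]_x transfer (fun y => (map_deriv Phi y * v y) * u (Phi y)) x).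
  by apply: eq_Rintegral => x _; rewrite transferM.
rewrite Rintegral_transfer.
  by apply: eq_Rintegral => x _; rewrite /adjoint_op mulrAC mulrC.
by apply: Lfun2M_integrable => //; exact: Lfun2_map_deriv.
Qed.

End transfer_operator.

(** * Approximation by derivatives of smooth functions *)

Section trigonometric_sums.
Context {R : realType}.
Implicit Types (a t u x : R) (N : nat).

(** The factor 2 sin (t / 2) makes the sum telescope; it is kept on the left so that the identity
    also covers a vanishing sine. *)
Lemma sum_cos_arith a t N :
  2 * sin (t / 2) * (\sum_(j < N) cos (a + j%:R * t)) =
  sin (a + N%:R * t - t / 2) - sin (a - t / 2).
Proof.
elim: N => [|N ih]; first by rewrite big_ord0 mul0r addr0 mulr0 subrr.
rewrite big_ord_recr/= mulrDr ih -[N.+1%:R]natr1.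
have -> : a + (N%:R + 1) * t - t / 2 = (a + N%:R * t) + t / 2 by field.
set A := a + N%:R * t; rewrite (sinB A) (sinD A); ring.
Qed.

Lemma cos_2pi_int a (n : int) : cos (a + 2 * pi * n%:~R) = cos a.
Proof.
have h : one_periodic (fun s => cos (a + 2 * pi * s)).
  by move=> s; rewrite mulrDr mulr1 addrA mulr_natl cosD2pi.
by have := one_periodicDz n 0 h; rewrite add0r mulr0 addr0.
Qed.

Lemma sin_2pi_int a (n : int) : sin (a + 2 * pi * n%:~R) = sin a.
Proof.
have h : one_periodic (fun s => sin (a + 2 * pi * s)).
  by move=> s; rewrite mulrDr mulr1 addrA mulr_natl sinD2pi.
by have := one_periodicDz n 0 h; rewrite add0r mulr0 addr0.
Qed.

Lemma sin_pi_ratio_neq0 (d : int) N : d != 0 -> (`|d| < N%:Z) ->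
  sin (pi * d%:~R / N%:R : R) != 0.
Proof.
move=> d0 dN; have N0 : (0 : R) < N%:R.
  by rewrite ltr0n -ltz_nat; apply: le_lt_trans dN.
have h (c : int) : 0 < c -> c < N%:Z -> sin (pi * c%:~R / N%:R : R) != 0.
  move=> c0 cN; rewrite gt_eqF// sin_gt0_pi// -mulrA; apply/andP; split.
    by rewrite mulr_gt0 ?pi_gt0// divr_gt0// ltr0z.
  rewrite gtr_pMr ?pi_gt0// ltr_pdivrMr// mul1r.
  by rewrite -[N%:R]/((Posz N)%:~R) ltr_int.
have [dp|dn] := ltP 0 d; first by apply: h => //; rewrite (le_lt_trans (ler_norm d)).
have dn' : d < 0 by rewrite lt_neqAle d0.
have := h (- d); rewrite oppr_gt0 => /(_ dn'); rewrite intrN mulrN mulNr sinN oppr_eq0.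
by apply; rewrite -(ltr0_norm dn').
Qed.

(** Over the N nodes the phase makes d whole turns, so the telescoped ends coincide, while the
    factor sin (pi d / N) is nonzero because 0 < |d| < N. *)
Lemma sum_cos_roots (d : int) N x : d != 0 -> (`|d| < N%:Z) ->
  \sum_(j < N) cos (2 * pi * d%:~R * (x - j%:R / N%:R)) = 0.
Proof.
move=> d0 dN; have N0 : (N%:R : R) != 0.
  by rewrite pnatr_eq0 -lt0n -ltz_nat; apply: le_lt_trans dN.
pose t := - (2 * pi * d%:~R / N%:R) : R.
have := sum_cos_arith (2 * pi * d%:~R * x) t N.
have -> : 2 * pi * d%:~R * x + N%:R * t - t / 2 =
    (2 * pi * d%:~R * x - t / 2) + 2 * pi * (- d)%:~R.
  by rewrite /t intrN; field.
rewrite sin_2pi_int subrr => /eqP.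
have -> : \sum_(j < N) cos (2 * pi * d%:~R * x + j%:R * t) =
    \sum_(j < N) cos (2 * pi * d%:~R * (x - j%:R / N%:R)).
  by apply: eq_bigr => j _; congr cos; rewrite /t; field.
rewrite mulf_eq0 => /orP[|/eqP//].
have -> : t / 2 = - (pi * d%:~R / N%:R) by rewrite /t; field.
by rewrite sinN mulf_eq0 oppr_eq0 (negbTE (sin_pi_ratio_neq0 _ _))// orbF pnatr_eq0.
Qed.

(** Fejer's kernel divided by N, that is the squared modulus of the exponential sum over N^2. With
    this factor the N translates by j / N add up to 1. *)
Definition fejer N u : R :=
  (\sum_(m < N) \sum_(l < N) cos (2 * pi * (m%:Z - l%:Z)%:~R * u)) / N%:R ^+ 2.

Lemma fejerE N u : fejer N u =
  ((\sum_(m < N) cos (m%:R * (2 * pi * u))) ^+ 2 +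
   (\sum_(m < N) sin (m%:R * (2 * pi * u))) ^+ 2) / N%:R ^+ 2.
Proof.
congr (_ / _); rewrite !expr2 !big_distrlr/= -big_split/=.
apply: eq_bigr => m _; rewrite -big_split/=; apply: eq_bigr => l _.
by rewrite -cosB; congr cos; rewrite intrB; ring.
Qed.

Lemma fejer_ge0 N u : 0 <= fejer N u.
Proof. by rewrite fejerE divr_ge0 ?addr_ge0 ?sqr_ge0. Qed.

(** Twice the sine times each of the two sums telescopes; the squares then add up to 2 - 2 cos (A +
    D), which is at most 4. *)
Lemma fejer_sin2_le N u : fejer N u * sin (pi * u) ^+ 2 <= (N%:R ^+ 2)^-1.
Proof.
rewrite fejerE mulrAC ler_piMl ?invr_ge0 ?sqr_ge0//.
set C := \sum_(m < N) cos _; set S := \sum_(m < N) sin _.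
set t := 2 * pi * u in C S *.
have tE : t / 2 = pi * u by rewrite /t; field.
have hC : 2 * sin (pi * u) * C = sin (N%:R * t - t / 2) + sin (t / 2).
  have := sum_cos_arith 0 t N; rewrite tE !add0r sinN opprK => <-.
  by congr (_ * _); apply: eq_bigr => m _; rewrite add0r.
have hS : 2 * sin (pi * u) * S = cos (t / 2) - cos (N%:R * t - t / 2).
  have := sum_cos_arith (- (pi / 2)) t N; rewrite tE.
  have -> : \sum_(j < N) cos (- (pi / 2) + j%:R * t) = S.
    by apply: eq_bigr => m _; rewrite addrC cosBpihalf.
  move=> ->; have -> : - (pi / 2) + N%:R * t - pi * u = (N%:R * t - pi * u) - pi / 2 by ring.
  have -> : - (pi / 2) - pi * u = - (pi * u) - pi / 2 by ring.
  rewrite !sinBpihalf cosN; ring.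
have h4 : 4 * ((C ^+ 2 + S ^+ 2) * sin (pi * u) ^+ 2) <= 4.
  have -> : 4 * ((C ^+ 2 + S ^+ 2) * sin (pi * u) ^+ 2) =
    (2 * sin (pi * u) * C) ^+ 2 + (2 * sin (pi * u) * S) ^+ 2 by ring.
  rewrite hC hS; set A := N%:R * t - _; set D := t / 2.
  have hA := cos2Dsin2 A; have hD := cos2Dsin2 D.
  have := cos_geN1 (A + D); rewrite cosD; nra.
lra.
Qed.

(** Over the nodes j / N every frequency m - l other than 0 cancels, being below N in absolute
    value; each of the N diagonal terms contributes N. *)
Lemma sum_fejer N x : (0 < N)%N -> \sum_(j < N) fejer N (x - j%:R / N%:R) = 1.
Proof.
move=> N0; rewrite /fejer -mulr_suml exchange_big/=.
under eq_bigr do rewrite exchange_big/=.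
rewrite (eq_bigr (fun=> N%:R)) => [|m _].
  by rewrite sumr_const card_ord -[N%:R *+ N]mulr_natr -expr2 divff// sqrf_eq0 pnatr_eq0 -lt0n.
rewrite (bigD1 m)//= [X in _ + X]big1 ?addr0 => [|l lm].
  under eq_bigr do rewrite subrr mulr0 mul0r cos0.
  by rewrite sumr_const card_ord.
apply: sum_cos_roots.
  by rewrite subr_eq0 eqz_nat eq_sym; exact: lm.
have := ltn_ord m; have := ltn_ord l; rewrite -!ltz_nat => h1 h2.
have h3 : 0 <= Posz m by [].
have h4 : 0 <= Posz l by [].
by rewrite ltr_norml; apply/andP; split; lra.
Qed.

Lemma sin_lower_bound u : `|u| <= 2^-1 -> `|u| <= `|sin (pi * u)|.
Proof.
wlog u0 : u / 0 <= u => [hw|].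
  have [u0|/ltW u0] := leP 0 u; first exact: hw.
  by have := hw (- u); rewrite oppr_ge0 mulrN sinN !normrN; apply.
rewrite ger0_norm// => u2; apply: le_trans (ler_norm _).
(* Half angle: sin (2 z) = 2 sin z cos z and sin z = z cos c, with both angles at most pi / 4, where
   squared cosines are at least 1/2. This gives sin (pi u) >= z, and z >= u because pi >= 2. *)
pose z := pi * u / 2.
have pi2 : (2 : R) <= pi by have := @pi_ge2 R.
have z0 : 0 <= z by rewrite /z divr_ge0// mulr_ge0// ltW// pi_gt0.
have zle : z <= pi / 4.
  have : pi * u <= pi * 2^-1 by rewrite ler_wpM2l// ltW// pi_gt0.
  by rewrite /z; lra.
have c4 (c : R) : 0 <= c <= pi / 4 -> 2^-1 <= cos c ^+ 2.
  move=> /andP[c0 cp]; have : 0 <= cos (2 * c).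
    by apply: cos_ge0_pihalf; apply/andP; split; lra.
  have -> : 2 * c = c + c by ring.
  by rewrite cosD; have := cos2Dsin2 c; lra.
have cpos (c : R) : 0 <= c <= pi / 4 -> 0 <= cos c.
  by move=> /andP[c0 cp]; apply: cos_ge0_pihalf; apply/andP; split; lra.
have [c /andP[c0 cz] sz] : exists2 c, 0 <= c <= z & sin z = cos c * z.
  have [|c] := @MVT_segment R sin cos 0 z z0 (fun x _ => is_derive_sin x).
    exact: continuous_subspaceT (@continuous_sin R).
  by rewrite in_itv/= sin0 !subr0; exists c.
have -> : pi * u = z + z by rewrite /z; field.
rewrite sinD sz.
have h1 := c4 c; have h2 := c4 z; have h3 := cpos c; have h4 := cpos z.
have cI : 0 <= c <= pi / 4 by apply/andP; split; lra.
have zI : 0 <= z <= pi / 4 by apply/andP; split; lra.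
move: (h1 cI) (h2 zI) (h3 cI) (h4 zI) => {}h1 {}h2 {}h3 {}h4.
have h5 : 2^-1 <= cos c * cos z.
  have : 2^-1 ^+ 2 <= (cos c * cos z) ^+ 2.
    by rewrite exprMn expr2; apply: ler_pM.
  by rewrite ler_pXn2r// nnegrE// mulr_ge0.
have : z <= 2 * (cos c * cos z) * z by rewrite ler_peMl//; lra.
have : u <= z by rewrite /z; nra.
lra.
Qed.

End trigonometric_sums.

(** * Trigonometric sums as smooth functions on the circle *)

Section smooth_approximation.
Context {R : realType}.
Local Notation tc := (@to_circle R).

(** Phases are kept so that derivatives stay in the family: each amplitude is multiplied by its
    angular frequency and each phase moves by pi / 2. *)
Definition trig (I : finType) (A : I -> R) (d : I -> int) (b : I -> R) (s : R) : R :=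
  \sum_i A i * cos (2 * pi * (d i)%:~R * s + b i).

Lemma trig_periodic (I : finType) (A : I -> R) d b : one_periodic (trig A d b).
Proof.
move=> s; apply: eq_bigr => i _; congr (_ * _).
rewrite -[RHS](cos_2pi_int _ (d i)); congr cos; ring.
Qed.

Lemma is_derive_sum_fin (I : finType) (f df : I -> R -> R) (s : R) :
  (forall i, is_derive s 1 (f i) (df i s)) ->
  is_derive s 1 (fun t => \sum_i f i t) (\sum_i df i s).
Proof.
move=> h; rewrite unlock; elim: (index_enum I) => [|i l ih] /=.
  exact: is_derive_cst.
exact: (@is_deriveD _ _ _ (f i) _ s 1 (df i s)).
Qed.

Lemma trig_derive (I : finType) (A : I -> R) d b (s : R) :
  is_derive s 1 (trig A d b)
    (trig (fun i => A i * (2 * pi * (d i)%:~R)) d (fun i => b i + pi / 2) s).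
Proof.
apply: (@is_derive_sum_fin I (fun i s => A i * cos (2 * pi * (d i)%:~R * s + b i))
  (fun i s => A i * (2 * pi * (d i)%:~R) * cos (2 * pi * (d i)%:~R * s + (b i + pi / 2)))) => i.
set w := 2 * pi * _.
have dl : is_derive s 1 (fun s => w * s + b i) w.
  rewrite -[X in is_derive _ _ _ X]addr0; apply: is_deriveD.
  rewrite -[X in is_derive _ _ _ X]mulr1.
  exact: (@is_deriveZ _ _ _ id w s 1 1 (is_derive_id s 1)).
have dc := @is_derive1_comp R (@cos R) (fun s => w * s + b i) s _ _ (is_derive_cos _) dl.
have := @is_deriveZ _ _ _ _ (A i) _ _ _ dc.
rewrite addrA cosDpihalf.
by have -> : A i *: (- sin (w * s + b i) * w) = A i * w * - sin (w * s + b i) :> R by rewrite /GRing.scale/=; ring.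
Qed.

Lemma trig_smooth (I : finType) (A : I -> R) d b :
  fun_smooth (fun x : circle R => trig A d b (short_repr x)).
Proof.
have lift (A' b' : I -> R) : (fun t => trig A' d b' (short_repr (tc t))) = trig A' d b'.
  apply/funext => t; have [n ->] := short_repr_intE t.
  by rewrite one_periodicDz//; exact: trig_periodic.
have dE (A' b' : I -> R) : fun_derivable (fun x : circle R => trig A' d b' (short_repr x)) /\
    fun_deriv (fun x : circle R => trig A' d b' (short_repr x)) =
    (fun x => trig (fun i => A' i * (2 * pi * (d i)%:~R)) d (fun i => b' i + pi / 2) (short_repr x)).
  have [|D E] := @fun_deriv_of_lift R (fun x => trig A' d b' (short_repr x)) 
    (trig (fun i => A' i * (2 * pi * (d i)%:~R)) d (fun i => b' i + pi / 2)).
    by move=> s; rewrite lift; exact: trig_derive.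
  by split => //; apply/funext => x; rewrite -E short_reprK.
move=> n; elim: n A b => [|n ih] A b; first by have [] := dE A b.
by rewrite iterSr; have [_ ->] := dE A b; exact: ih.
Qed.

Lemma circle_dist_lipschitz (g : R -> R) L s t : one_periodic g ->
  (forall x y, `|g x - g y| <= L * `|x - y|) ->
  `|g s - g t| <= L * circle_dist (tc s) (tc t).
Proof.
move=> pg hL; rewrite /circle_dist -to_circleB.
have [n E] := short_repr_intE (s - t); rewrite E.
by rewrite -(one_periodicDz n s pg); apply: le_trans (hL _ _) _; rewrite addrAC.
Qed.

(** The kernels form a partition of unity, so the error averages g (j / N) - g x, which is at most L
    |u| with [u] the short representative of x - j / N. As |u| <= eta / 2 + u^2 / (2 eta) and u^2 K
    <= N^-2, the sum is at most L (eta / 2 + 1 / (2 N eta)), hence at most L eta. *)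
Lemma fejer_interpolation (g : R -> R) L eta N x : one_periodic g ->
  (forall x y, `|g x - g y| <= L * `|x - y|) -> 0 <= L -> 0 < eta ->
  (0 < N)%N -> N%:R^-1 <= eta ^+ 2 ->
  `|\sum_(j < N) g (j%:R / N%:R) * fejer N (x - j%:R / N%:R) - g x| <= L * eta.
Proof.
move=> pg hL L0 eta0 N0 hN.
have NR : (0 : R) < N%:R by rewrite ltr0n.
pose K (j : 'I_N) : R := fejer N (x - j%:R / N%:R).
have -> : \sum_(j < N) g (j%:R / N%:R) * fejer N (x - j%:R / N%:R) - g x =
    \sum_(j < N) (g (j%:R / N%:R) - g x) * K j.
  have E : g x = \sum_(j < N) g x * K j by rewrite -mulr_sumr (sum_fejer x N0) mulr1.
  rewrite [X in _ - X]E -sumrB.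
  by apply: eq_bigr => j _; rewrite mulrBl.
apply: (le_trans (ler_norm_sum _ _ _)).
have step (j : 'I_N) : `|(g (j%:R / N%:R) - g x) * K j| <=
    L * (eta / 2 * K j + (N%:R ^+ 2)^-1 / (2 * eta)).
  have K0 : 0 <= K j by exact: fejer_ge0.
  rewrite normrM (ger0_norm K0).
  pose u := short_repr (tc (x - j%:R / N%:R)).
  have [n uE] := short_repr_intE (x - j%:R / N%:R).
  have u2 : `|u| <= 2^-1.
    by have /andP[? ?] := short_repr_bounds (tc (x - j%:R / N%:R)); rewrite ler_norml; apply/andP; split => //; apply/ltW.
  have us := sin_lower_bound u2.
  (* An odd integer shift changes the sign of sin (pi u); only its square, a function of cos (2 pi
     u), has period 1. *)
  have sinE : sin (pi * u) ^+ 2 = sin (pi * (x - j%:R / N%:R)) ^+ 2.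
    rewrite /u uE mulrDr; set y := pi * _.
    have h v : sin v ^+ 2 = (1 - cos (2 * v)) / 2 :> R.
      have -> : 2 * v = v + v by ring.
      by rewrite cosD -!expr2; have := cos2Dsin2 v; lra.
    by rewrite !h; congr ((1 - _) / 2); rewrite -[RHS](cos_2pi_int _ n); congr cos; ring.
  have d2K : u ^+ 2 * K j <= (N%:R ^+ 2)^-1.
    apply: (@le_trans _ _ (K j * sin (pi * u) ^+ 2)); last by rewrite sinE; exact: fejer_sin2_le.
    rewrite mulrC ler_wpM2l// -[leLHS]ger0_norm ?sqr_ge0// -[leRHS]ger0_norm ?sqr_ge0//.
    by rewrite !normrX lerXn2r// nnegrE.
  have amgm : `|u| * K j <= eta / 2 * K j + (N%:R ^+ 2)^-1 / (2 * eta).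
    have e1 : `|u| <= eta / 2 + u ^+ 2 / (2 * eta).
      have : 0 <= (`|u| - eta) ^+ 2 / (2 * eta) by rewrite divr_ge0 ?sqr_ge0// mulr_ge0// ltW.
      have -> : (`|u| - eta) ^+ 2 / (2 * eta) = (eta / 2 + `|u| ^+ 2 / (2 * eta)) - `|u|.
        by field; rewrite gt_eqF.
      by rewrite real_normK ?num_real// subr_ge0.
    apply: (@le_trans _ _ ((eta / 2 + u ^+ 2 / (2 * eta)) * K j)); first by rewrite ler_wpM2r.
    rewrite mulrDl lerD2l mulrAC ler_wpM2r// invr_ge0 mulr_ge0// ltW//.
  apply: (@le_trans _ _ (L * (`|u| * K j))); last by rewrite ler_wpM2l.
  rewrite mulrA ler_wpM2r// distrC.
  have := circle_dist_lipschitz x (j%:R / N%:R) pg hL.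
  by rewrite /circle_dist -to_circleB.
apply: (le_trans (ler_sum _ (fun j _ => step j))).
rewrite -mulr_sumr ler_wpM2l// big_split/= -mulr_sumr (sum_fejer x N0) mulr1.
rewrite sumr_const card_ord -[_ *+ N]mulr_natr.
have -> : (N%:R ^+ 2)^-1 / (2 * eta) * N%:R = N%:R^-1 / (2 * eta).
  by field; rewrite !gt_eqF.
have : N%:R^-1 / (2 * eta) <= eta ^+ 2 / (2 * eta).
  by rewrite ler_wpM2r// invr_ge0 mulr_ge0// ltW.
have -> : eta ^+ 2 / (2 * eta) = eta / 2 by field; rewrite gt_eqF.
lra.
Qed.

(* The interpolant is the sum of its mean and of the derivative of a
   trigonometric sum; the mean is small because G' = g has mean zero. *)
Lemma smooth_approximation (G g : R -> R) L delta :
  (forall s : R, is_derive s 1 G (g s)) -> one_periodic G -> one_periodic g ->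
  (forall x y, `|g x - g y| <= L * `|x - y|) -> 0 < delta ->
  exists phi : circle R -> R, fun_smooth phi /\
    forall s, `|g s - fun_deriv phi (tc s)| <= delta.
Proof.
move=> dG pG pg hL0 delta0.
(* Positive, so that [eta] can be defined by division even if L is zero. *)
pose L' := `|L| + 1; have L'0 : 0 < L' by rewrite ltr_wpDl.
have hL x y : `|g x - g y| <= L' * `|x - y|.
  apply: le_trans (hL0 x y) _; rewrite ler_wpM2r// /L'.
  by rewrite (le_trans (ler_norm L))// lerDl.
pose eta := delta / (2 * L'); have eta0 : 0 < eta by rewrite divr_gt0// mulr_gt0.
have Leta : L' * eta = delta / 2 by rewrite /eta; field; rewrite gt_eqF.
pose N := (Num.trunc (eta ^+ 2)^-1).+1.
have N0 : (0 < N)%N by [].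
have NR : (0 : R) < N%:R by rewrite ltr0n.
have hN : N%:R^-1 <= eta ^+ 2 :> R.
  rewrite -[leRHS]invrK lef_pV2 ?posrE ?invr_gt0 ?exprn_gt0//.
  by rewrite ltW// truncnS_gt.
pose tau x := \sum_(j < N) g (j%:R / N%:R) * fejer N (x - j%:R / N%:R).
have tauP x : `|tau x - g x| <= delta / 2.
  by rewrite -Leta; apply: fejer_interpolation => //; exact: ltW.
pose I := ('I_N * ('I_N * 'I_N))%type.
(* Diagonal pairs have frequency 0 and make up the mean [a0]; with amplitude 0 they leave a sum that
   has a trigonometric primitive. *)
pose A (i : I) : R := if i.2.1 == i.2.2 then 0 else g (i.1%:R / N%:R) / N%:R ^+ 2.
pose d (i : I) : int := i.2.1%:Z - i.2.2%:Z.
pose b (i : I) : R := - (2 * pi * (d i)%:~R * (i.1%:R / N%:R)).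
pose a0 := \sum_(j < N) \sum_(m < N) g (j%:R / N%:R) / N%:R ^+ 2.
have tauE x : tau x = a0 + trig A d b x.
  rewrite /trig -(pair_big xpredT xpredT (fun j (ml : 'I_N * 'I_N) => A (j, ml) * cos (2 * pi * (d (j, ml))%:~R * x + b (j, ml))))/=.
  rewrite /a0 -big_split/=; apply: eq_bigr => j _.
  rewrite /fejer -(pair_big xpredT xpredT (fun m l => A (j, (m, l)) * cos (2 * pi * (d (j, (m, l)))%:~R * x + b (j, (m, l)))))/=.
  rewrite -big_split/= mulr_suml mulr_sumr; apply: eq_bigr => m _.
  rewrite mulr_suml mulr_sumr (bigD1 m)//= [X in _ = _ + X](bigD1 m)//= /A/= eqxx mul0r add0r.
  rewrite subrr mulr0 mul0r cos0 mul1r; congr (_ + _).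
  apply: eq_bigr => l /negbTE; rewrite eq_sym => ->.
  rewrite /b /d/= mulrCA mulrC mulrA; congr (_ * cos _); ring.
pose A' i := A i / (2 * pi * (d i)%:~R).
pose b' i := b i - pi / 2.
have pi0 : (pi : R) != 0 by rewrite gt_eqF// pi_gt0.
have dtrig x : trig (fun i => A' i * (2 * pi * (d i)%:~R)) d (fun i => b' i + pi / 2) x = trig A d b x.
  apply: eq_bigr => i _; rewrite /b' subrK; congr (_ * _).
  rewrite /A' /A; case: ifPn => [_|ml]; first by rewrite !mul0r.
  rewrite divfK// mulf_neq0//; first by rewrite mulf_neq0.
  by rewrite intr_eq0 /d subr_eq0 eqz_nat.
pose phi (x : circle R) := trig A' d b' (short_repr x).
have lift : (fun t => phi (tc t)) = trig A' d b'.
  apply/funext => t; rewrite /phi; have [n ->] := short_repr_intE t.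
  by rewrite one_periodicDz//; exact: trig_periodic.
have [|_ dphi] := @fun_deriv_of_lift R phi (trig A d b).
  by move=> s; rewrite lift -dtrig; exact: trig_derive.
exists phi; split; first exact: trig_smooth.
have a0P : `|a0| <= delta / 2.
  have dd (s : R) : is_derive s 1 (fun t => trig A' d b' t - G t) (trig A d b s - g s).
    by apply: is_deriveB; rewrite -dtrig; exact: trig_derive.
  (* Both primitives are periodic, so their derivatives agree at some [c]; there the interpolation
     error is exactly [a0]. *)
  have [c] := mean_value 0 1 dd.
  rewrite -[X in trig A' d b' X]add0r trig_periodic -[X in G X]add0r pG subrr subr0 mulr1 => /esym/eqP.
  rewrite subr_eq0 => /eqP tg.
  by have := tauP c; rewrite tauE tg addrK.
move=> s; rewrite dphi -[trig A d b s](addKr a0) -tauE.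
have := tauP s; have := a0P; rewrite !ler_norml => /andP[? ?] /andP[? ?].
by apply/andP; split; lra.
Qed.

End smooth_approximation.

(** * The space of mean-zero fields *)

Lemma continuousMR (R : realType) (f h : R -> R) :
  continuous f -> continuous h -> continuous (fun s => f s * h s).
Proof. by move=> cf ch s; apply: continuousM; [exact: cf|exact: ch]. Qed.

Lemma continuousDR (R : realType) (f h : R -> R) :
  continuous f -> continuous h -> continuous (fun s => f s + h s).
Proof. by move=> cf ch s; apply: continuousD; [exact: cf|exact: ch]. Qed.

Section L20_spaces.
Context {R : realType}.
Local Notation tc := (@to_circle R).
Local Notation leb := (@lebesgue_measure R).
Variables (Phi : circle R -> circle R) (g p dp xi : R -> R) (e : R) (k : nat).
Hypothesis cov : circle_covering Phi g p dp xi e k.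
Variables (rho : circle R -> R) (mu : probability (circle R) R).
Hypothesis inv : invariant_density Phi rho mu.
Implicit Types (u v f : circle R -> R) (phi : circle R -> R) (s : R).

Let r s := rho (tc s).
Let dr s := fun_deriv rho (tc s).

Lemma fun_smooth_deriv phi : fun_smooth phi -> fun_smooth (fun_deriv phi).
Proof. by move=> sphi n; rewrite -iterSr; exact: sphi n.+1. Qed.

Lemma fun_smooth_lift_continuous phi : fun_smooth phi -> continuous (fun s => phi (tc s)).
Proof. by move=> sphi; exact: is_derive_continuous (is_derive_lift (sphi 0%N)). Qed.

Lemma Lfun2_lift_continuous f : continuous (fun s => f (tc s)) -> f \in Lfun mu 2%:E.
Proof.
move=> cf; have [C C0 hC] := periodic_bounded cf (one_periodic_lift f).
apply: (@Lfun2_bounded _ _ _ mu f C); first exact: continuous_measurable_lift.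
by move=> x; rewrite -(short_reprK x).
Qed.

Lemma Lfun2_smooth phi : fun_smooth phi -> phi \in Lfun mu 2%:E.
Proof. by move=> /fun_smooth_lift_continuous; exact: Lfun2_lift_continuous. Qed.

Lemma Rintegral_C1 f (F : R -> R) : continuous (fun s => f (tc s)) ->
  (forall s : R, is_derive s 1 F (f (tc s))) ->
  \int[mu]_x (f x / rho x) = F 1 - F 0.
Proof.
move=> cf dF; have mf := continuous_measurable_lift cf.
rewrite -(Rintegral_lebesgueE inv mf) /Rintegral integral_circle; last exact/measurable_EFinP.
have mfl : measurable_fun [set: measurableTypeR R] (fun s : R => (f (tc s))%:E).
  by apply/measurable_EFinP; exact: continuous_measurable_fun.
rewrite integral_itv_bndo_bndc; last exact: measurable_funTS.
rewrite -integral_itv_obnd_cbnd; last exact: measurable_funTS.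
by rewrite (integral_derive dF cf).
Qed.

Lemma L20P v : L20 mu v <-> v \in Lfun mu 2%:E /\
  forall eps, 0 < eps -> exists phi, fun_smooth phi /\
    \int[mu]_x ((v x - fun_deriv phi x) ^+ 2) < eps.
Proof.
split=> -[v2 h]; split => // eps eps0.
  have [|phi [sphi]] := h (Num.sqrt eps); first by rewrite sqrtr_gt0.
  rewrite Lnorm2E; last exact: Lfun2B v2 (Lfun2_smooth (fun_smooth_deriv sphi)).
  by rewrite lte_fin ltr_sqrt// => ?; exists phi.
have [|phi [sphi hphi]] := h (eps ^+ 2); first exact: exprn_gt0.
exists phi; split => //.
rewrite Lnorm2E; last exact: Lfun2B v2 (Lfun2_smooth (fun_smooth_deriv sphi)).
by rewrite lte_fin -(gtr0_norm eps0) -sqrtr_sqr ltr_sqrt// exprn_gt0.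
Qed.

Lemma small_sqr_eq0 (a C : R) : 0 < C ->
  (forall eps, 0 < eps -> a ^+ 2 <= C * eps) -> a = 0.
Proof.
move=> C0 h; apply/eqP; rewrite -sqrf_eq0; apply/eqP/le_anti; rewrite sqr_ge0 andbT.
apply/ler_addgt0Pl => eps eps0; rewrite addr0.
by have := h (eps / C); rewrite divr_gt0// mulrC divfK ?gt_eqF//; apply.
Qed.

(** The mean is continuous in L^2(mu), because 1 / rho is bounded, and it vanishes on derivatives of
    functions on the circle. *)
Lemma L20_mean0 v : L20 mu v -> \int[mu]_x (v x / rho x) = 0.
Proof.
move=> /L20P[v2 h]; have [m [M [m0 M0 hm]]] := rho_bounded inv.
apply: (@small_sqr_eq0 _ (m^-1 ^+ 2)); first by rewrite exprn_gt0// invr_gt0.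
move=> eps /h[phi [sphi hphi]]; have p2 := Lfun2_smooth (fun_smooth_deriv sphi).
have vp2 := Lfun2B v2 p2.
have -> : \int[mu]_x (v x / rho x) = \int[mu]_x ((v x - fun_deriv phi x) / rho x).
  rewrite [RHS](@eq_Rintegral _ _ _ _ _ (fun x => v x / rho x - fun_deriv phi x / rho x)); last first.
    by move=> x _ /=; rewrite mulrBl.
  rewrite RintegralB//; last 2 first.
  - exact: (Lfun2_integrable (Lfun2_div_rho inv v2)).
  - exact: (Lfun2_integrable (Lfun2_div_rho inv p2)).
  have cphi := fun_smooth_lift_continuous (fun_smooth_deriv sphi).
  rewrite (Rintegral_C1 cphi (is_derive_lift (sphi 0%N))).
  by have := one_periodic_lift phi 0; rewrite add0r /= => ->; rewrite subrr subr0.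
have vpr2 := Lfun2_div_rho inv vp2.
apply: (le_trans (sqr_Rintegral_le vpr2)).
apply: (@le_trans _ _ (m^-1 ^+ 2 * \int[mu]_x ((v x - fun_deriv phi x) ^+ 2))).
  apply: le_Rintegral_sqr => // x.
  rewrite normrM mulrC ler_wpM2r// gtr0_norm ?invr_gt0 ?(rho_gt0 inv)//.
  by rewrite lef_pV2 ?posrE ?(rho_gt0 inv)//; have /andP[] := hm x.
by rewrite ler_wpM2l ?exprn_ge0 ?invr_ge0 ?ltW.
Qed.

(** Mean zero makes the primitive [G] periodic and the bounded derivative makes [f] Lipschitz, so
    the smooth approximation is uniform. The class C^1 is the one in which both operators send
    derivatives of smooth functions. *)
Lemma L20_C1 f (df : R -> R) : (forall s : R, is_derive s 1 (fun t => f (tc t)) (df s)) ->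
  continuous df -> one_periodic df -> \int[mu]_x (f x / rho x) = 0 -> L20 mu f.
Proof.
move=> ddf cdf pdf f0; have cf := is_derive_continuous ddf.
have [G dG] := continuous_primitive cf.
have [C C0 hC] := periodic_bounded cdf pdf.
have pG : one_periodic G.
  move=> s; have dd (t : R) : is_derive t 1 (fun t => G (t + 1) - G t) 0.
    rewrite -[X in is_derive _ _ _ X](subrr (f (tc t))); apply: is_deriveB.
    by apply: is_derive_translate; rewrite -[f (tc t)](one_periodic_lift f).
  have := is_derive_0_is_cst s 0 dd; rewrite add0r -(Rintegral_C1 cf dG) f0.
  by move/eqP; rewrite subr_eq0 => /eqP.
have f2 := Lfun2_lift_continuous cf.
apply/L20P; split=> // eps eps0.
(* At most 1, so that delta^2 <= delta <= eps / 2. *)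
pose delta := Num.min 1 (eps / 2).
have delta0 : 0 < delta by rewrite lt_min ltr01 divr_gt0.
have hL x y : `|f (tc x) - f (tc y)| <= C * `|x - y|.
  exact: (derive_bounded_lipschitz _ _ ddf hC).
have [phi [sphi hphi]] := smooth_approximation dG pG (one_periodic_lift f) hL delta0.
exists phi; split => //; have p2 := Lfun2_smooth (fun_smooth_deriv sphi).
apply: (@le_lt_trans _ _ (delta ^+ 2 * \int[mu]_x (1 ^+ 2))).
  apply: le_Rintegral_sqr; [exact: Lfun2B|exact: Lfun2_cst|].
  by move=> x; rewrite normr1 mulr1 -(short_reprK x).
rewrite (@eq_Rintegral _ _ _ _ _ (fun=> 1)); last by move=> x _; rewrite expr1n.
rewrite Rintegral_cst// mul1r.
have -> : fine (mu [set: circle R]) = 1 by rewrite probability_setT.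
rewrite mulr1; apply: (@le_lt_trans _ _ (eps / 2)); last by lra.
have d1 : delta <= 1 by rewrite ge_min lexx.
have d2 : delta <= eps / 2 by rewrite ge_min lexx orbT.
rewrite expr2; apply: le_trans d2; by rewrite ler_piMr// ltW.
Qed.

Lemma L20_closed v : v \in Lfun mu 2%:E ->
  (forall eps, 0 < eps -> exists2 w, L20 mu w & \int[mu]_x ((v x - w x) ^+ 2) < eps) ->
  L20 mu v.
Proof.
move=> v2 h; apply/L20P; split => // eps eps0.
have e4 : 0 < eps / 4 by rewrite divr_gt0.
have [w /L20P[w2 hw] vw] := h _ e4; have [phi [sphi wp]] := hw _ e4.
exists phi; split => //; have p2 := Lfun2_smooth (fun_smooth_deriv sphi).
rewrite (@eq_Rintegral _ _ _ _ _ (fun x => ((v x - w x) + (w x - fun_deriv phi x)) ^+ 2)); last first.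
  by move=> x _; rewrite addrA subrK.
apply: (le_lt_trans (le_Rintegral_sqrD (Lfun2B v2 w2) (Lfun2B w2 p2))); lra.
Qed.

Lemma is_derive_periodic (f df : R -> R) : (forall s : R, is_derive s 1 f (df s)) ->
  one_periodic f -> one_periodic df.
Proof.
move=> ddf pf s; have d1 := @is_derive_translate R f s 1 _ (ddf (s + 1)).
have [_ <-] := ddf s; have [_ <-] := d1.
by congr ('D_1 _ s); apply/funext => t; rewrite pf.
Qed.

(** * Fluxes of continuously differentiable fields *)

Section C1_field.
Variables (v : circle R -> R) (dv : R -> R).
Hypotheses (dvE : forall s : R, is_derive s 1 (fun t => v (tc t)) (dv s)).
Hypotheses (cdv : continuous dv).

(* The mass flux of the field v at time 0; that of deriv_op v is image_flux. *)
Definition flux (s : R) : R := rho (tc s) * v (tc s).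
Definition dflux (s : R) : R := rho (tc s) * dv s + fun_deriv rho (tc s) * v (tc s).

Lemma flux_derive (s : R) : is_derive s 1 flux (dflux s).
Proof.
have -> : dflux s = rho (tc s) *: (dv s : R^o) + v (tc s) *: (fun_deriv rho (tc s) : R^o).
  by rewrite /dflux /GRing.scale/= [X in _ + X]mulrC.
exact: (@is_deriveM R R^o (fun t => rho (tc t)) (fun t => v (tc t)) s 1 _ _ (rho_derive inv s) (dvE s)).
Qed.

Let cv : continuous (fun s => v (tc s)) := is_derive_continuous dvE.

Lemma dflux_continuous : continuous dflux.
Proof.
apply: continuousDR; apply: continuousMR.
- exact: (rho_lift_continuous inv).
- exact: cdv.
- exact: (rho_derive_continuous inv).
- exact: cv.
Qed.

Definition image_flux (s : R) : R :=
  \sum_(j < k) e * flux (xi (s + j%:R)) - gauge Phi rho v.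
Definition dimage_flux (s : R) : R :=
  \sum_(j < k) e * dflux (xi (s + j%:R)) / p (xi (s + j%:R)).

Lemma deriv_op_flux s : deriv_op Phi rho v (tc s) = image_flux s / rho (tc s).
Proof.
rewrite (deriv_opE cov inv) /image_flux mulrBl; congr (_ - _).
rewrite /drift (transfer_lift cov); congr (_ / _); apply: eq_bigr => j _.
rewrite (cov_map_deriv cov) (cov_norm cov) /flux; set x := xi _.
have := cov_expanding cov x => hp.
have p0 : p x != 0 by apply: contraTN hp => /eqP->; rewrite mulr0 ler10.
by case: (cov_sign cov) => ->; field.
Qed.

(** The [gauge] term is a constant of integration: it disappears here, hence also from the density
    transported by the image flux. *)
Lemma image_flux_derive (s : R) : is_derive s 1 image_flux (dimage_flux s).
Proof.
rewrite -[X in is_derive _ _ _ X]subr0; apply: is_deriveB.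
apply: (@is_derive_sumord R k (fun j t => e * flux (xi (t + j%:R)))
  (fun j t => e * dflux (xi (t + j%:R)) / p (xi (t + j%:R)))) => j.
have d1 : is_derive s 1 (fun t => xi (t + j%:R)) (p (xi (s + j%:R)))^-1.
  exact: (@is_derive_translate R xi s j%:R _ (cov_inv_derive cov _)).
have d2 := @is_derive1_comp R flux (fun t => xi (t + j%:R)) s _ _ (flux_derive _) d1.
rewrite -mulrA; exact: (@is_deriveZ _ _ _ _ e _ _ _ d2).
Qed.

Lemma dimage_flux_continuous : continuous dimage_flux.
Proof.
apply: (@continuous_sumord R k (fun j s => e * dflux (xi (s + j%:R)) / p (xi (s + j%:R)))) => j.
have cs : continuous (fun s : R => s + j%:R).
  by move=> t; apply: cvgD; [exact: cvg_id|exact: cvg_cst].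
have cx := continuous_compR cs (cov_inv_continuous cov).
apply: continuousMR.
  apply: continuousMR; first by move=> s; exact: cvg_cst.
  exact: (continuous_compR cx dflux_continuous).
move=> s; apply: continuousV; last exact: (continuous_compR cx (cov_p_continuous cov)).
have := cov_expanding cov (xi (s + j%:R)) => hp.
by apply: contraTN hp => /eqP->; rewrite mulr0 ler10.
Qed.

(** Read off from [deriv_op_flux]: the quotient by rho is a function on the circle. *)
Lemma image_flux_periodic : one_periodic image_flux.
Proof.
move=> s; have := deriv_op_flux (s + 1).
rewrite -[1]/(1%:R) to_circleDn deriv_op_flux => /esym/mulIf; apply.
by rewrite invr_neq0// gt_eqF// (rho_gt0 inv).
Qed.

Lemma deriv_op_L20_C1 : L20 mu (deriv_op Phi rho v).
Proof.
have v2 := Lfun2_lift_continuous cv.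
have rn s : r s != 0 by rewrite gt_eqF// (rho_gt0 inv).
have dd (s : R) : is_derive s 1 (fun t => deriv_op Phi rho v (tc t))
    (image_flux s * (- (r s) ^- 2 * dr s) + (r s)^-1 * dimage_flux s).
  rewrite (_ : (fun t => _) = fun t => image_flux t * (r t)^-1); last first.
    by apply/funext => t; rewrite deriv_op_flux.
  have d1 := @is_deriveV R r s _ 1 (rn s) (rho_derive inv s).
  exact: (@is_deriveM R R^o image_flux (fun t => (r t)^-1) s 1 _ _ (image_flux_derive s) d1).
have ci : continuous image_flux := is_derive_continuous image_flux_derive.
apply: (L20_C1 dd).
- apply: continuousDR; apply: continuousMR.
  + exact: ci.
  + apply: continuousMR; last exact: (rho_derive_continuous inv).
    have -> : (fun s => - (r s) ^- 2) = fun s => (-1) * ((r s)^-1 * (r s)^-1).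
      by apply/funext => s; rewrite mulN1r -invfM -expr2.
    apply: continuousMR; first by move=> s; exact: cvg_cst.
    by apply: continuousMR; exact: (rhoV_lift_continuous inv).
  + exact: (rhoV_lift_continuous inv).
  + exact: dimage_flux_continuous.
- apply: (is_derive_periodic dd); exact: (one_periodic_lift (deriv_op Phi rho v)).
- exact: (deriv_op_mean0 cov inv v2).
Qed.

End C1_field.

Lemma smooth_field phi : fun_smooth phi ->
  (forall s : R, is_derive s 1 (fun t => fun_deriv phi (tc t)) (fun_deriv (fun_deriv phi) (tc s))) /\
  continuous (fun s => fun_deriv (fun_deriv phi) (tc s)).
Proof.
move=> sphi; have sphi1 := fun_smooth_deriv sphi.
split; first exact: (is_derive_lift (sphi1 0%N)).
exact: fun_smooth_lift_continuous (fun_smooth_deriv (fun_smooth_deriv sphi)).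
Qed.

Lemma deriv_opB v w x : v \in Lfun mu 2%:E -> w \in Lfun mu 2%:E ->
  deriv_op Phi rho (fun y => v y - w y) x = deriv_op Phi rho v x - deriv_op Phi rho w x.
Proof.
move=> v2 w2; have := deriv_opZD cov inv (-1) x w2 v2.
rewrite mulN1r addrC => <-; congr (deriv_op Phi rho _ x).
by apply/funext => y; rewrite mulN1r addrC.
Qed.

(** The operator is bounded, L^2_0 is closed, and derivatives of smooth functions, which are dense
    in it, are sent to C^1 fields of mean zero. *)
Lemma deriv_op_L20 v : L20 mu v -> L20 mu (deriv_op Phi rho v).
Proof.
move=> /L20P[v2 h]; have [C C0 hC] := deriv_op_bounded cov inv.
apply: L20_closed; first exact: (Lfun2_deriv_op cov inv v2).
move=> eps eps0; have [|phi [sphi hphi]] := h (eps / C); first by rewrite divr_gt0.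
have [d1 d2] := smooth_field sphi.
have p2 := Lfun2_smooth (fun_smooth_deriv sphi).
exists (deriv_op Phi rho (fun_deriv phi)); first exact: (deriv_op_L20_C1 d1 d2).
rewrite (@eq_Rintegral _ _ _ _ _ (fun x => deriv_op Phi rho (fun y => v y - fun_deriv phi y) x ^+ 2)); last first.
  by move=> x _; rewrite deriv_opB.
apply: (le_lt_trans (hC _ (Lfun2B v2 p2))).
by rewrite -ltr_pdivlMl// mulrC.
Qed.

(** On the derivative of a smooth phi the operator gives the derivative of phi \o Phi, so the mean
    vanishes. As [Phi] is of class C^2, this is a C^1 field and [L20_C1] applies. *)
Lemma adjoint_op_L20 u : L20 mu u -> L20 mu (adjoint_op Phi u).
Proof.
move=> /L20P[u2 h]; have [C C0 hC] := adjoint_op_bounded cov inv.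
apply: L20_closed; first exact: (Lfun2_adjoint_op cov inv u2).
move=> eps eps0; have [|phi [sphi hphi]] := h (eps / C); first by rewrite divr_gt0.
have [d1 d2] := smooth_field sphi.
have p2 := Lfun2_smooth (fun_smooth_deriv sphi).
exists (adjoint_op Phi (fun_deriv phi)); last first.
  rewrite (@eq_Rintegral _ _ _ _ _ (fun x => adjoint_op Phi (fun y => u y - fun_deriv phi y) x ^+ 2)); last first.
    by move=> x _; rewrite /adjoint_op mulrBr.
  apply: (le_lt_trans (hC _ (Lfun2B u2 p2))).
  by rewrite -ltr_pdivlMl// mulrC.
have fE : (fun t => adjoint_op Phi (fun_deriv phi) (tc t)) =
    fun t => p t * fun_deriv phi (tc (g t)).
  by apply/funext => t; rewrite /adjoint_op (cov_map_deriv cov) (cov_lift cov).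
pose d2phi t := fun_deriv (fun_deriv phi) (tc t).
have dd (s : R) : is_derive s 1 (fun t => adjoint_op Phi (fun_deriv phi) (tc t))
   (p s * (d2phi (g s) * p s) + fun_deriv phi (tc (g s)) * dp s).
  rewrite fE.
  have dc := @is_derive1_comp R (fun t => fun_deriv phi (tc t)) g s _ _ (d1 _) (cov_derive cov s).
  exact: (@is_deriveM R R^o p (fun t => fun_deriv phi (tc (g t))) s 1 _ _ (cov_derive2 cov s) dc).
have cg := is_derive_continuous (cov_derive cov).
apply: (L20_C1 dd).
- apply: continuousDR; apply: continuousMR.
  + exact: (cov_p_continuous cov).
  + apply: continuousMR; last exact: (cov_p_continuous cov).
    exact: (continuous_compR cg d2).
  + exact: (continuous_compR cg (is_derive_continuous d1)).
  + exact: (cov_derive2_continuous cov).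
- apply: (is_derive_periodic dd).
  exact: (one_periodic_lift (adjoint_op Phi (fun_deriv phi))).
- have ca := is_derive_continuous dd.
  have dF (s : R) : is_derive s 1 (fun t => phi (tc (g t))) (adjoint_op Phi (fun_deriv phi) (tc s)).
    have -> : adjoint_op Phi (fun_deriv phi) (tc s) = fun_deriv phi (tc (g s)) * p s.
      by have := congr1 (@^~ s) fE => /= ->; rewrite mulrC.
    exact: (@is_derive1_comp R (fun t => phi (tc t)) g s _ _ (is_derive_lift (sphi 0%N) _) (cov_derive cov s)).
  rewrite (Rintegral_C1 ca dF) !(cov_lift cov).
  by have := one_periodic_lift Phi 0; rewrite add0r => ->; rewrite subrr.
Qed.

Lemma sqrt_bound_Lnorm (L : (circle R -> R) -> circle R -> R) C v : 0 < C ->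
  v \in Lfun mu 2%:E -> L v \in Lfun mu 2%:E ->
  \int[mu]_x (L v x ^+ 2) <= C * \int[mu]_x (v x ^+ 2) ->
  ('N[mu]_2%:E[EFin \o L v] <= (Num.sqrt C)%:E * 'N[mu]_2%:E[EFin \o v])%E.
Proof.
move=> C0 v2 Lv2 h; rewrite !Lnorm2E// -EFinM lee_fin -sqrtrM; last exact: ltW.
by rewrite ler_sqrt// mulr_ge0// ?Rintegral_sqr_ge0// ltW.
Qed.

Lemma deriv_op_L20_operator : L20_operator mu mu (deriv_op Phi rho).
Proof.
split; first exact: deriv_op_L20.
  move=> a v w /L20P[v2 _] /L20P[w2 _]; apply: aeW => x.
  exact: (deriv_opZD cov inv).
have [C C0 hC] := deriv_op_bounded cov inv; exists (Num.sqrt C) => v /L20P[v2 _].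
by apply: sqrt_bound_Lnorm => //; [exact: (Lfun2_deriv_op cov inv v2)|exact: hC].
Qed.

Lemma adjoint_op_L20_operator : L20_operator mu mu (adjoint_op Phi).
Proof.
split; first exact: adjoint_op_L20.
  by move=> a v w _ _; apply: aeW => x; rewrite /adjoint_op; ring.
have [C C0 hC] := adjoint_op_bounded cov inv; exists (Num.sqrt C) => v /L20P[v2 _].
by apply: sqrt_bound_Lnorm => //; [exact: (Lfun2_adjoint_op cov inv v2)|exact: hC].
Qed.

Lemma deriv_op_L20_adjoint : L20_adjoint mu (deriv_op Phi rho) (adjoint_op Phi).
Proof.
split; first exact: adjoint_op_L20_operator.
move=> u v Lu /L20P[v2 _]; have u0 := L20_mean0 Lu; have /L20P[u2 _] := Lu.
exact: (deriv_op_adjoint cov inv u2 v2 u0).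
Qed.

End L20_spaces.

(** * Couplings by fluxes *)

Section wasserstein_bounds.
Context {R : realType}.
Local Notation S1 := (circle R).
Implicit Types (mu nu : probability S1 R).

Lemma pushPE (g : S1 -> S1) mu A : measurable_fun setT g ->
  pushP g mu A = mu (g @^-1` A).
Proof. by move=> mg; rewrite /pushP; case: pselect. Qed.

(** The coupling is the joint law of [X] and [Y]; a free base space allows a reference probability
    different from both marginals. *)
Lemma wasserstein_le_coupling d (T : measurableType d) (m : probability T R)
    (X Y : T -> S1) mu nu (c : R) :
  measurable_fun setT X -> measurable_fun setT Y ->
  (forall A, measurable A -> mu A = m (X @^-1` A)) ->
  (forall A, measurable A -> nu A = m (Y @^-1` A)) ->
  0 <= c -> (\int[m]_z ((circle_dist (X z) (Y z)) ^+ 2)%:E <= (c ^+ 2)%:E)%E ->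
  wasserstein mu nu <= c.
Proof.
move=> mX mY muE nuE c0 hc.
have mXY : measurable_fun [set: T] (fun z => (X z, Y z)) by exact: measurable_fun_pair.
pose Pi := distribution m (mfun_Sub (mem_set mXY)).
have PiE (A : set (S1 * S1)) : Pi A = m ((fun z => (X z, Y z)) @^-1` A) by [].
have cPi : coupling mu nu Pi by move=> A mA; rewrite muE// nuE//.
have md : measurable_fun [set: S1 * S1] (fun z : S1 * S1 => ((circle_dist z.1 z.2) ^+ 2)%:E).
  apply/measurable_EFinP; apply: measurable_funX; exact: measurable_circle_dist.
have E : (\int[Pi]_z ((circle_dist z.1 z.2) ^+ 2)%:E = \int[m]_z ((circle_dist (X z) (Y z)) ^+ 2)%:E)%E.
  rewrite (ge0_integral_transfer (mu := m) (nu := Pi) mXY)//.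
  by move=> z; rewrite lee_fin sqr_ge0.
rewrite /wasserstein -(ger0_norm c0) -sqrtr_sqr ler_sqrt ?sqr_ge0//.
set S := [set _ | _ in _].
have infS : (ereal_inf S <= (c ^+ 2)%:E)%E.
  apply: le_trans hc; rewrite -E; apply: ereal_inf_lbound; by exists Pi.
have inf0 : (0 <= ereal_inf S)%E.
  by apply: le_ereal_inf_tmp => _ [Q _ <-]; apply: integral_ge0 => z _; rewrite lee_fin sqr_ge0.
(* [fine] would send an infinite value to 0, so the infimum is first shown to be finite. *)
have fin : ereal_inf S \is a fin_num.
  by rewrite ge0_fin_numE// (le_lt_trans infS)// ltry.
by rewrite -lee_fin fineK.
Qed.

End wasserstein_bounds.

Lemma eq_refl_le (R : realType) (x y : R) : x = y -> x <= y.
Proof. by move->. Qed.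

Lemma mean_value_near (R : realType) (f df : R -> R) (a b : R) :
  (forall s : R, is_derive s 1 f (df s)) ->
  exists2 c, `|c - a| <= `|b - a| & f b - f a = df c * (b - a).
Proof.
move=> h; have cf := is_derive_continuous h.
have [ab|/ltW ba] := leP a b.
  have [c + ->] := @MVT_segment R f df a b ab (fun x _ => h x) (continuous_subspaceT cf).
  rewrite in_itv/= => /andP[ac cb]; exists c => //.
  by rewrite !ger0_norm ?subr_ge0// lerB.
have [c + e] := @MVT_segment R f df b a ba (fun x _ => h x) (continuous_subspaceT cf).
rewrite in_itv/= => /andP[ac cb]; exists c; last by rewrite -opprB e -mulrN opprB.
by rewrite !ler0_norm ?subr_le0// lerN2 lerB.
Qed.

(** * Transport along a flux on the line *)

Section flux_transport.
Context {R : realType}.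
Local Notation tc := (@to_circle R).
Local Notation leb := (@lebesgue_measure R).
Variables (r F T z dz : R -> R) (m : R).
Hypotheses (m0 : 0 < m) (rm : forall s, m <= r s) (cr : continuous r).
Hypotheses (dF : forall s : R, is_derive s 1 F (r s)).
Hypotheses (F1 : forall s, F (s + 1) = F s + 1).
Hypotheses (FK : cancel F T) (TK : cancel T F).
Hypotheses (dzE : forall s : R, is_derive s 1 z (dz s)) (cdz : continuous dz).
Hypotheses (pz : one_periodic z).

Lemma quantile_shift (n : nat) x : T (x + n%:R) = T x + n%:R.
Proof.
elim: n => [|n ih]; first by rewrite !addr0.
apply: (can_inj FK); rewrite TK -natr1 !addrA F1 -[T x + n%:R]ih TK.
by [].
Qed.

Lemma quantile_continuous : continuous T.
Proof.
have [T' [FK' TK' dT]] := increasing_derive_inverse m0 dF rm.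
have -> : T = T'; last exact: is_derive_continuous dT.
by apply/funext => x; apply: (can_inj FK); rewrite TK TK'.
Qed.

Lemma flux_primitive_derive (t s : R) :
  is_derive s 1 (fun s => F s - t * z s) (r s - t * dz s).
Proof.
have dtz := @is_deriveZ R R R z t s 1 (dz s) (dzE s).
exact: (@is_deriveB R R R F (fun s => t * z s) s 1 (r s) (t * dz s) (dF s) dtz).
Qed.

(* The transport of the density r - t z' to r: F - t z and F are primitives of
   the two densities. *)
Definition flux_map (t s : R) : R := T (F s - t * z s).

Lemma flux_map_continuous t : continuous (flux_map t).
Proof.
apply: continuous_compR; last exact: quantile_continuous.
exact: is_derive_continuous (flux_primitive_derive t).
Qed.

Lemma flux_map_shift t (n : nat) s : flux_map t (s + n%:R) = flux_map t s + n%:R.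
Proof.
rewrite /flux_map -quantile_shift; congr T; rewrite (one_periodicDn n s pz).
have -> : F (s + n%:R) = F s + n%:R; last by ring.
by elim: n => [|n ih]; rewrite ?addr0// -natr1 !addrA F1 ih.
Qed.

(** Degree one case of [ge0_integral_branches]: F - t z is an increasing primitive of the density
    and rises by 1 over each period. *)
Lemma ge0_integral_flux_map t f : (forall s, m / 2 <= r s - t * dz s) ->
  measurable_fun [set: circle R] f -> (forall x, (0 <= f x)%E) ->
  (\int[leb]_(s in `[0%R, 1%R[) (f (tc (flux_map t s)) * (r s - t * dz s)%:E) =
   \int[leb]_(x in `[0%R, 1%R[) f (tc (T x)))%E.
Proof.
move=> hm mf f0.
have dH := flux_primitive_derive t.
have cdH : continuous (fun s => r s - t * dz s).
  have -> : (fun s => r s - t * dz s) = fun s => r s + (- t) * dz s.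
    by apply/funext => s; rewrite mulNr.
  apply: continuousDR => //; apply: continuousMR => // s; exact: cvg_cst.
have m20 : 0 < m / 2 by rewrite divr_gt0.
have mT : measurable_fun [set: measurableTypeR R] (T : measurableTypeR R -> measurableTypeR R).
  exact: continuous_measurable_fun quantile_continuous.
have cH := is_derive_continuous dH.
have mH : measurable_fun [set: measurableTypeR R] ((fun s => F s - t * z s) : measurableTypeR R -> measurableTypeR R).
  exact: continuous_measurable_fun cH.
have [Hi [HK HiK dHi]] := increasing_derive_inverse m20 dH hm.
pose h s := f (tc (flux_map t s)).
have -> : (\int[leb]_(s in `[0%R, 1%R[) (f (tc (flux_map t s)) * (r s - t * dz s)%:E) =
    \int[leb]_(s in `[0%R, 1%R[) (h s * `|r s - t * dz s|%:E))%E.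
  by apply: eq_integral => s _; rewrite ger0_norm// (le_trans (ltW m20)).
have hm1 s : m / 2 <= 1 * (r s - t * dz s) by rewrite mul1r.
rewrite (@ge0_integral_branches R (fun s => F s - t * z s) (fun s => r s - t * dz s) Hi (m / 2) 1 1 h
  m20 (or_introl erefl) dH cdH hm1).
- by apply: eq_integral => x _; rewrite big_ord1 addr0 /h /flux_map HiK.
- by move=> s; rewrite F1 pz mulr1; ring.
- exact: HK.
- exact: HiK.
- exact: is_derive_continuous dHi.
- apply: (measurableT_comp (measurable_comp_to_circle mf)).
  exact: (measurableT_comp mT mH).
- by move=> s; exact: f0.
- by move=> s; rewrite /h -[1]/(1%:R) flux_map_shift to_circleDn.
Qed.

(** With x = flux_map t s one has F s - F x = t z s, and the mean value theorem makes this r c (s -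
    x) for some c between x and s. So |s - x| is at most A |t|; replacing r c by r x and z s by z x
    then costs one more factor |t|, by the Lipschitz bounds on r and z. *)
Lemma flux_map_estimate L : (forall x y, `|r x - r y| <= L * `|x - y|) ->
  exists2 K, 0 <= K & forall t s,
  `|s - (flux_map t s + t * (z (flux_map t s) / r (flux_map t s)))| <= K * t ^+ 2.
Proof.
move=> rL.
have [Cz Cz0 hz] := periodic_bounded (is_derive_continuous dzE) pz.
have [Cd Cd0 hd] := periodic_bounded cdz (is_derive_periodic dzE pz).
pose A := Cz / m; have A0 : 0 < A by rewrite divr_gt0.
have L0 : 0 <= L.
  by have := rL 0 1; rewrite sub0r normrN normr1 mulr1; exact: le_trans.
exists ((L * A ^+ 2 + Cd * A) / m).
  apply: divr_ge0; last exact: ltW.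
  by apply: addr_ge0; apply: mulr_ge0 => //; [exact: sqr_ge0|exact: ltW|exact: ltW].
move=> t s; set x := flux_map t s.
have Fx : F x = F s - t * z s by rewrite /x /flux_map TK.
have [c cx Fc] := mean_value_near x s dF.
have dE : r c * (s - x) = t * z s by rewrite -Fc Fx subKr.
have rc0 : 0 < r c by exact: lt_le_trans (rm c).
have dA : `|s - x| <= `|t| * A.
  rewrite /A mulrA ler_pdivlMr//.
  apply: (@le_trans _ _ (`|r c * (s - x)|)).
    by rewrite normrM mulrC ler_wpM2r// gtr0_norm.
  by rewrite dE normrM ler_wpM2l.
have zA : `|z s - z x| <= Cd * `|s - x| by exact: (derive_bounded_lipschitz _ _ dzE hd).
have rx0 : 0 < r x by exact: lt_le_trans (rm x).
set E := s - _.
have rE : r x * E = (r x - r c) * (s - x) + t * (z s - z x).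
  have -> : r x * E = r x * (s - x) - t * z x by rewrite /E; field; rewrite gt_eqF.
  rewrite mulrBl dE; ring.
rewrite mulrAC ler_pdivlMr//.
apply: (@le_trans _ _ (`|r x * E|)).
  by rewrite normrM mulrC ler_wpM2r// gtr0_norm.
rewrite rE [leRHS]mulrDl; apply: (le_trans (ler_normD _ _)); apply: lerD; rewrite normrM.
  apply: (@le_trans _ _ ((L * `|s - x|) * `|s - x|)).
    by rewrite ler_wpM2r// distrC (le_trans (rL _ _))// ler_wpM2l.
  rewrite -[leLHS]mulrA -[leRHS]mulrA; apply: ler_wpM2l => //.
  apply: (@le_trans _ _ ((`|t| * A) * (`|t| * A))); first exact: ler_pM.
  by rewrite -[t ^+ 2]real_normK ?num_real//; apply: eq_refl_le; ring.
apply: (@le_trans _ _ (`|t| * (Cd * (`|t| * A)))).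
  by rewrite ler_wpM2l// (le_trans zA)// ler_wpM2l// ltW.
rewrite -[t ^+ 2]real_normK ?num_real//; apply: eq_refl_le; ring.
Qed.

End flux_transport.

(** * The coupling of the two image measures *)

Section transport_coupling.
Context {R : realType}.
Local Notation tc := (@to_circle R).
Local Notation leb := (@lebesgue_measure R).
Local Notation S1 := (circle R).
Variables (Phi : circle R -> circle R) (g p dp xi : R -> R) (e : R) (k : nat).
Hypothesis cov : circle_covering Phi g p dp xi e k.
Variables (rho : circle R -> R) (mu : probability (circle R) R).
Hypothesis inv : invariant_density Phi rho mu.

Let r s := rho (tc s).

Lemma density_quantile : exists F T : R -> R,
  [/\ forall s : R, is_derive s 1 F (r s), forall s, F (s + 1) = F s + 1,
      cancel F T & cancel T F].
Proof.
have [m [M [m0 M0 h]]] := rho_bounded inv.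
have cr : continuous r := rho_lift_continuous inv.
have [F dF] := continuous_primitive cr.
have [T [FK TK _]] := increasing_derive_inverse m0 dF (fun s => proj1 (andP (h (tc s)))).
exists F, T; split=> // s.
have dG (x : R) : is_derive x 1 (fun x => F (x + 1) - F x) (r (x + 1) - r x).
  exact: (@is_deriveB R R R (fun x => F (x + 1)) F x 1 _ _
    (@is_derive_translate R F x 1 _ (dF (x + 1))) (dF x)).
have [c _ Gc] := mean_value_near 0 s dG.
have Gs : F (s + 1) - F s = F 1 - F 0.
  move: Gc; rewrite /r (one_periodic_lift rho c) subrr mul0r add0r => /eqP.
  by rewrite subr_eq0 => /eqP.
have F10 : F 1 - F 0 = 1.
  rewrite -(Rintegral_C1 inv cr dF).
  under eq_Rintegral do rewrite divff ?gt_eqF ?(rho_gt0 inv)//.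
  rewrite /Rintegral integral_cst// mul1e.
  exact: (congr1 fine (probability_setT mu)).
by apply/eqP; rewrite [eqbRHS]addrC -subr_eq Gs F10.
Qed.

Lemma rho_lipschitz : exists L, forall x y, `|r x - r y| <= L * `|x - y|.
Proof.
have pr := is_derive_periodic (rho_derive inv) (one_periodic_lift rho).
have [L L0 hL] := periodic_bounded (rho_derive_continuous inv) pr.
by exists L => x y; exact: (derive_bounded_lipschitz _ _ (rho_derive inv) hL).
Qed.

Lemma map_lipschitz : exists2 C, 0 < C &
  forall x a b, circle_dist (Phi (x + tc a)) (Phi (x + tc b)) <= C * `|a - b|.
Proof.
have [C C0 hC] := periodic_bounded (cov_p_continuous cov) (cov_p_periodic cov).
exists C => // x a b; rewrite -(short_reprK x); set s := short_repr x.
rewrite -!to_circleD -!(cov_lift cov).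
apply: (le_trans (circle_dist_to_circle_le _ _)).
have -> : a - b = (s + a) - (s + b) by ring.
exact: (derive_bounded_lipschitz _ _ (cov_derive cov) hC).
Qed.

Section quantile.
Variables (F T : R -> R).
Hypotheses (dF : forall s : R, is_derive s 1 F (r s)).
Hypotheses (F1 : forall s, F (s + 1) = F s + 1).
Hypotheses (FK : cancel F T) (TK : cancel T F).

(** The case of zero flux: [T] is the quantile function of [mu] and carries Lebesgue measure on a
    period to [mu]. *)
Lemma ge0_integral_quantile f : measurable_fun [set: circle R] f ->
  (forall x, (0 <= f x)%E) ->
  (\int[mu]_x f x = \int[leb]_(x in `[0%R, 1%R[) f (tc (T x)))%E.
Proof.
move=> mf f0; have [m [M [m0 M0 h]]] := rho_bounded inv.
have rm s : m <= r s := proj1 (andP (h (tc s))).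
have z0 (s : R) : is_derive s 1 ((fun=> 0) : R -> R) (0 : R) by exact: is_derive_cst.
have c0 : continuous ((fun=> 0) : R -> R) by move=> s; exact: cvg_cst.
rewrite (integral_mu_lift inv mf).
rewrite -(ge0_integral_flux_map m0 rm (rho_lift_continuous inv) dF F1 FK TK z0 c0
  (fun s => erefl) (t := 0) _ mf f0); last first.
  by move=> s; rewrite mul0r subr0 (le_trans _ (rm s))// ler_pdivrMr// mulr_natr mulr2n lerDl ltW.
by apply: eq_integral => s _; rewrite /flux_map !mul0r !subr0 FK.
Qed.

Section field.
Variables (v : circle R -> R) (dv : R -> R).
Hypotheses (dvE : forall s : R, is_derive s 1 (fun t => v (tc t)) (dv s)).
Hypotheses (cdv : continuous dv).

Let z := flux rho v.
Let dz := dflux rho v dv.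
Let Z := image_flux Phi xi e k rho v.
Let dZ := dimage_flux p xi e k rho v dv.

Lemma sum_branches_flux_density t s :
  \sum_(j < k) (r (xi (s + j%:R)) - t * dz (xi (s + j%:R))) / `|p (xi (s + j%:R))| =
  r s - t * dZ s.
Proof.
rewrite /r -(sum_branches_density cov inv s) /dZ /dimage_flux mulr_sumr -sumrB.
apply: eq_bigr => j _; set x := xi _.
rewrite mulrBl; congr (_ - _); rewrite -/dz !mulrA.
have -> : `|p x|^-1 = e / p x.
  have := cov_sign_sqr cov; rewrite (cov_norm cov) invfM => ee.
  by congr (_ / _); case: (cov_sign cov) => ->; rewrite ?invrN invr1.
by rewrite mulrA -[t * e * _]mulrA [e * dz x]mulrC !mulrA.
Qed.

(** Folding along the branches of [g] replaces the density r - t z' by its image r - t Z', which the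
    flux map of [Z] then carries to r. *)
Lemma ge0_integral_image_flux_map m t f : 0 < m -> (forall s, m <= r s) ->
  (forall s, m / 2 <= r s - t * dz s) -> (forall s, m / 2 <= r s - t * dZ s) ->
  measurable_fun [set: circle R] f -> (forall x, (0 <= f x)%E) ->
  (\int[leb]_(s in `[0%R, 1%R[) (f (tc (flux_map F T Z t (g s))) * (r s - t * dz s)%:E) =
   \int[leb]_(x in `[0%R, 1%R[) f (tc (T x)))%E.
Proof.
move=> m0 rm hz hZ mf f0.
have cr : continuous r := rho_lift_continuous inv.
have dZE := image_flux_derive cov inv dvE.
have cdZ := dimage_flux_continuous cov inv dvE cdv.
have pZ := image_flux_periodic cov inv v.
rewrite -(ge0_integral_flux_map m0 rm cr dF F1 FK TK dZE cdZ pZ hZ mf f0).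
pose q s := (r s - t * dz s) / `|p s|.
have pn0 s : `|p s| != 0.
  have := cov_expanding cov s; rewrite normr_eq0 => hp.
  by apply: contraTN hp => /eqP->; rewrite mulr0 ler10.
have cq : continuous q.
  rewrite (_ : q = fun s => (r s + (- t) * dz s) * `|p s|^-1); last first.
    by apply/funext => s; rewrite mulNr.
  apply: continuousMR.
    apply: continuousDR => //; apply: continuousMR; first by move=> s; exact: cvg_cst.
    exact: (dflux_continuous inv dvE cdv).
  have cn : continuous (fun s => `|p s|).
    have cp : continuous p := cov_p_continuous cov.
    by move=> s; apply: (continuous_comp (cp s)); exact: norm_continuous.
  by move=> s; exact: (@continuousV _ _ (fun s => `|p s|) s (pn0 s) (cn s)).
have q0 s : 0 <= q s.
  by rewrite divr_ge0// (le_trans _ (hz s))// divr_ge0// ltW.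
pose h s := (f (tc (flux_map F T Z t (g s))) * (q s)%:E)%E.
have cfm : continuous (flux_map F T Z t) by exact: (flux_map_continuous m0 rm dF FK TK dZE).
have -> : (\int[leb]_(s in `[0%R, 1%R[) (f (tc (flux_map F T Z t (g s))) * (r s - t * dz s)%:E) =
    \int[leb]_(s in `[0%R, 1%R[) (h s * `|p s|%:E))%E.
  apply: eq_integral => s _; rewrite /h -muleA -EFinM; congr (_ * _%:E)%E.
  by rewrite /q divfK.
rewrite (@ge0_integral_branches R g p xi 1 e k h ltr01 (cov_sign cov) (cov_derive cov)
  (cov_p_continuous cov) (cov_expanding cov) (cov_degree cov) (covK cov) (cov_invK cov)
  (cov_inv_continuous cov)).
- apply: eq_integral => s _; rewrite -(sum_branches_flux_density t s) -sumEFin.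
  rewrite ge0_sume_distrr; last by move=> j _; rewrite lee_fin q0.
  apply: eq_bigr => j _; rewrite /h (cov_invK cov).
  by rewrite (flux_map_shift F1 FK TK pZ) to_circleDn.
- have mg : measurable_fun [set: measurableTypeR R] ((fun s => flux_map F T Z t (g s)) : measurableTypeR R -> measurableTypeR R).
    apply: continuous_measurable_fun; apply: continuous_compR => //.
    exact: is_derive_continuous (cov_derive cov).
  apply: emeasurable_funM.
    exact: (measurableT_comp (measurable_comp_to_circle mf) mg).
  by apply/measurable_EFinP; exact: continuous_measurable_fun.
- by move=> s; rewrite /h mule_ge0// lee_fin.
- move=> s; rewrite /h; congr (_ * _%:E)%E; last first.
    rewrite /q /r (one_periodic_lift rho s) (cov_p_periodic cov s); congr ((_ - _ * _) / _).
    exact: (is_derive_periodic (flux_derive inv dvE) (one_periodic_lift (fun x => rho x * v x))).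
  rewrite (cov_degree cov); congr f; case: (cov_sign cov) => ->.
    by rewrite mul1r (flux_map_shift F1 FK TK pZ) to_circleDn.
  rewrite -[in RHS](subrK k%:R (g s)) (flux_map_shift F1 FK TK pZ) to_circleDn mulN1r.
  by [].
Qed.

End field.
End quantile.

(** Integral identities on one period become laws on the circle: on the indicator of [A], [hf] gives
    the mass of [A], and periodicity lets [short_repr] stand for any lift. *)
Lemma law_of_lift (H : R -> S1) (w : R -> R) (m : probability S1 R) :
  one_periodic H -> one_periodic w -> measurable_fun [set: measurableTypeR R] H ->
  measurable_fun [set: measurableTypeR R] w -> (forall s, 0 <= w s) ->
  (forall A, m A = \int[circle_lebesgue R]_(x in A) (w (short_repr x))%:E)%E ->
  (forall f : S1 -> \bar R, measurable_fun setT f -> (forall x, (0 <= f x)%E) ->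
    \int[leb]_(s in `[0%R, 1%R[) (f (H s) * (w s)%:E) = \int[mu]_x f x)%E ->
  forall A, measurable A -> mu A = m ((fun x => H (short_repr x)) @^-1` A).
Proof.
move=> pH pw mH mw w0 mE hf A mA.
have mX : measurable_fun [set: S1] (fun x => H (short_repr x)).
  exact: measurableT_comp mH (@measurable_short_repr R).
have mw' : measurable_fun [set: S1] (fun x => w (short_repr x)).
  exact: measurableT_comp mw (@measurable_short_repr R).
have mXA : measurable ((fun x => H (short_repr x)) @^-1` A).
  by rewrite -[X in measurable X]setTI; exact: mX.
have mfA : measurable_fun [set: S1] (fun x => (\1_A x : R)%:E).
  by apply/measurable_EFinP; exact: measurable_indic.
have -> : mu A = (\int[mu]_x (\1_A x : R)%:E)%E by rewrite integral_indic// setIT.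
rewrite -hf//.
have -> : m ((fun x => H (short_repr x)) @^-1` A) =
    (\int[m]_x (\1_((fun x => H (short_repr x)) @^-1` A) x : R)%:E)%E.
  by rewrite integral_indic// setIT.
rewrite (ge0_integral_density mw' (fun x => w0 _) (fun A _ => mE A)); last 2 first.
- by apply/measurable_EFinP; exact: measurable_indic.
- by move=> x; rewrite lee_fin.
rewrite ge0_integral_circle; last 2 first.
- apply: emeasurable_funM; first by apply/measurable_EFinP; exact: measurable_indic.
  exact/measurable_EFinP.
- by move=> x; rewrite mule_ge0// lee_fin.
apply: eq_integral => s _.
have E (V : Type) (h : R -> V) : one_periodic h -> h (short_repr (tc s)) = h s.
  by move=> ph; rewrite short_repr_to_circle -mulrNz (one_periodicDz _ _ ph).
rewrite (E _ _ pw); congr (_%:E * _)%E; rewrite !indicE.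
by congr ((_ : bool)%:R); apply/idP/idP; rewrite !inE/= (E _ _ pH).
Qed.

Lemma flux_coupling (v : S1 -> R) (dv : R -> R) :
  (forall s : R, is_derive s 1 (fun t => v (tc t)) (dv s)) -> continuous dv ->
  exists tau K, [/\ 0 < tau, 0 <= K & forall t, `|t| <= tau ->
  exists (m : probability S1 R) (X Y : S1 -> S1),
   [/\ measurable_fun setT X, measurable_fun setT Y,
       forall A, measurable A -> mu A = m (X @^-1` A),
       forall A, measurable A -> mu A = m (Y @^-1` A) &
       forall x, circle_dist (Phi (X x + tc (t * v (X x))))
                   (Y x + tc (t * deriv_op Phi rho v (Y x))) <= K * t ^+ 2]].
Proof.
move=> dvE cdv.
have [c [M [c0 M0 hc]]] := rho_bounded inv.
have rc s : c <= r s := proj1 (andP (hc (tc s))).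
have cr : continuous r := rho_lift_continuous inv.
have [F [T [dF F1 FK TK]]] := density_quantile.
have [L hL] := rho_lipschitz; have [C C0 hC] := map_lipschitz.
pose z := flux rho v; pose dz := dflux rho v dv.
pose Z := image_flux Phi xi e k rho v; pose dZ := dimage_flux p xi e k rho v dv.
have dzE : forall s : R, is_derive s 1 z (dz s) := flux_derive inv dvE.
have cdz : continuous dz := dflux_continuous inv dvE cdv.
have pz : one_periodic z := one_periodic_lift (fun x => rho x * v x).
have dZE : forall s : R, is_derive s 1 Z (dZ s) := image_flux_derive cov inv dvE.
have cdZ : continuous dZ := dimage_flux_continuous cov inv dvE cdv.
have pZ : one_periodic Z := image_flux_periodic cov inv v.
have [K1 K10 h1] := flux_map_estimate c0 rc dF TK dzE cdz pz hL.
have [K2 K20 h2] := flux_map_estimate c0 rc dF TK dZE cdZ pZ hL.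
have pdz := is_derive_periodic dzE pz.
have [C1 C10 hC1] := periodic_bounded cdz pdz.
have [C2 C20 hC2] := periodic_bounded cdZ (is_derive_periodic dZE pZ).
have C120 : 0 < C1 + C2 by exact: addr_gt0.
(* For such t both r - t z' and r - t Z' stay above c / 2, as the changes of variables require. [C]
   multiplies [K1] because the error of the first map passes through [Phi]. *)
exists (c / 2 / (C1 + C2)), (C * K1 + K2); split.
- by rewrite !divr_gt0.
- by rewrite addr_ge0// mulr_ge0// ltW.
move=> t; rewrite ler_pdivlMr// => ht.
have low (f : R -> R) B : (forall s, `|f s| <= B) -> B <= C1 + C2 ->
    forall s, c / 2 <= r s - t * f s.
  move=> hf hB s.
  have tf : t * f s <= c / 2.
    apply: le_trans ht; apply: (le_trans (ler_norm _)); rewrite normrM.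
    by rewrite ler_wpM2l// (le_trans (hf s)).
  by have := rc s; lra.
have lz : forall s, c / 2 <= r s - t * dz s by apply: (low _ _ hC1); rewrite lerDl ltW.
have lZ : forall s, c / 2 <= r s - t * dZ s by apply: (low _ _ hC2); rewrite lerDr ltW.
pose w s := r s - t * dz s.
have w0 s : 0 <= w s by rewrite (le_trans _ (lz s))// divr_ge0// ltW.
have pw : one_periodic w.
  by move=> s; rewrite /w pdz /r (one_periodic_lift rho s).
have cw : continuous w.
  rewrite (_ : w = fun s => r s + (- t) * dz s); last first.
    by apply/funext => s; rewrite mulNr.
  by apply: continuousDR => //; apply: continuousMR => // s; exact: cvg_cst.
have mw : measurable_fun [set: measurableTypeR R] (w : measurableTypeR R -> R).
  exact: continuous_measurable_fun.
have mw' : measurable_fun [set: S1] (fun x => w (short_repr x)).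
  exact: measurableT_comp mw (@measurable_short_repr R).
have lawz f : measurable_fun [set: S1] f -> (forall x, (0 <= f x)%E) ->
    (\int[leb]_(s in `[0%R, 1%R[) (f (tc (flux_map F T z t s)) * (w s)%:E) = \int[mu]_x f x)%E.
  move=> mf f0; rewrite (ge0_integral_quantile dF F1 FK TK mf f0).
  exact: (ge0_integral_flux_map c0 rc cr dF F1 FK TK dzE cdz pz lz mf f0).
have lawZ f : measurable_fun [set: S1] f -> (forall x, (0 <= f x)%E) ->
    (\int[leb]_(s in `[0%R, 1%R[) (f (tc (flux_map F T Z t (g s))) * (w s)%:E) = \int[mu]_x f x)%E.
  move=> mf f0; rewrite (ge0_integral_quantile dF F1 FK TK mf f0).
  exact: (ge0_integral_image_flux_map dF F1 FK TK dvE cdv c0 rc lz lZ mf f0).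
(* Total mass one is the law identity applied to the constant function 1. *)
have w1 : density_measure (circle_lebesgue R) (fun x => w (short_repr x)) setT = 1%E.
  have mwE : measurable_fun [set: S1] (fun x => (w (short_repr x))%:E).
    exact/measurable_EFinP.
  rewrite /density_measure (ge0_integral_circle mwE); last by move=> x; rewrite lee_fin.
  transitivity (\int[mu]_x (1 : \bar R))%E; last first.
    by rewrite integral_cst// mul1e; exact: probability_setT.
  rewrite -(lawz (fun=> 1%E))//.
  apply: eq_integral => s _; rewrite mul1e short_repr_to_circle -mulrNz.
  by rewrite (one_periodicDz _ _ pw).
have [m mE] := exists_density_probability mw' (fun x => w0 _) w1.
have cfz : continuous (flux_map F T z t) by exact: (flux_map_continuous c0 rc dF FK TK dzE).
have cfZ : continuous (fun s => flux_map F T Z t (g s)).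
  apply: continuous_compR; first exact: is_derive_continuous (cov_derive cov).
  exact: (flux_map_continuous c0 rc dF FK TK dZE).
have mHz : measurable_fun [set: measurableTypeR R] ((fun s => tc (flux_map F T z t s)) : measurableTypeR R -> S1).
  apply: (measurableT_comp (@measurable_to_circle R)).
  exact: continuous_measurable_fun.
have mHZ : measurable_fun [set: measurableTypeR R] ((fun s => tc (flux_map F T Z t (g s))) : measurableTypeR R -> S1).
  apply: (measurableT_comp (@measurable_to_circle R)).
  exact: continuous_measurable_fun.
have pHz : one_periodic (fun s => tc (flux_map F T z t s)).
  by move=> s; rewrite -[1]/(1%:R) (flux_map_shift F1 FK TK pz) to_circleDn.
have pHZ : one_periodic (fun s => tc (flux_map F T Z t (g s))).
  move=> s; rewrite (cov_degree cov); case: (cov_sign cov) => ->.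
    by rewrite mul1r (flux_map_shift F1 FK TK pZ) to_circleDn.
  by rewrite -[in RHS](subrK k%:R (g s)) (flux_map_shift F1 FK TK pZ) to_circleDn mulN1r.
exists m, (fun x => tc (flux_map F T z t (short_repr x))).
exists (fun x => tc (flux_map F T Z t (g (short_repr x)))); split.
- exact: measurableT_comp mHz (@measurable_short_repr R).
- exact: measurableT_comp mHZ (@measurable_short_repr R).
- exact: (law_of_lift pHz pw mHz mw w0 mE lawz).
- exact: (law_of_lift pHZ pw mHZ mw w0 mE lawZ).
move=> x; set s := short_repr x.
set a := flux_map F T z t s; set b := flux_map F T Z t (g s).
apply: (le_trans (circle_dist_triangle (tc (g s)) _ _)); rewrite mulrDl; apply: lerD.
  rewrite (cov_lift cov).
  have -> : Phi (tc s) = Phi (tc a + tc (s - a)) by rewrite -to_circleD addrC subrK.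
  apply: (le_trans (hC _ _ _)); rewrite -mulrA; apply: ler_wpM2l; first exact: ltW.
  apply: le_trans (h1 t s); rewrite -normrN -/a; apply: eq_refl_le; congr `|_|.
  have -> : z a / r a = v (tc a).
    by rewrite /z /flux mulrAC divff ?mul1r// gt_eqF// (rho_gt0 inv).
  ring.
rewrite (deriv_op_flux cov inv) -to_circleD.
apply: (le_trans (circle_dist_to_circle_le _ _)); exact: h2.
Qed.

End transport_coupling.

(** * The derivative *)

Section gateaux.
Context {R : realType}.
Local Notation tc := (@to_circle R).
Local Notation S1 := (circle R).
Variables (Phi : circle R -> circle R) (g p dp xi : R -> R) (e : R) (k : nat).
Hypothesis cov : circle_covering Phi g p dp xi e k.
Variables (rho : circle R -> R) (mu : probability (circle R) R).
Hypothesis inv : invariant_density Phi rho mu.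

Lemma circle_dist_translate_le (x : S1) a b : circle_dist (x + tc a) (x + tc b) <= `|a - b|.
Proof.
rewrite -(short_reprK x) -!to_circleD; apply: (le_trans (circle_dist_to_circle_le _ _)).
by rewrite opprD addrACA subrr add0r.
Qed.

Lemma sqr_add3_le (d x y z : R) : 0 <= d -> d <= x + y + z ->
  d ^+ 2 <= 3 * (x ^+ 2 + y ^+ 2 + z ^+ 2).
Proof.
move=> d0 h; apply: (@le_trans _ _ ((x + y + z) ^+ 2)).
  by rewrite lerXn2r// nnegrE (le_trans d0 h).
rewrite -subr_ge0.
have -> : 3 * (x ^+ 2 + y ^+ 2 + z ^+ 2) - (x + y + z) ^+ 2 =
  (x - y) ^+ 2 + (y - z) ^+ 2 + (x - z) ^+ 2 by ring.
by rewrite !addr_ge0// sqr_ge0.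
Qed.

(** Since [X] has law [mu], L^2 distances between fields are the same along [X] as under [mu]; this
    lets a coupling built for one field serve another. *)
Lemma integral_law_sqr d (T : measurableType d) (m : probability T R) (X : T -> S1) (f : S1 -> R) :
  measurable_fun setT X -> (forall A, measurable A -> mu A = m (X @^-1` A)) ->
  f \in Lfun mu 2%:E ->
  (\int[m]_x ((f (X x)) ^+ 2)%:E = (\int[mu]_x (f x ^+ 2))%R%:E)%E.
Proof.
move=> mX lX f2; have mf := Lfun2_measurable f2.
rewrite /Rintegral fineK; last exact: (integrable_fin_num _ (Lfun2_sqr_integrable f2)).
rewrite (ge0_integral_transfer (f := fun x => ((f x) ^+ 2)%:E) mX lX)//.
- by apply/measurable_EFinP; exact: measurable_funX.
- by move=> x; rewrite lee_fin sqr_ge0.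
Qed.

Lemma wasserstein_deriv_op v eps : L20 mu v -> 0 < eps ->
  exists2 tau, 0 < tau & forall t, `|t| <= tau ->
    wasserstein (pushP Phi (translate mu (fun x => t * v x)))
      (translate (pushP Phi mu) (fun x => t * deriv_op Phi rho v x)) <= eps * `|t|.
Proof.
move=> /L20P[v2 hv] eps0; have mv := Lfun2_measurable v2.
have mPhi := measurable_expanding cov.
have [A A0 hA] := map_lipschitz cov; have [C C0 hC] := deriv_op_bounded cov inv.
have AC0 : 0 < A ^+ 2 + C by rewrite addr_gt0// exprn_gt0.
(* Of the budget eps^2 t^2, the approximation takes 3 t^2 (A^2 + C) times this bound, that is one
   half; the quadratic error takes 3 (K t^2)^2, at most one third for the t allowed below. *)
have [|phi [sphi hphi]] := hv (eps ^+ 2 / (6 * (A ^+ 2 + C))).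
  by rewrite divr_gt0// ?exprn_gt0// mulr_gt0.
pose v' := fun_deriv phi.
have [d1 d2] := smooth_field sphi.
have v'2 : v' \in Lfun mu 2%:E := Lfun2_smooth mu (fun_smooth_deriv sphi).
have [tau [K [tau0 K0 hK]]] := flux_coupling cov inv d1 d2.
(* The second bound gives K |t| <= eps / 3; the divisor uses K + 1 because K may be 0. *)
exists (Num.min tau (eps / (3 * (K + 1)))).
  by rewrite lt_min tau0 divr_gt0// mulr_gt0// ltr_wpDl.
move=> t; rewrite le_min => /andP[/hK[m [X [Y [mX mY lX lY hXY]]]]].
rewrite ler_pdivlMr ?mulr_gt0 ?ltr_wpDl// => ht.
set Lv := deriv_op Phi rho v; pose Lv' := deriv_op Phi rho v'.
have Lv2 : Lv \in Lfun mu 2%:E := Lfun2_deriv_op cov inv v2.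
have Lv'2 : Lv' \in Lfun mu 2%:E := Lfun2_deriv_op cov inv v'2.
have mLv := Lfun2_measurable Lv2.
have mtv : measurable_fun [set: S1] (fun x => x + tc (t * v x)).
  by apply: measurable_translate_circle; [exact: measurable_id|exact: measurable_funM].
have mtLv : measurable_fun [set: S1] (fun x => x + tc (t * Lv x)).
  by apply: measurable_translate_circle; [exact: measurable_id|exact: measurable_funM].
have msub (h : S1 -> S1) B : measurable_fun setT h -> measurable B -> measurable (h @^-1` B).
  by move=> mh mB; rewrite -[X in measurable X]setTI; exact: mh.
apply: (@wasserstein_le_coupling R _ _ m (fun x => Phi (X x + tc (t * v (X x))))
  (fun x => Y x + tc (t * Lv (Y x)))).
- exact: measurableT_comp mPhi (measurableT_comp mtv mX).
- exact: measurableT_comp mtLv mY.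
- move=> B mB; rewrite pushPE// /translate pushPE// lX//.
  by apply: (msub _ _ mtv); exact: msub.
- move=> B mB; rewrite /translate pushPE// pushPE//.
  have [_ _ _ ->] := inv; last exact: msub.
  by rewrite lY//; exact: msub.
- by rewrite mulr_ge0// ltW.
have vv'2 : (fun x => v x - v' x) \in Lfun mu 2%:E := Lfun2B v2 v'2.
have LL2 : (fun x => Lv x - Lv' x) \in Lfun mu 2%:E := Lfun2B Lv2 Lv'2.
pose c1 := 3 * (A ^+ 2 * t ^+ 2); pose c2 := 3 * t ^+ 2; pose c3 := 3 * (K * t ^+ 2) ^+ 2.
have c10 : 0 <= c1 by rewrite mulr_ge0// mulr_ge0// sqr_ge0.
have c20 : 0 <= c2 by rewrite mulr_ge0// sqr_ge0.
have c30 : 0 <= c3 by rewrite mulr_ge0// sqr_ge0.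
have bound x : (circle_dist (Phi (X x + tc (t * v (X x)))) (Y x + tc (t * Lv (Y x)))) ^+ 2 <=
    c1 * (v (X x) - v' (X x)) ^+ 2 + (c2 * (Lv (Y x) - Lv' (Y x)) ^+ 2 + c3).
  apply: (@le_trans _ _ (3 * ((A * `|t * v (X x) - t * v' (X x)|) ^+ 2 +
      (K * t ^+ 2) ^+ 2 + `|t * Lv' (Y x) - t * Lv (Y x)| ^+ 2))).
    apply: sqr_add3_le; first exact: circle_dist_ge0.
    apply: (le_trans (circle_dist_triangle (Y x + tc (t * Lv' (Y x))) _ _)).
    apply: lerD; last exact: circle_dist_translate_le.
    apply: (le_trans (circle_dist_triangle (Phi (X x + tc (t * v' (X x)))) _ _)).
    by apply: lerD; [exact: hA|exact: hXY].
  rewrite exprMn !real_normK ?num_real//;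
  by rewrite /c1 /c2 /c3; apply: eq_refl_le; ring.
have msq : measurable_fun [set: S1] (fun x => ((v (X x) - v' (X x)) ^+ 2)%:E).
  apply/measurable_EFinP; apply: measurable_funX.
  exact: measurableT_comp (Lfun2_measurable vv'2) mX.
have msq' : measurable_fun [set: S1] (fun x => ((Lv (Y x) - Lv' (Y x)) ^+ 2)%:E).
  apply/measurable_EFinP; apply: measurable_funX.
  exact: measurableT_comp (Lfun2_measurable LL2) mY.
apply: (@le_trans _ _ (\int[m]_x (c1%:E * ((v (X x) - v' (X x)) ^+ 2)%:E +
    (c2%:E * ((Lv (Y x) - Lv' (Y x)) ^+ 2)%:E + c3%:E)))%E).
  apply: ge0_le_integral => //.
  - by move=> x _; rewrite lee_fin sqr_ge0.
  - apply/measurable_EFinP; apply: measurable_funX.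
    apply: measurable_circle_dist.
      exact: measurableT_comp mPhi (measurableT_comp mtv mX).
    exact: measurableT_comp mtLv mY.
  - apply: emeasurable_funD; last apply: emeasurable_funD => //.
      by apply: emeasurable_funM => //; exact: msq.
    by apply: emeasurable_funM => //; exact: msq'.
  - by move=> x _; rewrite -!EFinM -!EFinD lee_fin; exact: bound.
have s0 (T : Type) (c : R) (f : T -> R) y : 0 <= c -> (0 <= c%:E * (f y ^+ 2)%:E)%E.
  by move=> c0; rewrite -EFinM lee_fin mulr_ge0// sqr_ge0.
rewrite ge0_integralD//; last 4 first.
- by move=> x _; exact: (s0 _ _ (fun x => v (X x) - v' (X x))).
- by apply: emeasurable_funM => //; exact: msq.
- by move=> x _; apply: adde_ge0; [exact: (s0 _ _ (fun x => Lv (Y x) - Lv' (Y x)))|rewrite lee_fin].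
- by apply: emeasurable_funD => //; apply: emeasurable_funM => //; exact: msq'.
rewrite ge0_integralD//; last 2 first.
- by move=> x _; exact: (s0 _ _ (fun x => Lv (Y x) - Lv' (Y x))).
- by apply: emeasurable_funM => //; exact: msq'.
rewrite ge0_integralZl_EFin//; last by move=> x _; rewrite lee_fin sqr_ge0.
rewrite ge0_integralZl_EFin//; last by move=> x _; rewrite lee_fin sqr_ge0.
have -> : (\int[m]__ c3%:E = c3%:E)%E.
  rewrite integral_cst// -[RHS]mule1; congr (_ * _)%E; exact: probability_setT.
rewrite (integral_law_sqr mX lX vv'2) (integral_law_sqr mY lY LL2).
rewrite -!EFinM -!EFinD lee_fin.
have I1 : \int[mu]_x ((v x - v' x) ^+ 2) <= eps ^+ 2 / (6 * (A ^+ 2 + C)) := ltW hphi.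
have I2 : \int[mu]_x ((Lv x - Lv' x) ^+ 2) <= C * \int[mu]_x ((v x - v' x) ^+ 2).
  apply: le_trans (hC _ vv'2); apply: eq_refl_le.
  by apply: eq_Rintegral => x _; rewrite (deriv_opB cov inv).
apply: (@le_trans _ _ (3 * t ^+ 2 * ((A ^+ 2 + C) * \int[mu]_x ((v x - v' x) ^+ 2)) + c3)).
  rewrite addrA lerD2r; apply: (le_trans (lerD (lexx _) (ler_wpM2l c20 I2))).
  by rewrite /c1 /c2; apply: eq_refl_le; ring.
apply: (@le_trans _ _ (3 * t ^+ 2 * (eps ^+ 2 / 6) + 3 * t ^+ 2 * (eps ^+ 2 / 9))); last first.
  rewrite exprMn real_normK ?num_real// -mulrDr mulrC.
  have := sqr_ge0 t; have := sqr_ge0 eps; nra.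
apply: lerD; rewrite /c3.
  apply: ler_wpM2l => //; rewrite -ler_pdivlMl// mulrC -mulrA -invfM.
  exact: I1.
have kt : K * `|t| <= eps / 3.
  by have := normr_ge0 t; move: ht; lra.
have -> : 3 * (K * t ^+ 2) ^+ 2 = 3 * t ^+ 2 * (K * `|t|) ^+ 2.
  by rewrite [(K * `|t|) ^+ 2]exprMn real_normK ?num_real//; ring.
apply: ler_wpM2l => //; apply: (@le_trans _ _ ((eps / 3) ^+ 2)).
  by rewrite lerXn2r// nnegrE ?mulr_ge0// ltW// divr_gt0.
by apply: eq_refl_le; field.
Qed.
Lemma measurable_circle1 (x : S1) : measurable [set x].
Proof.
have -> : [set x] = (fun y => circle_dist y x) @^-1` [set 0].
  by apply/seteqP; split=> y /= => [->|]; [exact: circle_distxx|move/circle_dist_eq0].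
rewrite -[X in measurable X]setTI.
by apply: measurable_circle_dist => //; exact: measurable_cst.
Qed.

Lemma circle_lebesgue1 (x : S1) : circle_lebesgue R [set x] = 0%E.
Proof.
rewrite /circle_lebesgue; apply: countable_lebesgue_measure0.
apply: (@sub_countable _ _ _ (range (fun n : int => short_repr x + n%:~R))).
  apply: subset_card_le => s [/= sx _].
  have /to_circle_eq/intrP[n sn] : tc s = tc (short_repr x) by rewrite short_reprK.
  by exists n => //; rewrite -sn addrC subrK.
exact: card_le_trans (card_image_le _ _) (countableP _).
Qed.

Lemma atomless_invariant : atomless mu.
Proof.
move=> x; have [_ _ muE _] := inv; rewrite (muE _ (measurable_circle1 x)).
apply: null_set_integral; [exact: measurable_circle1| |exact: circle_lebesgue1].
by apply: measurable_funTS; apply/measurable_EFinP; exact: measurable_rho inv.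
Qed.

Lemma pushP_invariant A : measurable A -> pushP Phi mu A = mu A.
Proof.
move=> mA; rewrite pushPE; last exact: measurable_expanding cov.
by have [_ _ _ ->] := inv.
Qed.

(** [pushP Phi mu] and [mu] agree on measurable sets without being the same term, so norms, and then
    L^2_0, are carried from one to the other. *)
Lemma Lnorm_pushP_invariant f : ('N[pushP Phi mu]_2%:E[f] = 'N[mu]_2%:E[f])%E.
Proof.
rewrite unlock; congr (_ `^ _)%E.
by apply: eq_measure_integral => A mA _; exact: pushP_invariant.
Qed.

Lemma L20_pushP_invariant v : L20 mu v -> L20 (pushP Phi mu) v.
Proof.
move=> [v2 hv]; split; last first.
  by move=> eps /hv[phi]; exists phi; rewrite Lnorm_pushP_invariant.
move: v2; rewrite !inE => /andP[mv nv]; apply/andP; split=> //.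
by move: nv; rewrite !inE/= /finite_norm Lnorm_pushP_invariant.
Qed.

Lemma gateaux_derivative_expanding : gateaux_derivative (pushP Phi) mu (deriv_op Phi rho).
Proof.
split.
- exact: atomless_invariant.
- move=> x; rewrite pushP_invariant; first exact: atomless_invariant.
  exact: measurable_circle1.
- have [h1 _ [C hC]] := deriv_op_L20_operator cov inv; split.
  + by move=> v /h1; exact: L20_pushP_invariant.
  + move=> a v w /L20P[v2 _] /L20P[w2 _]; apply: aeW => x.
    exact: (deriv_opZD cov inv).
  + by exists C => v Lv; rewrite Lnorm_pushP_invariant; exact: hC.
- move=> v Lv; apply/eqoP => eps eps0.
  have [tau tau0 h] := wasserstein_deriv_op Lv eps0.
  near=> t; rewrite ger0_norm ?sqrtr_ge0//; apply: h.
  near: t; exact: (@nbhs0_le R R tau tau0).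
Unshelve. all: by end_near. Qed.

End gateaux.

Theorem theorem5p1 (R : realType) (Phi : circle R -> circle R)
    (rho : circle R -> R) (mu : probability (circle R) R)
    (Phi_C2 : map_C2 Phi) (Phi_expanding : expanding Phi)
    (mu_invariant : invariant_density Phi rho mu) :
  gateaux_derivative (pushP Phi) mu (deriv_op Phi rho) /\
  L20_adjoint mu (deriv_op Phi rho) (adjoint_op Phi).
Proof.
have [g [p [dp [xi [e [k cov]]]]]] := expanding_covering Phi_C2 Phi_expanding.
split; first exact: (gateaux_derivative_expanding cov mu_invariant).
exact: (deriv_op_L20_adjoint cov mu_invariant).
Qed.
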